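(* Let $k$ be a positive integer and let $\mathbb{C}[\mathrm{Mat}_{k\times k}]=\mathbb{C}[z_{ij}\mid 1\le i,j\le k]$ be the coordinate ring of the space of $k\times k$ complex matrices. This ring has a cluster structure whose set of coefficient and cluster variables includes all minors of a $k\times k$ matrix. That is, there is a seed $(\tilde{\mathbf{x}},\tilde B)$ in the field of fractions of $\mathbb{C}[\mathrm{Mat}_{k\times k}]$ such that $\mathcal{A}(\tilde{\mathbf{x}},\tilde B)=\mathbb{C}[\mathrm{Mat}_{k\times k}]$ and, for all $I,J\subset\{1,\dots,k\}$ with $|I|=|J|\ge1$, the minor $\Delta_{I,J}$ of the generic matrix $z=(z_{ij})$ (row set $I$, column set $J$) is either a coefficient variable or a cluster variable of $\mathcal{A}(\tilde{\mathbf{x}},\tilde B)$.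
   Context: A seed of rank $n$ in a field $\mathcal{F}\supset\mathbb{C}$ is a pair $(\tilde{\mathbf{x}},\tilde B)$ where $\tilde{\mathbf{x}}=(x_1,\dots,x_m)$, $n\le m$, is algebraically independent over $\mathbb{C}$ with $\mathcal{F}=\mathbb{C}(x_1,\dots,x_m)$, and $\tilde B=(b_{ij})$ is an $m\times n$ integer matrix whose top $n\times n$ submatrix is skew-symmetrizable. The elements $x_1,\dots,x_n$ are the cluster variables of the seed and $x_{n+1},\dots,x_m$ are the frozen (coefficient) variables. For $1\le \ell\le n$, the mutation $\mu_\ell$ replaces $x_\ell$ by $x_\ell'$ with $x_\ell x_\ell'=\prod_{b_{i\ell}>0}x_i^{b_{i\ell}}+\prod_{b_{i\ell}<0}x_i^{-b_{i\ell}}$, and $\tilde B$ by $(b'_{ij})$ with $b'_{ij}=-b_{ij}$ if $i=\ell$ or $j=\ell$, and $b'_{ij}=b_{ij}+\tfrac12(|b_{i\ell}|b_{\ell j}+b_{i\ell}|b_{\ell j}|)$ otherwise. The cluster variables of $\mathcal{A}(\tilde{\mathbf{x}},\tilde B)$ are the cluster variables of all seeds obtained from $(\tilde{\mathbf{x}},\tilde B)$ by finite sequences of mutations, and $\mathcal{A}(\tilde{\mathbf{x}},\tilde B)$ is the $\mathbb{C}$-subalgebra of $\mathcal{F}$ generated by all of them together with the frozen variables (whose inverses are not adjoined). *)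

(* Defs.v *)
From HB Require Import structures.
From mathcomp Require Import all_boot all_order all_algebra.
From mathcomp Require Import reals.
From mathcomp Require Import complex.
From mathcomp Require Import mpoly.

Set Implicit Arguments.
Unset Strict Implicit.
Unset Printing Implicit Defensive.

Import Order.TTheory GRing.Theory Num.Theory.

Local Open Scope ring_scope.

(* The m = n + f extended cluster variables are indexed by 'I_(n + f): the n
   cluster variables are [lshift f j], the f frozen ones [rshift n j], so that
   the top n x n block of the exchange matrix is [usubmx].                    *)
Record seed_data (F : fieldType) (n f : nat) := SeedData {
  seed_var : 'I_(n + f) -> F;
  seed_mx : 'M[int]_(n + f, n)
}.

Definition skew_symmetrizable (n : nat) (B : 'M[int]_n) : Prop :=
  exists d : 'I_n -> int,
    (forall i, 0 < d i) /\ (forall i j, d i * B i j = - (d j * B j i)).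

Definition alg_independent (K F : fieldType) (iota : {rmorphism K -> F})
    (m : nat) (x : 'I_m -> F) : Prop :=
  forall p : {mpoly K[m]}, mmap iota x p = 0 -> p = 0.

Definition generates_field (K F : fieldType) (iota : {rmorphism K -> F})
    (m : nat) (x : 'I_m -> F) : Prop :=
  forall y : F, exists p q : {mpoly K[m]},
    mmap iota x q != 0 /\ y = mmap iota x p / mmap iota x q.

Definition is_seed (K F : fieldType) (iota : {rmorphism K -> F})
    (n f : nat) (s : seed_data F n f) : Prop :=
  [/\ alg_independent iota (seed_var s),
      generates_field iota (seed_var s)
    & skew_symmetrizable (usubmx (seed_mx s))].

Definition mutate_var (F : fieldType) (n f : nat) (s : seed_data F n f)
    (l : 'I_n) : 'I_(n + f) -> F :=
  let x := seed_var s in let B := seed_mx s in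
  fun i => if i == lshift f l then
      (\prod_(h | 0 < B h l) x h ^+ `|B h l|%N
       + \prod_(h | B h l < 0) x h ^+ `|B h l|%N) / x (lshift f l)
    else x i.

(* The integer division by 2 is exact: |a| b + a |b| is 2 a b, 0 or - 2 a b.  *)
Definition mutate_mx (n f : nat) (B : 'M[int]_(n + f, n)) (l : 'I_n) :
    'M[int]_(n + f, n) :=
  \matrix_(i, j)
    if (i == lshift f l) || (j == l) then - B i j
    else B i j + ((`|B i l| * B (lshift f l) j
                   + B i l * `|B (lshift f l) j|) %/ 2)%Z.

Definition mutate (F : fieldType) (n f : nat) (s : seed_data F n f)
    (l : 'I_n) : seed_data F n f :=
  SeedData (mutate_var s l) (mutate_mx (seed_mx s) l).

Definition is_cluster_variable (F : fieldType) (n f : nat)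
    (s : seed_data F n f) (y : F) : Prop :=
  exists (ls : seq 'I_n) (j : 'I_n),
    y = seed_var (foldl (@mutate F n f) s ls) (lshift f j).

Definition is_frozen_variable (F : fieldType) (n f : nat)
    (s : seed_data F n f) (y : F) : Prop :=
  exists j : 'I_f, y = seed_var s (rshift n j).

Inductive generated_subalgebra (K F : fieldType) (iota : {rmorphism K -> F})
    (G : F -> Prop) : F -> Prop :=
| GenIncl y of G y : generated_subalgebra iota G y
| GenScalar c : generated_subalgebra iota G (iota c)
| GenAdd y z of generated_subalgebra iota G y & generated_subalgebra iota G z :
    generated_subalgebra iota G (y + z)
| GenMul y z of generated_subalgebra iota G y & generated_subalgebra iota G z :
    generated_subalgebra iota G (y * z).

Definition cluster_algebra (K F : fieldType) (iota : {rmorphism K -> F})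
    (n f : nat) (s : seed_data F n f) : F -> Prop :=
  generated_subalgebra iota
    (fun y => is_cluster_variable s y \/ is_frozen_variable s y).

Section MatrixSpace.
Variables (K : fieldType) (k : nat).

Definition coord_field : fieldType := {fraction {mpoly K[k * k]}}.

Definition coord_in_field : {rmorphism {mpoly K[k * k]} -> coord_field} :=
  @FracField.tofrac {mpoly K[k * k]}.

Definition scalar_in_field : {rmorphism K -> coord_field} :=
  coord_in_field \o @mpolyC (k * k) K.

Definition generic_matrix : 'M[{mpoly K[k * k]}]_k :=
  \matrix_(i, j) 'X_(mxvec_index i j).

(* [enum_val] lists the elements of a set of ordinals in increasing order.    *)
Definition generic_minor (I J : {set 'I_k}) (eIJ : #|I| = #|J|) :
    {mpoly K[k * k]} :=
  \det (mxsub enum_val (fun a => enum_val (cast_ord eIJ a)) generic_matrix).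

End MatrixSpace.

(* Main.v *)
Require Import Defs.
From HB Require Import structures.
From mathcomp Require Import all_boot all_order all_algebra.
From mathcomp Require Import reals.
From mathcomp Require Import complex.
From mathcomp Require Import mpoly.
From mathcomp Require Import perm.
From mathcomp Require Import zify ring.
From Stdlib Require Import FunctionalExtensionality.

Set Implicit Arguments.
Unset Strict Implicit.
Unset Printing Implicit Defensive.

Import Order.TTheory GRing.Theory Num.Theory.

Local Open Scope ring_scope.

(* Every double wiring diagram with [k] red and [k] blue wires gives a seed: its
   chambers carry minors, the chambers bounded on both sides are mutable, and
   each crossing contributes arrows to the quiver. Local moves of diagrams are
   mutations, by the Desnanot-Jacobi and three-term Pluecker identities; they
   connect all diagrams, and every minor is a chamber of some diagram, so every
   minor is a cluster or frozen variable. In particular the entries [z_ij] are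
   rational functions of the [k^2] variables of the initial seed, which are thus
   algebraically independent by the Jacobian criterion.

   Conversely, let [y] be a cluster variable. The initial exchange matrix is
   unimodular, so upper bounds are invariant under mutation and [y] is a Laurent
   polynomial in the variables of every seed. Take one diagram with all red
   crossings first and one with all blue crossings first: they share only frozen
   chambers, and minors are prime and pairwise non-associate, so the denominator
   of [y] is a product of frozen variables. Finally [y] takes a finite positive
   or zero value at the point where one frozen variable is [0] and the others are
   [1], so no frozen variable occurs in the denominator and [y] is a
   polynomial. *)

(** * Polynomial evaluation and generated subalgebras *)

(** A circularity fixes the order of the argument. The theory of mutations wants independent initial
    variables, but their independence is read off from the entries [z_ij], which appear only after
    mutations. So diagrams are followed through mutations first, under the sole hypothesis that the
    minors are nonzero; every variable met is a rational function of the initial ones by its very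
    formula, and independence comes afterwards.

    For the inclusion in the polynomial ring it would be natural to test all neighbours of one seed.
    But a mutable chamber need not be the centre of a local move, and then its mutation has no ready
    determinantal formula. Expansions at two distant seeds are compared instead, which is why the
    Laurent phenomenon is proved at every seed. Unimodularity enters there: when two directions are
    not joined by an arrow, their exchange binomials might share a factor, and an integer weight
    that separates the two columns excludes this. *)

Lemma mpoly_alg_ind (R : comNzRingType) (m : nat) (P : {mpoly R[m]} -> Prop) :
  (forall c, P c%:MP) -> (forall i, P 'X_i) ->
  (forall p q, P p -> P q -> P (p + q)) ->
  (forall p q, P p -> P q -> P (p * q)) -> forall p, P p.
Proof.
move=> PC PX PD PM; have PXm mm : P 'X_[mm].
  rewrite mpolyXE_id; apply: (big_ind P) => //; first exact: PC.
  move=> i _; elim: (mm i) => [|e IH]; first by rewrite expr0; exact: PC.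
  by rewrite exprS; apply: PM.
elim/mpolyind => [|c mm p _ _ Pp]; first by rewrite -(mpolyC0 m R); exact: PC.
by apply: PD => //; rewrite -mul_mpolyC; apply: PM.
Qed.

(* The multinomials lemmas see the ground morphism of [mmap] as an additive
   map; stating them for [iota] itself keeps rewriting syntactic. *)
Section MmapMorphism.
Variables (K F : comNzRingType) (iota : {rmorphism K -> F}) (m : nat).
Implicit Types (x : 'I_m -> F) (p q : {mpoly K[m]}).

Lemma mmap_add x p q : mmap iota x (p + q) = mmap iota x p + mmap iota x q.
Proof. exact: mmapD. Qed.

Lemma mmap_sub x p q : mmap iota x (p - q) = mmap iota x p - mmap iota x q.
Proof. exact: mmapB. Qed.

Lemma mmap_mul x p q : mmap iota x (p * q) = mmap iota x p * mmap iota x q.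
Proof. exact: rmorphM. Qed.

Lemma mmap_exp x p e : mmap iota x (p ^+ e) = mmap iota x p ^+ e.
Proof. exact: rmorphXn. Qed.

Lemma mmap_const x c : mmap iota x c%:MP = iota c.
Proof. exact: mmapC. Qed.

Lemma mmap_var x i : mmap iota x 'X_i = x i.
Proof. by rewrite mmapX mmap1U. Qed.

Lemma mmap_zero x : mmap iota x 0 = 0.
Proof. exact: mmap0. Qed.

Lemma mmap_one x : mmap iota x 1 = 1.
Proof. exact: rmorph1. Qed.

Lemma mmap_prod x (I : Type) (r : seq I) (P : pred I) (E : I -> {mpoly K[m]}) :
  mmap iota x (\prod_(i <- r | P i) E i) =
  \prod_(i <- r | P i) mmap iota x (E i).
Proof. exact: rmorph_prod. Qed.

Lemma mmap_prod_var x (P : pred 'I_m) :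
  mmap iota x (\prod_(h | P h) 'X_h) = \prod_(h | P h) x h.
Proof. by rewrite mmap_prod; apply: eq_bigr => h _; rewrite mmap_var. Qed.

Lemma eq_mmap x x' p : x =1 x' -> mmap iota x p = mmap iota x' p.
Proof.
by move=> e; apply: eq_bigr => mm _; congr (_ * _); apply: mmap1_eq.
Qed.

End MmapMorphism.

Section Subalgebra.
Variables (K F : fieldType) (iota : {rmorphism K -> F}).
Implicit Types (G : F -> Prop).

Notation subalg := (generated_subalgebra iota).

Lemma subalg_sub G G' y :
  (forall z, G z -> subalg G' z) -> subalg G y -> subalg G' y.
Proof.
move=> sGG'; elim=> [z /sGG' // | c | z1 z2 _ h1 _ h2 | z1 z2 _ h1 _ h2].
- exact: GenScalar.
- exact: GenAdd.
- exact: GenMul.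
Qed.

Variable G : F -> Prop.

Lemma subalg0 : subalg G 0.
Proof. by rewrite -(rmorph0 iota); apply: GenScalar. Qed.

Lemma subalg1 : subalg G 1.
Proof. by rewrite -(rmorph1 iota); apply: GenScalar. Qed.

Lemma subalgN y : subalg G y -> subalg G (- y).
Proof.
move=> Gy; rewrite -mulN1r -(rmorph1 iota) -rmorphN.
by apply: GenMul => //; apply: GenScalar.
Qed.

Lemma subalgX y e : subalg G y -> subalg G (y ^+ e).
Proof.
move=> Gy; elim: e => [|e IH]; first by rewrite expr0; apply: subalg1.
by rewrite exprS; apply: GenMul.
Qed.

Lemma subalg_prod (I : Type) (r : seq I) (P : pred I) (E : I -> F) :
  (forall i, P i -> subalg G (E i)) -> subalg G (\prod_(i <- r | P i) E i).
Proof.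
move=> GE; apply: (big_ind (subalg G)) => //; first exact: subalg1.
by move=> *; apply: GenMul.
Qed.

Lemma subalg_sum (I : Type) (r : seq I) (P : pred I) (E : I -> F) :
  (forall i, P i -> subalg G (E i)) -> subalg G (\sum_(i <- r | P i) E i).
Proof.
move=> GE; apply: (big_ind (subalg G)) => //; first exact: subalg0.
by move=> *; apply: GenAdd.
Qed.

Lemma subalg_mmap m (x : 'I_m -> F) (p : {mpoly K[m]}) :
  (forall i, subalg G (x i)) -> subalg G (mmap iota x p).
Proof.
move=> Gx; elim/mpoly_alg_ind: p => [c | i | p q | p q].
- by rewrite mmap_const; apply: GenScalar.
- by rewrite mmap_var.
- by rewrite mmap_add; apply: GenAdd.
- by rewrite mmap_mul; apply: GenMul.
Qed.

(** Compares two rings that differ by the inverse of one variable [z]: it suffices to clear powers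
    of [z] from the generators, because a common exponent serves sums and products. *)
Lemma subalg_denominator G' z y :
  subalg G z -> (forall g, G' g -> exists a, subalg G (z ^+ a * g)) ->
  subalg G' y -> exists a, subalg G (z ^+ a * y).
Proof.
move=> Gz hG; elim=> [g /hG // | c | y1 y2 _ [a ha] _ [b hb]
                     | y1 y2 _ [a ha] _ [b hb]].
- by exists 0%N; rewrite mul1r; apply: GenScalar.
- exists (a + b)%N; rewrite mulrDr exprD; apply: GenAdd.
    rewrite mulrAC [_ * _ ^+ b]mulrC; apply: GenMul => //; exact: subalgX.
  by rewrite -mulrA; apply: GenMul => //; apply: subalgX.
- by exists (a + b)%N; rewrite exprD mulrACA; apply: GenMul.
Qed.

(** Regularity is local: [a] and [b] generate the unit ideal, so the two principal localisations
    cover. Lowering the exponents one at a time avoids expanding a power of the relation. *)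
Lemma subalg_comaximal (a b s t y : F) :
  subalg G a -> subalg G b -> subalg G s -> subalg G t ->
  s * a + t * b = 1 -> forall i j, subalg G (a ^+ i * y) ->
  subalg G (b ^+ j * y) -> subalg G y.
Proof.
move=> Ga Gb Gs Gt e1; have step z j : subalg G (a * z) ->
    subalg G (b ^+ j * z) -> subalg G z.
  move=> Gaz; elim: j => [|j IH]; first by rewrite mul1r.
  move=> Gbz; apply: IH.
  have -> : b ^+ j * z = s * b ^+ j * (a * z) + t * (b ^+ j.+1 * z).
    rewrite -[LHS]mul1r -e1 exprS; ring.
  by apply: GenAdd; apply: GenMul => //; apply: GenMul => //; apply: subalgX.
elim=> [|i IH] j; first by rewrite mul1r.
rewrite exprS -mulrA => Gay Gby; apply: (IH j) => //.
apply: (step _ j) => //; rewrite mulrCA.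
by apply: GenMul => //; apply: subalgX.
Qed.

End Subalgebra.

(** * Mutations *)

Definition pos_part (b : int) : nat := if 0 < b then `|b|%N else 0%N.

Definition pos_monomial (F : fieldType) (m : nat) (x : 'I_m -> F)
  (c : 'I_m -> int) : F := \prod_h x h ^+ pos_part (c h).

Definition binomial_of (F : fieldType) (m : nat) (x : 'I_m -> F)
  (c : 'I_m -> int) : F := pos_monomial x c + pos_monomial x (fun h => - c h).

Lemma pos_part_le0 b : b <= 0 -> pos_part b = 0%N.
Proof. by rewrite /pos_part ltNge => ->. Qed.

Lemma pos_part_nat (b : nat) : pos_part b%:Z = b.
Proof. by rewrite /pos_part; case: ifP => //; lia. Qed.

Lemma pos_partB b : (pos_part b)%:Z - (pos_part (- b))%:Z = b.
Proof. by rewrite /pos_part; case: ifP; case: ifP; lia. Qed.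

Lemma pos_monomial_neq0 (F : fieldType) m (x : 'I_m -> F) c :
  (forall h, x h != 0) -> pos_monomial x c != 0.
Proof. by move=> x0; apply/prodf_neq0 => h _; rewrite expf_neq0. Qed.

Section MutationMatrix.
Variables n f : nat.
Implicit Types l : 'I_n.

Definition skew_principal (B : 'M[int]_(n + f, n)) : Prop :=
  forall i j : 'I_n, B (lshift f i) j = - B (lshift f j) i.

Lemma skew_principal_diag B i : skew_principal B -> B (lshift f i) i = 0.
Proof. by move=> /(_ i i); lia. Qed.

(** Puts the halved term of the mutation rule into positive and negative parts, so that later matrix
    identities contain no integer division. *)
Lemma avg_abs_mul (a b : int) : ((`|a| * b + a * `|b|) %/ 2)%Z =
  (pos_part a)%:Z * (pos_part b)%:Z - (pos_part (- a))%:Z * (pos_part (- b))%:Z.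
Proof.
set g := RHS; suff -> : `|a| * b + a * `|b| = g * 2 by rewrite mulzK.
have sgn (c : int) : exists d : nat, c = d%:Z \/ c = - d%:Z.
  by exists `|c|%N; lia.
rewrite /g; have [d [] ->] := sgn a; have [e [] ->] := sgn b;
  rewrite ?opprK !pos_part_nat ?(@pos_part_le0 (- _%:Z)) //; nia.
Qed.

Lemma mutate_mxE (B : 'M[int]_(n + f, n)) l i j :
  i != lshift f l -> j != l -> mutate_mx B l i j = B i j +
    ((pos_part (B i l))%:Z * (pos_part (B (lshift f l) j))%:Z
     - (pos_part (- B i l))%:Z * (pos_part (- B (lshift f l) j))%:Z).
Proof.
by move=> /negPf il /negPf jl; rewrite mxE il jl /= avg_abs_mul.
Qed.

Lemma mutate_mx_flip (B : 'M[int]_(n + f, n)) l i j :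
  (i == lshift f l) || (j == l) -> mutate_mx B l i j = - B i j.
Proof. by rewrite mxE => ->. Qed.

Lemma mutate_mxN (B : 'M[int]_(n + f, n)) l :
  mutate_mx (- B) l = - mutate_mx B l.
Proof.
apply/matrixP => i j; rewrite [RHS]mxE.
have [h|] := boolP ((i == lshift f l) || (j == l)).
  by rewrite !mutate_mx_flip // !mxE.
rewrite negb_or => /andP[hi hj]; rewrite !mutate_mxE // !mxE !opprK; ring.
Qed.

Lemma lshift_eq (i j : 'I_n) : (lshift f i == lshift f j) = (i == j).
Proof. by rewrite (inj_eq (@lshift_inj _ _)). Qed.

Lemma mutate_skew (B : 'M[int]_(n + f, n)) l :
  skew_principal B -> skew_principal (mutate_mx B l).
Proof.
move=> sk i j; have [/orP h|] := boolP ((i == l) || (j == l)).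
  rewrite !mutate_mx_flip ?lshift_eq; first by rewrite sk.
    by case: h => ->; rewrite ?orbT.
  by case: h => ->; rewrite ?orbT.
rewrite negb_or => /andP[hi hj]; rewrite !mutate_mxE ?lshift_eq //.
rewrite (sk l j) (sk l i) (sk i j) !opprK; ring.
Qed.

(** Surjectivity of the transpose of [B] over the integers: weights of the variables exist with any
    prescribed degrees along the columns. *)
Definition unimodular (B : 'M[int]_(n + f, n)) : Prop :=
  forall v : 'I_n -> int, exists w : 'I_(n + f) -> int,
    forall j, \sum_i w i * B i j = v j.

(** The mutated matrix is the product [E B F] for integer involutions [E] and [F] that differ from
    the identity only in column and row [l] respectively. So [B] is solved for the vector [v F], and
    a solution [w] is turned into [w E]. *)
Lemma mutate_unimodular (B : 'M[int]_(n + f, n)) l :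
  B (lshift f l) l = 0 -> unimodular B -> unimodular (mutate_mx B l).
Proof.
move=> b0 uB v; set L := lshift f l.
have [w hw] := uB (fun j => if j == l then - v l
  else v j + v l * (pos_part (- B L j))%:Z).
exists (fun i => if i == L
  then \sum_(h | h != L) w h * (pos_part (B h l))%:Z - w L else w i) => j.
rewrite (bigD1 L) //= eqxx mutate_mx_flip ?eqxx //.
under [X in _ + X = _]eq_bigr => i /negPf -> do [].
have [->|jl] := eqVneq j l.
  rewrite b0 oppr0 mulr0 add0r.
  rewrite (eq_bigr (fun i => - (w i * B i l))); last first.
    by move=> i _; rewrite mutate_mx_flip ?eqxx ?orbT // mulrN.
  by rewrite sumrN; have := hw l; rewrite eqxx (bigD1 L) //= b0 mulr0 add0r => ->;
     rewrite opprK.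
have hl := hw l; rewrite eqxx (bigD1 L) //= b0 mulr0 add0r in hl.
have hj := hw j; rewrite (negPf jl) (bigD1 L) //= in hj.
rewrite [X in _ + X = _](eq_bigr (fun i => w i * B i j
   + (w i * (pos_part (B i l))%:Z) * B L j
   + (w i * B i l) * (pos_part (- B L j))%:Z)); last first.
  move=> i iL; rewrite mutate_mxE // -[B L j in LHS]opprK.
  have := pos_partB (B L j); have := pos_partB (B i l); rewrite opprK -/L.
  move: (pos_part _) (pos_part _) (pos_part _) (pos_part _) => a b c d <- <-.
  ring.
rewrite !big_split /= -!mulr_suml hl.
transitivity (w L * B L j + \sum_(i | i != L) w i * B i j
   - v l * (pos_part (- B L j))%:Z); first ring.
by rewrite hj; ring.
Qed.

End MutationMatrix.

Section Mutation.
Variables (K F : fieldType) (iota : {rmorphism K -> F}) (n f : nat).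
Implicit Types (s : seed_data F n f) (l : 'I_n).

Lemma mutate_varE s l : mutate_var s l (lshift f l) =
  binomial_of (seed_var s) (fun h => seed_mx s h l) / seed_var s (lshift f l).
Proof.
rewrite /mutate_var eqxx; congr ((_ + _) / _); rewrite /pos_monomial big_mkcond;
  apply: eq_bigr => h _; rewrite /pos_part ?oppr_gt0; case: ifP => //.
by rewrite abszN.
Qed.

Lemma mutate_var_id s l h : h != lshift f l -> mutate_var s l h = seed_var s h.
Proof. by rewrite /mutate_var => /negPf ->. Qed.

Lemma mutate_varM s l : seed_var s (lshift f l) != 0 ->
  seed_var s (lshift f l) * mutate_var s l (lshift f l) =
  binomial_of (seed_var s) (fun h => seed_mx s h l).
Proof. by move=> nz; rewrite mutate_varE mulrC divfK. Qed.

Lemma binomial_of_eq m (x x' : 'I_m -> F) c :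
  (forall h, c h != 0 -> x h = x' h) -> binomial_of x c = binomial_of x' c.
Proof.
move=> ex; congr (_ + _); apply: eq_bigr => h _.
  by have [->|/ex ->//] := eqVneq (c h) 0.
by have [->|/ex ->//] := eqVneq (c h) 0.
Qed.

Lemma mutate_var_binomial s l : seed_mx s (lshift f l) l = 0 ->
  binomial_of (mutate_var s l) (fun h => seed_mx s h l) =
  binomial_of (seed_var s) (fun h => seed_mx s h l).
Proof.
move=> b0; apply: binomial_of_eq => h ch; apply: mutate_var_id.
by apply: contraNneq ch => ->; rewrite b0.
Qed.

Lemma mutate_varK s l : seed_mx s (lshift f l) l = 0 ->
  seed_var s (lshift f l) != 0 -> mutate_var s l (lshift f l) != 0 ->
  mutate_var (SeedData (mutate_var s l) (seed_mx s)) l =1 seed_var s.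
Proof.
move=> b0 nz nz' h; have [->|hl] := eqVneq h (lshift f l); last first.
  by rewrite mutate_var_id //= mutate_var_id.
rewrite mutate_varE /= mutate_var_binomial //.
by rewrite -mutate_varM // mulfK.
Qed.

Lemma alg_independent_neq0 m (x : 'I_m -> F) h :
  alg_independent iota x -> x h != 0.
Proof.
move=> ai; apply/eqP => xh0.
have /ai/(congr1 (meval (fun _ => 1))) : mmap iota x 'X_h = 0.
  by rewrite mmap_var.
by rewrite mevalXU meval0 => /eqP; rewrite oner_eq0.
Qed.

Lemma mmap_prodX m (x : 'I_m -> F) (e : 'I_m -> nat) :
  mmap iota x (\prod_h 'X_h ^+ e h) = \prod_h x h ^+ e h.
Proof.
rewrite mmap_prod; apply: eq_bigr => h _.
by rewrite mmap_exp mmap_var.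
Qed.

Lemma mmap_binomial m (c : 'I_m -> int) : exists p : {mpoly K[m]},
  forall x, mmap iota x p = binomial_of x c.
Proof.
exists (\prod_h 'X_h ^+ pos_part (c h) + \prod_h 'X_h ^+ pos_part (- c h)) => x.
by rewrite mmap_add !mmap_prodX.
Qed.

(** The polynomial [q] is chosen before [x], so that it can be evaluated at a seed and also at the
    mutated seed. *)
Lemma mutate_clear_denominator (B : 'M[int]_(n + f, n)) l
    (p : {mpoly K[n + f]}) :
  exists (N : nat) (q : {mpoly K[n + f]}), forall x : 'I_(n + f) -> F,
    x (lshift f l) != 0 -> mmap iota x q =
    x (lshift f l) ^+ N * mmap iota (mutate_var (SeedData x B) l) p.
Proof.
elim/mpoly_alg_ind: p => [c | h | p1 p2 [N1 [q1 h1]] [N2 [q2 h2]]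
                         | p1 p2 [N1 [q1 h1]] [N2 [q2 h2]]].
- by exists 0%N, c%:MP => x _; rewrite !mmap_const mul1r.
- have [->|hl] := eqVneq h (lshift f l).
    have [q hq] := mmap_binomial (fun h => B h l).
    exists 1%N, q => x nz; rewrite hq mmap_var.
    by rewrite expr1 (@mutate_varM (SeedData x B)).
  exists 0%N, 'X_h => x nz; rewrite !mmap_var mul1r.
  by rewrite mutate_var_id.
- exists (N1 + N2)%N, ('X_(lshift f l) ^+ N2 * q1 + 'X_(lshift f l) ^+ N1 * q2).
  move=> x nz; rewrite !mmap_add !mmap_mul !mmap_exp !mmap_var.
  by rewrite h1 // h2 // exprD mulrDr !mulrA [_ ^+ N1 * _ ^+ N2]mulrC.
- exists (N1 + N2)%N, (q1 * q2) => x nz.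
  by rewrite !mmap_mul h1 // h2 // exprD mulrACA.
Qed.

Hypothesis two_neq0 : 2%:R != 0 :> K.

(** As a polynomial, the binomial takes the value 2 at the all-ones point. *)
Lemma binomial_of_neq0 m (x : 'I_m -> F) (c : 'I_m -> int) :
  alg_independent iota x -> binomial_of x c != 0.
Proof.
move=> ai; apply/eqP.
rewrite /binomial_of /pos_monomial -!mmap_prodX -mmap_add => /ai.
move/(congr1 (meval (fun _ => 1))); rewrite mevalD meval0.
rewrite !rmorph_prod /= !big1 => [|h _|h _]; last 2 first.
- by rewrite rmorphXn /= mevalXU expr1n.
- by rewrite rmorphXn /= mevalXU expr1n.
by apply/eqP; rewrite -(natrD _ 1 1).
Qed.

(** Clearing denominators in a relation [p] among the new variables gives a relation [q] among the
    old ones, so [q = 0]. Evaluated at the new variables, whose mutation gives back the old ones,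
    [q = 0] says that [p] vanishes at the old variables. *)
Lemma mutate_var_alg_independent s l : seed_mx s (lshift f l) l = 0 ->
  alg_independent iota (seed_var s) -> alg_independent iota (mutate_var s l).
Proof.
move=> b0 ai p p0; have nz h := @alg_independent_neq0 _ _ h ai.
have [N [q hq]] := mutate_clear_denominator (seed_mx s) l p.
have q0 : q = 0.
  by apply: ai; rewrite hq //; case: (s) p0 => x B /= ->; rewrite mulr0.
have nz' : mutate_var s l (lshift f l) != 0.
  by rewrite mutate_varE mulf_neq0 ?invr_neq0 // binomial_of_neq0.
apply: ai; have := hq (mutate_var s l); rewrite q0 mmap_zero => /(_ nz')/esym/eqP.
rewrite mulf_eq0 expf_eq0 (negPf nz') andbF /= => /eqP.
by rewrite (eq_mmap _ _ (mutate_varK b0 (nz _) nz')).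
Qed.

End Mutation.

(** * Upper bounds and the Laurent phenomenon *)

Section UpperBound.
Variables (K F : fieldType) (iota : {rmorphism K -> F}) (n f : nat).
Hypothesis two_neq0 : 2%:R != 0 :> K.
Implicit Types (s : seed_data F n f) (i l : 'I_n).

Notation subalg := (generated_subalgebra iota).

Definition exchange_gen s i (y : F) : Prop :=
  [\/ y = seed_var s (lshift f i), y = mutate_var s i (lshift f i)
    | exists2 h, h != lshift f i &
        y = seed_var s h \/ y = (seed_var s h)^-1].

(* The intersection of these rings over all [i] is the upper bound of Berenstein,
   Fomin and Zelevinsky, with inverted frozen variables. *)
Definition exchange_ring s i : F -> Prop := subalg (exchange_gen s i).

Definition good_seed s : Prop :=
  [/\ alg_independent iota (seed_var s), skew_principal (seed_mx s)
    & unimodular (seed_mx s)].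

Lemma good_seed_mutate s l : good_seed s -> good_seed (mutate s l).
Proof.
case=> ai sk un; have b0 := skew_principal_diag l sk.
split; first exact: mutate_var_alg_independent.
  exact: mutate_skew sk.
exact: mutate_unimodular b0 un.
Qed.

Definition opp_seed s : seed_data F n f := SeedData (seed_var s) (- seed_mx s).

Lemma binomial_of_opp m (x : 'I_m -> F) c :
  binomial_of x (fun h => - c h) = binomial_of x c.
Proof.
rewrite /binomial_of addrC; congr (_ + _).
by apply: eq_bigr => h _; rewrite opprK.
Qed.

Lemma mutate_var_opp s l : mutate_var (opp_seed s) l = mutate_var s l.
Proof.
apply: functional_extensionality => h.
have [->|hl] := eqVneq h (lshift f l); last by rewrite !mutate_var_id.
rewrite !mutate_varE /= -(binomial_of_opp _ (fun h => seed_mx s h l)).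
by congr (_ / _); congr (_ + _); apply: eq_bigr => i _; rewrite !mxE.
Qed.

Lemma mutate_opp s l : mutate (opp_seed s) l = opp_seed (mutate s l).
Proof. by rewrite /mutate mutate_var_opp /opp_seed /= mutate_mxN. Qed.

Lemma exchange_ring_opp s i y :
  exchange_ring (opp_seed s) i y <-> exchange_ring s i y.
Proof. by rewrite /exchange_ring /exchange_gen mutate_var_opp. Qed.

Lemma exchange_ring_self s i : exchange_ring s i (seed_var s (lshift f i)).
Proof. by apply: GenIncl; constructor 1. Qed.

Lemma exchange_ring_mutated s i :
  exchange_ring s i (mutate_var s i (lshift f i)).
Proof. by apply: GenIncl; constructor 2. Qed.

Lemma exchange_ring_other s i h : h != lshift f i ->
  exchange_ring s i (seed_var s h).
Proof. by move=> hi; apply: GenIncl; constructor 3; exists h => //; left. Qed.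

Lemma exchange_ring_inv s i h : h != lshift f i ->
  exchange_ring s i (seed_var s h)^-1.
Proof. by move=> hi; apply: GenIncl; constructor 3; exists h => //; right. Qed.

Lemma exchange_ring_var s i h : exchange_ring s i (seed_var s h).
Proof.
have [->|] := eqVneq h (lshift f i); first exact: exchange_ring_self.
exact: exchange_ring_other.
Qed.

Lemma exchange_ring_mutate_same s l y : good_seed s ->
  exchange_ring s l y -> exchange_ring (mutate s l) l y.
Proof.
case=> ai sk _; have nz := fun h => @alg_independent_neq0 _ _ iota _ _ h ai.
have b0 := skew_principal_diag l sk.
have nz' : mutate_var s l (lshift f l) != 0.
  by apply: alg_independent_neq0 (mutate_var_alg_independent two_neq0 b0 ai).
apply: subalg_sub => z [-> | -> | [h hl [->|->]]].
- rewrite -(mutate_varK b0 (nz _) nz').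
  have -> : mutate_var (SeedData (mutate_var s l) (seed_mx s)) l (lshift f l)
    = mutate_var (mutate s l) l (lshift f l).
    rewrite !mutate_varE /= -[in LHS]binomial_of_opp; congr (_ / _).
    by congr (_ + _); apply: eq_bigr => h _; rewrite mutate_mx_flip ?eqxx ?orbT.
  exact: exchange_ring_mutated.
- exact: (exchange_ring_self (mutate s l) l).
- by have := @exchange_ring_other (mutate s l) l h hl; rewrite /= mutate_var_id.
- by have := @exchange_ring_inv (mutate s l) l h hl; rewrite /= mutate_var_id.
Qed.

Definition laurent m (x : 'I_m -> F) (y : F) : Prop :=
  exists N p, y * (\prod_h x h) ^+ N = mmap iota x p.

Lemma laurent_subalg m (x : 'I_m -> F) (G : F -> Prop) y :
  (forall g, G g -> laurent x g) -> subalg G y -> laurent x y.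
Proof.
move=> GL; elim=> [z /GL // | c | y1 y2 _ [N1 [p1 h1]] _ [N2 [p2 h2]]
                   | y1 y2 _ [N1 [p1 h1]] _ [N2 [p2 h2]]].
- by exists 0%N, c%:MP; rewrite mulr1 mmap_const.
- exists (N1 + N2)%N, ((\prod_h 'X_h) ^+ N2 * p1 + (\prod_h 'X_h) ^+ N1 * p2).
  rewrite mmap_add !mmap_mul !mmap_exp mmap_prod_var -h1 -h2 exprD; ring.
- exists (N1 + N2)%N, (p1 * p2).
  by rewrite mmap_mul -h1 -h2 exprD mulrACA.
Qed.

Lemma exchange_ring_laurent s i y : (forall h, seed_var s h != 0) ->
  exchange_ring s i y -> laurent (seed_var s) y.
Proof.
move=> nz; have lv h : laurent (seed_var s) (seed_var s h).
  by exists 0%N, 'X_h; rewrite mulr1 mmap_var.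
have lV h : laurent (seed_var s) (seed_var s h)^-1.
  exists 1%N, (\prod_(h' | h' != h) 'X_h'); rewrite mmap_prod_var (bigD1 h) //=.
  by rewrite expr1 mulKf.
apply: laurent_subalg => g [-> // | -> | [h _ [->|->]] //].
have [q hq] := mmap_binomial iota (fun h => seed_mx s h i).
exists 1%N, (q * \prod_(h' | h' != lshift f i) 'X_h').
rewrite mmap_mul hq -mutate_varM // mmap_prod_var.
by rewrite (bigD1 (lshift f i)) //= expr1; ring.
Qed.

Lemma prod_expz (I : Type) (r : seq I) (P : pred I) (a : F) (w : I -> int) :
  a != 0 -> \prod_(i <- r | P i) a ^ w i = a ^ (\sum_(i <- r | P i) w i).
Proof.
move=> nz; elim: r => [|i r IH]; first by rewrite !big_nil expr0z.
by rewrite !big_cons; case: ifP => // _; rewrite expfzDr // IH.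
Qed.

(** A one-parameter torus acting with weights [w] scales the ratio of the two monomials by the
    degree of the column [c]; the rest is a common factor. *)
Lemma binomial_of_twist m (y : 'I_m -> F) (a : F) (w c : 'I_m -> int) : a != 0 ->
  exists e : int, binomial_of (fun h => y h * a ^ w h) c = a ^ e *
    (pos_monomial y c * a ^ (\sum_h w h * c h) +
     pos_monomial y (fun h => - c h)).
Proof.
move=> nz; have twist d : pos_monomial (fun h => y h * a ^ w h) d =
    pos_monomial y d * a ^ (\sum_h w h * (pos_part (d h))%:Z).
  rewrite -prod_expz // -big_split /=; apply: eq_bigr => h _.
  by rewrite exprMn -exprz_exp.
exists (\sum_h w h * (pos_part (- c h))%:Z); rewrite /binomial_of !twist.
rewrite mulrDr [_ * pos_monomial _ (fun _ => _)]mulrC; congr (_ + _).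
rewrite mulrCA -expfzDr // -big_split /=; congr (_ * _ ^ _).
apply: eq_bigr => h _; rewrite -mulrDr; congr (_ * _).
by have := pos_partB (c h); lia.
Qed.

(** * The exchange ring in direction [i] after a mutation in another direction [l] *)

Section TwoDirections.
Variables (s : seed_data F n f) (l i : 'I_n).
Hypothesis good_s : good_seed s.
Hypothesis neq_li : l != i.

Let x := seed_var s.
Let B := seed_mx s.
Let L := lshift f l.
Let I := lshift f i.
Let xl' := mutate_var s l L.
Let xi' := mutate_var s i I.
Let xi'' := mutate_var (mutate s l) i I.
Let T := exchange_ring (mutate s l) i.

Let neq_LI : L != I. Proof. by rewrite lshift_eq. Qed.
Let neq_IL : I != L. Proof. by rewrite eq_sym. Qed.

Let x_neq0 h : x h != 0.
Proof. by case: good_s => ai _ _; apply: alg_independent_neq0 ai. Qed.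

Let mutate_neq0 j h : mutate_var s j h != 0.
Proof.
by case: (good_seed_mutate j good_s) => ai _ _; apply: alg_independent_neq0 ai.
Qed.

Let TD a b : T a -> T b -> T (a + b). Proof. exact: GenAdd. Qed.
Let TM a b : T a -> T b -> T (a * b). Proof. exact: GenMul. Qed.
Let TX a e : T a -> T (a ^+ e). Proof. exact: subalgX. Qed.
Let Tsum m (E : 'I_m -> F) : (forall j, T (E j)) -> T (\sum_j E j).
Proof. by move=> TE; rewrite /T /exchange_ring; apply: subalg_sum => j _; apply: TE. Qed.
Let TN a : T a -> T (- a). Proof. exact: subalgN. Qed.

Let Txl' : T xl'.
Proof. exact: (@exchange_ring_other (mutate s l) i L). Qed.

Let Txl'V : T xl'^-1.
Proof. exact: (@exchange_ring_inv (mutate s l) i L). Qed.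

Let Txi : T (x I).
Proof.
by have := exchange_ring_self (mutate s l) i; rewrite /= mutate_var_id.
Qed.

Let Tx h : h != L -> T (x h).
Proof.
by move=> hL; have := exchange_ring_var (mutate s l) i h;
  rewrite /= mutate_var_id.
Qed.

Let TxV h : h != L -> h != I -> T (x h)^-1.
Proof.
by move=> hL hI; have := @exchange_ring_inv (mutate s l) i h hI;
  rewrite /= mutate_var_id.
Qed.

Let mono (e : 'I_(n + f) -> nat) : F :=
  \prod_(h | (h != L) && (h != I)) x h ^+ e h.

Let mono_neq0 e : mono e != 0.
Proof. by apply/prodf_neq0 => h _; rewrite expf_neq0. Qed.

Let Tmono e : T (mono e).
Proof. by apply: subalg_prod => h /andP[hL hI]; apply: TX; apply: Tx. Qed.

Let TmonoV e : T (mono e)^-1.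
Proof.
rewrite /mono -prodfV; apply: subalg_prod => h /andP[hL hI].
by rewrite -exprVn; apply: TX; apply: TxV.
Qed.

Let pos_monomial_split (c : 'I_(n + f) -> int) (y : 'I_(n + f) -> F) :
  (forall h, h != L -> h != I -> y h = x h) ->
  pos_monomial y c = y L ^+ pos_part (c L) * (y I ^+ pos_part (c I) *
    mono (fun h => pos_part (c h))).
Proof.
move=> exy; rewrite /pos_monomial (bigD1 L) //= (bigD1 I) //=.
by congr (_ * (_ * _)); apply: eq_bigr => h /andP[hL hI]; rewrite exy.
Qed.

Let exchange_l : x L * xl' =
  x I ^+ pos_part (B I l) * mono (fun h => pos_part (B h l)) +
  x I ^+ pos_part (- B I l) * mono (fun h => pos_part (- B h l)).
Proof.
case: (good_s) => _ sk _; rewrite mutate_varM ?x_neq0 // /binomial_of.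
by rewrite !pos_monomial_split // skew_principal_diag // oppr0 !mul1r.
Qed.

Let exchange_i : x I * xi' =
  x L ^+ pos_part (B L i) * mono (fun h => pos_part (B h i)) +
  x L ^+ pos_part (- B L i) * mono (fun h => pos_part (- B h i)).
Proof.
case: (good_s) => _ sk _; rewrite mutate_varM ?x_neq0 // /binomial_of.
by rewrite !pos_monomial_split // [B I i]skew_principal_diag // oppr0 !mul1r.
Qed.

Let exchange_i' : x I * xi'' =
  xl' ^+ pos_part (- B L i) * mono (fun h => pos_part (mutate_mx B l h i)) +
  xl' ^+ pos_part (B L i) * mono (fun h => pos_part (- mutate_mx B l h i)).
Proof.
have xI : x I = seed_var (mutate s l) I by rewrite /= mutate_var_id.
rewrite xI mutate_varM -?xI ?x_neq0 // /binomial_of.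
have [_ sk _] := good_seed_mutate l good_s.
rewrite !pos_monomial_split; last 2 first.
- by move=> h hL _; rewrite /= mutate_var_id.
- by move=> h hL _; rewrite /= mutate_var_id.
rewrite [seed_mx _ I i]skew_principal_diag // oppr0 !mul1r.
by rewrite /= -/L (@mutate_mx_flip n f B l L i) ?eqxx // opprK.
Qed.

Let Txl : T (x L).
Proof.
have -> : x L = xl'^-1 * (x L * xl') by rewrite mulrCA mulVf ?mulr1 ?mutate_neq0.
rewrite exchange_l; apply: TM => //.
by apply: TD; apply: TM => //; apply: TX.
Qed.

Let denominator_I y : exchange_ring s l y -> exists a, T (x I ^+ a * y).
Proof.
apply: subalg_denominator => // g [-> | -> | [h hL [->|->]]].
- by exists 0%N; rewrite mul1r.
- by exists 0%N; rewrite mul1r.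
- by exists 0%N; rewrite mul1r; apply: Tx.
have [->|hI] := eqVneq h I.
  by exists 1%N; rewrite expr1 mulfV ?x_neq0 //; apply: subalg1.
by exists 0%N; rewrite mul1r; apply: TxV.
Qed.

Let denominator_L y :
  T xi' -> exchange_ring s i y -> exists a, T (x L ^+ a * y).
Proof.
move=> Txi'; apply: subalg_denominator => // g [-> | -> | [h hI [->|->]]].
- by exists 0%N; rewrite mul1r.
- by exists 0%N; rewrite mul1r.
- exists 0%N; rewrite mul1r.
  by have [->|hL] := eqVneq h L; [exact: Txl | apply: Tx].
have [->|hL] := eqVneq h L.
  by exists 1%N; rewrite expr1 mulfV ?x_neq0 //; apply: subalg1.
by exists 0%N; rewrite mul1r; apply: TxV.
Qed.

(** When the directions are joined, the exchange relation of [l] writes the unit [Mp] as a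
    combination of [x L] and [x I], so these are comaximal in [T]. A power of [x I] carries [y] into
    [T] because [y] is in the ring of direction [l], and a power of [x L] does because [y] is in the
    ring of direction [i]. *)
Lemma upper_bound_mutate_pos y : 0 < B L i ->
  exchange_ring s l y -> exchange_ring s i y -> T y.
Proof.
move=> bpos Ty_l Ty_i; case: (good_s) => _ sk _.
pose b := `|B L i|%N; have bE : B L i = b%:Z by rewrite /b; lia.
have b'E : B I l = - b%:Z by rewrite sk bE.
have posb : pos_part (B L i) = b by rewrite bE pos_part_nat.
have posb' : pos_part (- B L i) = 0%N by rewrite pos_part_le0 //; lia.
move: exchange_l exchange_i exchange_i'.
rewrite posb posb' b'E opprK pos_part_nat pos_part_le0 ?expr0 ?mul1r; last lia.
set Mp := mono _; set Mm := mono _; set Np := mono _; set Nm := mono _.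
set Rp := mono _; set Rm := mono _ => e1 e2 e3.
have [TMp TMm TNp TNm TRm] : [/\ T Mp, T Mm, T Np, T Nm & T Rm].
  by split; exact: Tmono.
(* Away from [L] and [I], column [i] grows by [b] times the positive part of column [l], so the
   ratio of its two monomials is multiplied by [Mp ^+ b]. *)
have key : Rp * Nm = Rm * Np * Mp ^+ b.
  rewrite /Mp /mono -prodrXl -!big_split /=; apply: eq_bigr => h /andP[hL hI].
  rewrite -exprM -!exprD mutate_mxE // -/L.
  congr (_ ^+ _); rewrite posb posb' mulr0 subr0.
  have := pos_partB (B h i); have := pos_partB (B h i + (pos_part (B h l))%:Z * b%:Z).
  nia.
(* [S] is the cofactor of [x I ^+ b * Mm] in the difference of the [b]-th powers of [x L * xl'] and
   [Mp]. *)
pose S := \sum_(j < b) (Mp + x I ^+ b * Mm) ^+ (b.-1 - j) * Mp ^+ j.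
have TS : T S.
  apply: Tsum => j; apply: TM; apply: TX => //.
  by apply: TD => //; apply: TM => //; apply: TX.
have hS : (Mp + x I ^+ b * Mm) ^+ b = Mp ^+ b + x I ^+ b * Mm * S.
  by apply/eqP; rewrite [X in _ == X]addrC -subr_eq subrXX /S; apply/eqP; congr (_ * _); ring.
(* After multiplication by [xl' ^+ b * Rm], the terms of [x I * xi'] without a factor [x I ^+ b]
   recombine by [key] into [Nm * (x I * xi'')]. Division by [x I] therefore stays inside [T]. *)
have xi'E : xi' = xl'^-1 ^+ b * Rm^-1 *
    (Nm * xi'' + Rm * Np * Mm * x I ^+ b.-1 * S).
  have nz : x I * xl' ^+ b * Rm != 0.
    by rewrite !mulf_neq0 ?expf_neq0 ?x_neq0 ?mutate_neq0 ?mono_neq0.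
  apply: (mulfI nz).
  have -> : x I * xl' ^+ b * Rm * xi' = xl' ^+ b * Rm * (x I * xi') by ring.
  rewrite e2 mulrDr.
  have -> : xl' ^+ b * Rm * (x L ^+ b * Np) = Rm * Np * (x L * xl') ^+ b.
    by rewrite exprMn; ring.
  rewrite e1 hS exprVn.
  have -> : x I * xl' ^+ b * Rm * ((xl' ^+ b)^-1 * Rm^-1 *
    (Nm * xi'' + Rm * Np * Mm * x I ^+ b.-1 * S)) =
    Nm * (x I * xi'') + Rm * Np * Mm * (x I * x I ^+ b.-1) * S.
    by field; rewrite expf_neq0 ?mutate_neq0 // mono_neq0.
  rewrite e3 -exprS prednK; last by rewrite /b; lia.
  rewrite [Nm * (_ + _)]mulrDr [Nm * Rp]mulrC key; ring.
have Txi' : T xi'.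
  rewrite xi'E; apply: TM; first by apply: TM; [exact: TX | exact: TmonoV].
  apply: TD; first by apply: TM => //; apply: exchange_ring_mutated.
  by do !apply: TM => //; apply: TX.
have [a Ta] := denominator_I Ty_l; have [c Tc] := denominator_L Txi' Ty_i.
apply: (@subalg_comaximal _ _ _ _ (x L) (x I) (Mp^-1 * xl')
  (- (Mp^-1 * (x I ^+ b.-1 * Mm))) y _ _ _ _ _ c a) => //.
- by apply: TM => //; apply: TmonoV.
- by apply: TN; do !apply: TM => //; [exact: TmonoV | exact: TX].
have -> : Mp^-1 * xl' * x L + - (Mp^-1 * (x I ^+ b.-1 * Mm)) * x I =
   Mp^-1 * (x L * xl' - x I * x I ^+ b.-1 * Mm) by ring.
rewrite e1 -exprS prednK; last by rewrite /b; lia.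
by rewrite addrK mulVf ?mono_neq0.
Qed.

(** * Directions that are not joined by an arrow *)

Section Commuting.
Hypothesis BLi0 : B L i = 0.

Let BIl0 : B I l = 0.
Proof. by case: good_s => _ sk _; rewrite sk BLi0 oppr0. Qed.

Let mutate_col_i h : mutate_mx B l h i = B h i.
Proof.
have [->|hL] := eqVneq h L; first by rewrite mutate_mx_flip ?eqxx // BLi0 oppr0.
by rewrite mutate_mxE // BLi0 oppr0 !mulr0 subrr addr0.
Qed.

Let xi''E : xi'' = xi'.
Proof.
apply: (mulfI (x_neq0 I)); rewrite exchange_i exchange_i' BLi0 oppr0 !mul1r.
by congr (_ + _); apply: eq_bigr => h _; rewrite mutate_col_i.
Qed.

Let z := mutate_var (mutate s l) i.

Let zI : z I = xi'. Proof. by rewrite -xi''E. Qed.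
Let zL : z L = xl'. Proof. by rewrite /z mutate_var_id. Qed.
Let zh h : h != L -> h != I -> z h = x h.
Proof. by move=> hL hI; rewrite /z !mutate_var_id //= mutate_var_id. Qed.

Let z_indep : alg_independent iota z.
Proof. by case: (good_seed_mutate i (good_seed_mutate l good_s)). Qed.

Let z_neq0 h : z h != 0.
Proof. exact: alg_independent_neq0 z_indep. Qed.

Let Txi' : T xi'.
Proof. by rewrite -xi''E; apply: exchange_ring_mutated. Qed.

Let Tz h : T (z h).
Proof.
have [->|hI] := eqVneq h I; first by rewrite zI.
have [->|hL] := eqVneq h L; first by rewrite zL.
by rewrite zh //; apply: Tx.
Qed.

Let TzV h : h != I -> T (z h)^-1.
Proof.
move=> hI; have [->|hL] := eqVneq h L; first by rewrite zL.
by rewrite zh //; apply: TxV.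
Qed.

Let zprod_I y : T y -> laurent z y.
Proof.
move=> Ty; apply: (@exchange_ring_laurent (mutate (mutate s l) i) i) => //.
exact: exchange_ring_mutate_same (good_seed_mutate l good_s) Ty.
Qed.

Let binomial_z_i : binomial_of z (fun h => B h i) = x I * xi'.
Proof.
case: (good_s) => _ sk _; rewrite exchange_i /binomial_of !pos_monomial_split //.
by rewrite [B I i]skew_principal_diag // BLi0 oppr0 !mul1r.
Qed.

Let binomial_z_l : binomial_of z (fun h => B h l) = x L * xl'.
Proof.
case: (good_s) => _ sk _; rewrite exchange_l /binomial_of !pos_monomial_split //.
by rewrite [B L l]skew_principal_diag // BIl0 oppr0 !mul1r.
Qed.

Let Np := pos_monomial z (fun h => B h i).
Let Nm := pos_monomial z (fun h => - B h i).
(** Multiplying the ratio [Np / Nm] by [eta] makes it -1, so the twisted binomial of column [i]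
    vanishes. Moreover [eta - 1] is a unit times that binomial [x I * xi'], hence [eta] is 1 modulo
    [x I]. *)
Let eta := - (Nm / Np).

Let Np_neq0 : Np != 0. Proof. exact: pos_monomial_neq0. Qed.
Let Nm_neq0 : Nm != 0. Proof. exact: pos_monomial_neq0. Qed.
Let eta_neq0 : eta != 0.
Proof. by rewrite oppr_eq0 mulf_neq0 ?invr_neq0. Qed.

Let pos_monomial_units c : c I = 0 ->
  T (pos_monomial z c) /\ T (pos_monomial z c)^-1.
Proof.
move=> cI; rewrite /pos_monomial (bigD1 I) //= cI pos_part_le0 // mul1r.
rewrite -prodfV; split; apply: subalg_prod => h hI; first by apply: TX; apply: Tz.
by rewrite -exprVn; apply: TX; apply: TzV.
Qed.

Let BIi0 : B I i = 0.
Proof. by case: good_s => _ sk _; rewrite skew_principal_diag. Qed.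

Let Teta : T eta /\ T eta^-1.
Proof.
have [h1 h2] := @pos_monomial_units (fun h => B h i) BIi0.
have [h3 h4] : T Nm /\ T Nm^-1 by apply: pos_monomial_units; rewrite BIi0 oppr0.
rewrite /eta invrN invf_div; split; apply: TN; exact: TM.
Qed.

(** Membership in the ideal [x I * T]. *)
Let J (g : F) : Prop := T (g / x I).

Let JD g g' : J g -> J g' -> J (g + g').
Proof. by rewrite /J mulrDl; apply: TD. Qed.
Let JB g g' : J g -> J g' -> J (g - g').
Proof. by move=> Jg Jg'; rewrite /J mulrBl; apply: TD => //; apply: TN. Qed.
Let JM g g' : T g -> J g' -> J (g * g').
Proof. by rewrite /J -mulrA; apply: TM. Qed.
Let JxI t : T t -> J (x I * t).
Proof. by rewrite /J mulrAC mulfV ?x_neq0 // mul1r. Qed.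
Let J0 : J 0. Proof. by rewrite /J mul0r; apply: subalg0. Qed.

Let J_eta1 : J (eta - 1).
Proof.
have [h1 h2] := @pos_monomial_units (fun h => B h i) BIi0.
have -> : eta - 1 = - Np^-1 * (x I * xi').
  by rewrite -binomial_z_i /binomial_of -/Np -/Nm /eta; field.
by apply: JM; [apply: TN | apply: JxI].
Qed.

Let eta_expz e : T (eta ^ e) /\ J (eta ^ e - 1).
Proof.
have [h1 h2] := Teta.
have nat_case (d : nat) : T (eta ^ d) /\ J (eta ^ d - 1).
  split; first exact: TX.
  elim: d => [|d IH]; first by rewrite subrr.
  have -> : eta ^ d.+1 - 1 = eta * (eta ^ d - 1) + (eta - 1).
    by rewrite -!exprnP exprS; ring.
  by apply: JD => //; apply: JM.
case: e => d //; rewrite NegzE -exprnN; have [k1 k2] := nat_case d.+1.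
split; first by rewrite -exprVn; apply: TX.
have -> : eta ^- d.+1 - 1 = - (eta^-1 ^+ d.+1) * (eta ^ d.+1 - 1).
  by rewrite -exprnP exprVn; field; rewrite expf_neq0.
by apply: JM => //; apply: TN; apply: TX.
Qed.

Section Weight.
Variable w : 'I_(n + f) -> int.
Hypothesis w_i : \sum_h w h * B h i = 1.
Hypothesis w_l : \sum_h w h * B h l = 0.

(* The substitution [z h |-> zt h] is the identity modulo [x I]; it kills
   [x I * xi'] but not [x L * xl'], so [x L] is regular modulo [x I]. *)
Let zt h := z h * eta ^ w h.

Let zt_neq0 h : zt h != 0.
Proof. by rewrite mulf_neq0 // expfz_neq0. Qed.

Let Tzt h : T (zt h).
Proof. by apply: TM; [exact: Tz | case: (eta_expz (w h))]. Qed.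

Let J_zt p : J (mmap iota zt p - mmap iota z p).
Proof.
elim/mpoly_alg_ind: p => [c | h | p q Jp Jq | p q Jp Jq].
- by rewrite !mmap_const subrr.
- rewrite !mmap_var /zt -[X in _ - X]mulr1 -mulrBr.
  by apply: JM; [exact: Tz | case: (eta_expz (w h))].
- by rewrite !mmap_add opprD addrACA; apply: JD.
- have -> : mmap iota zt (p * q) - mmap iota z (p * q) =
    mmap iota zt p * (mmap iota zt q - mmap iota z q)
    + mmap iota z q * (mmap iota zt p - mmap iota z p).
    by rewrite !mmap_mul; ring.
  by apply: JD; apply: JM => //; apply: subalg_mmap.
Qed.

Let zt_binomial_i : binomial_of zt (fun h => B h i) = 0.
Proof.
have [e ->] := binomial_of_twist z w (fun h => B h i) eta_neq0.
rewrite w_i expr1z -/Np -/Nm /eta.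
by rewrite (_ : Np * - (Nm / Np) + Nm = 0) ?mulr0 //; field.
Qed.

Let zt_binomial_l : binomial_of zt (fun h => B h l) != 0.
Proof.
have [e ->] := binomial_of_twist z w (fun h => B h l) eta_neq0.
rewrite w_l expr0z mulr1 -/(binomial_of _ _) binomial_z_l.
by rewrite !mulf_neq0 ?expfz_neq0 ?x_neq0 ?mutate_neq0.
Qed.

(** Up to monomials, an element of [x I * T] is a Laurent polynomial in [z] times the binomial of
    column [i], which vanishes at [zt]. *)
Let zt_eq0 r : J (mmap iota z r) -> mmap iota zt r = 0.
Proof.
move=> /zprod_I[N [p hp]].
have [q hq] := mmap_binomial iota (fun h => B h i).
have : r * 'X_I * (\prod_h 'X_h) ^+ N - q * p = 0.
  apply: z_indep; rewrite mmap_sub !mmap_mul mmap_exp mmap_prod_var mmap_var.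
  rewrite hq binomial_z_i -hp zI; field; exact: x_neq0.
move/(congr1 (mmap iota zt)); rewrite mmap_sub !mmap_mul mmap_exp hq.
rewrite zt_binomial_i mul0r subr0 mmap_prod_var mmap_var mmap_zero.
move/eqP; rewrite mulf_eq0 expf_eq0 mulf_eq0 (negPf (zt_neq0 I)) orbF => /orP[/eqP //|].
by case/andP=> _ /prodf_eq0[h _]; rewrite (negPf (zt_neq0 h)).
Qed.

Let mz := \prod_(h | h != I) z h.

Let mz_neq0 : mz != 0. Proof. by apply/prodf_neq0. Qed.

Let TmzV : T mz^-1.
Proof. by rewrite /mz -prodfV; apply: subalg_prod => h; apply: TzV. Qed.

(** Modulo [x I] the ring [T] is generated by the [z h] and the inverses of those other than [z I],
    so a power of the unit [mz] clears all denominators. *)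
Let mod_xI g : T g -> exists N p t,
  T t /\ g * mz ^+ N = mmap iota z p + x I * t.
Proof.
have var h : exists N p t, T t /\ z h * mz ^+ N = mmap iota z p + x I * t.
  exists 0%N, 'X_h, 0; split; first exact: subalg0.
  by rewrite mmap_var mulr0 addr0 mulr1.
elim=> [y [-> | -> | [h hI [->|->]]] | c | y1 y2 _ [N1 [p1 [t1 [Tt1 h1]]]] _
         [N2 [p2 [t2 [Tt2 h2]]]] | y1 y2 _ [N1 [p1 [t1 [Tt1 h1]]]] _
         [N2 [p2 [t2 [Tt2 h2]]]]].
- exists 0%N, 0, 1; split; first exact: subalg1.
  by rewrite mmap_zero add0r mulr1 /= mutate_var_id // mulr1.
- exact: var.
- have -> : seed_var (mutate s l) h = z h by rewrite /z mutate_var_id.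
  exact: var.
- have -> : seed_var (mutate s l) h = z h by rewrite /z mutate_var_id.
  exists 1%N, (\prod_(h' | (h' != I) && (h' != h)) 'X_h'), 0.
  split; first exact: subalg0.
  by rewrite mmap_prod_var mulr0 addr0 expr1 /mz (bigD1 h) //= mulKf.
- exists 0%N, c%:MP, 0; split; first exact: subalg0.
  by rewrite mmap_const mulr0 addr0 mulr1.
- exists (N1 + N2)%N, ((\prod_(h | h != I) 'X_h) ^+ N2 * p1 +
    (\prod_(h | h != I) 'X_h) ^+ N1 * p2), (mz ^+ N2 * t1 + mz ^+ N1 * t2).
  split.
    have Tmz : T mz by apply: subalg_prod => h _; apply: Tz.
    by apply: TD; apply: TM => //; apply: TX.
  rewrite mmap_add !mmap_mul !mmap_exp mmap_prod_var -/mz exprD.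
  transitivity (mz ^+ N2 * (y1 * mz ^+ N1) + mz ^+ N1 * (y2 * mz ^+ N2)).
    by ring.
  by rewrite h1 h2; ring.
- exists (N1 + N2)%N, (p1 * p2),
    (t1 * mmap iota z p2 + mmap iota z p1 * t2 + x I * t1 * t2).
  split.
    by apply: TD; [apply: TD|]; do ?apply: TM => //; apply: subalg_mmap.
  by rewrite exprD mulrACA h1 h2 mmap_mul; ring.
Qed.

Let xL_nonzerodivisor g : T g -> J (x L * g) -> J g.
Proof.
move=> Tg Jg; have [N [p [t [Tt e]]]] := mod_xI Tg.
have [q hq] := mmap_binomial iota (fun h => B h l).
have Tmz : T mz by apply: subalg_prod => h _; apply: Tz.
have /zt_eq0 : J (mmap iota z (q * p)).
  rewrite mmap_mul hq binomial_z_l.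
  have -> : mmap iota z p = g * mz ^+ N - x I * t by rewrite e addrK.
  have -> : x L * xl' * (g * mz ^+ N - x I * t) =
    xl' * mz ^+ N * (x L * g) - x I * (x L * xl' * t) by ring.
  apply: JB; last by apply: JxI; do ?apply: TM.
  by apply: JM => //; apply: TM => //; apply: TX.
rewrite mmap_mul hq => /eqP; rewrite mulf_eq0 (negPf zt_binomial_l) /= => /eqP p0.
have Jp : J (mmap iota z p).
  by have := JB J0 (J_zt p); rewrite p0 !sub0r opprK.
have -> : g = mz^-1 ^+ N * (mmap iota z p + x I * t).
  by rewrite -e exprVn mulrCA mulVf ?mulr1 // expf_neq0.
by apply: JM; [exact: TX | apply: JD => //; apply: JxI].
Qed.

(** Comaximality may fail here, but [x L] is a nonzerodivisor modulo [x I], which still removes the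
    powers of [x I] one by one: [x L ^+ c] carries [x I ^+ a.+1 * y] into [x I * T], so this element
    was already there. *)
Lemma upper_bound_mutate_weight y :
  exchange_ring s l y -> exchange_ring s i y -> T y.
Proof.
move=> Ty_l Ty_i; have [a Ta] := denominator_I Ty_l.
have [c Tc] := denominator_L Txi' Ty_i.
elim: a Ta => [|a IH] Ta; first by rewrite mul1r in Ta.
apply: IH; have -> : x I ^+ a * y = (x I ^+ a.+1 * y) / x I.
  by rewrite exprS; field; apply: x_neq0.
have : J (x L ^+ c * (x I ^+ a.+1 * y)).
  rewrite mulrCA exprS -mulrA; apply: JxI; apply: TM => //; exact: TX.
have : T (x I ^+ a.+1 * y) by [].
move: (x I ^+ a.+1 * y) => g Tg; elim: c {Tc} => [|c IHc]; first by rewrite mul1r.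
rewrite exprS -mulrA => /(xL_nonzerodivisor _) h; apply: IHc; apply: h.
by apply: TM => //; apply: TX.
Qed.

End Weight.
End Commuting.

End TwoDirections.

Lemma upper_bound_mutate s l i y : good_seed s -> l != i ->
  exchange_ring s l y -> exchange_ring s i y ->
  exchange_ring (mutate s l) i y.
Proof.
move=> gs li Tl Ti; have [bneg|bpos|b0] := ltgtP (seed_mx s (lshift f l) i) 0.
(* The opposite seed has the same variables and the same exchange rings, and its entry is
   positive. *)
- have [ai sk un] := gs.
  have gs' : good_seed (opp_seed s).
    split=> //=; first by move=> a b; rewrite !mxE sk.
    move=> v; have [w hw] := un (fun j => - v j); exists w => j.
    under eq_bigr do rewrite mxE mulrN.
    by rewrite sumrN hw opprK.
  apply/exchange_ring_opp; rewrite -mutate_opp.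
  apply: upper_bound_mutate_pos => //; first by rewrite /= mxE oppr_gt0.
    exact/exchange_ring_opp.
  exact/exchange_ring_opp.
- exact: upper_bound_mutate_pos.
(* Unimodularity yields a weight of degree 1 on column [i] and degree 0 on every other column, in
   particular on [l]. *)
- have [_ _ /(_ (fun j => (j == i)%:R))[w hw]] := gs.
  apply: (@upper_bound_mutate_weight s l i gs li b0 w) => //.
    by rewrite hw eqxx.
  by rewrite hw (negPf li).
Qed.

Definition upper_bound s (y : F) : Prop := forall i, exchange_ring s i y.

Lemma upper_bound_step s l y : good_seed s ->
  upper_bound s y -> upper_bound (mutate s l) y.
Proof.
move=> gs uy i; have [->|li] := eqVneq i l.
  exact: exchange_ring_mutate_same.
by apply: upper_bound_mutate; rewrite // eq_sym.
Qed.

Lemma mutateK s l : good_seed s -> mutate (mutate s l) l = s.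
Proof.
move=> gs; have [ai sk _] := gs; have [ai' _ _] := good_seed_mutate l gs.
have nz := fun h => @alg_independent_neq0 _ _ iota _ _ h ai.
have nz' := fun h => @alg_independent_neq0 _ _ iota _ _ h ai'.
have b0 := skew_principal_diag l sk.
have mxK : mutate_mx (mutate_mx (seed_mx s) l) l = seed_mx s.
  apply/matrixP => i j; have [h|] := boolP ((i == lshift f l) || (j == l)).
    by rewrite !mutate_mx_flip ?opprK.
  rewrite negb_or => /andP[hi hj].
  rewrite 2?(@mutate_mxE n f _ l i j) // (@mutate_mx_flip n f _ l i l) ?eqxx ?orbT //.
  rewrite (@mutate_mx_flip n f _ l _ j) ?eqxx // !opprK; ring.
have varK : mutate_var (mutate s l) l = seed_var s.
  apply: functional_extensionality => h; rewrite -(mutate_varK b0 (nz _) (nz' _)).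
  have [->|hl] := eqVneq h (lshift f l); last by rewrite !mutate_var_id.
  rewrite !mutate_varE /= -[in RHS]binomial_of_opp; congr (_ / _).
  by congr (_ + _); apply: eq_bigr => i _; rewrite mutate_mx_flip ?eqxx ?orbT.
by rewrite {1}/mutate varK /= mxK; case: (s).
Qed.

Lemma good_seed_foldl s ls : good_seed s -> good_seed (foldl (@mutate F n f) s ls).
Proof.
by elim: ls s => [|l ls IH] s gs //=; apply: IH; apply: good_seed_mutate.
Qed.

Lemma upper_bound_foldl s ls y : good_seed s ->
  upper_bound (foldl (@mutate F n f) s ls) y <-> upper_bound s y.
Proof.
elim: ls s => [|l ls IH] s gs //=; rewrite IH; last exact: good_seed_mutate.
split; last exact: upper_bound_step.
by rewrite -{2}(mutateK l gs); apply: upper_bound_step; apply: good_seed_mutate.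
Qed.

(* The Laurent phenomenon, at every seed. *)
Lemma cluster_variable_upper_bound s ls y : good_seed s ->
  is_cluster_variable s y -> upper_bound (foldl (@mutate F n f) s ls) y.
Proof.
move=> gs [ls' [j ->]]; apply/upper_bound_foldl => //.
by apply/(upper_bound_foldl ls' _ gs) => i; apply: exchange_ring_var.
Qed.

End UpperBound.

(** * Determinantal identities *)

Definition transpose_at (p i : nat) : nat :=
  if i == p then p.+1 else if i == p.+1 then p else i.

Definition swap (p : nat) (u : nat -> nat) : nat -> nat :=
  fun i => u (transpose_at p i).

Lemma swapL p u : swap p u p = u p.+1.
Proof. by rewrite /swap /transpose_at eqxx. Qed.

Lemma swapR p u : swap p u p.+1 = u p.
Proof. by rewrite /swap /transpose_at eqxx eqn_leq ltnn. Qed.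

Lemma swapD p u i : i != p -> i != p.+1 -> swap p u i = u i.
Proof. by rewrite /swap /transpose_at => /negPf -> /negPf ->. Qed.

Lemma transpose_atK p : involutive (transpose_at p).
Proof.
move=> i; rewrite /transpose_at; have [->|ip] := eqVneq i p.
  by rewrite eqxx eqn_leq ltnn.
by have [->|ip'] := eqVneq i p.+1; [rewrite eqxx | rewrite (negPf ip) (negPf ip')].
Qed.

Lemma swapK p : involutive (swap p).
Proof.
move=> u; apply: functional_extensionality => i.
by rewrite /swap transpose_atK.
Qed.

Section PairProducts.
Variables (T : Type) (idx : T) (op : Monoid.com_law idx) (G : nat -> nat -> T).
Implicit Types (u : nat -> nat).

(** The monoid is kept abstract because the same product over pairs gives the sign of a listing and,
    additively, its number of inversions. *)
Definition big_pairs q u : T :=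
  \big[op/idx]_(j < q) \big[op/idx]_(i < j) G (u i) (u j).

Lemma big_swap (h : nat -> T) p q u : (p.+1 < q)%N ->
  \big[op/idx]_(i < q) h (swap p u i) = \big[op/idx]_(i < q) h (u i).
Proof.
elim: q => // q IH; rewrite ltnS leq_eqVlt => /predU1P[<-|pq]; last first.
  by rewrite big_ord_recr [RHS]big_ord_recr /= IH // swapD //; lia.
rewrite !big_ord_recr /= swapL swapR -!Monoid.mulmA.
congr (op _ _); last exact: Monoid.mulmC.
by apply: eq_bigr => i _; rewrite swapD //; have := ltn_ord i; lia.
Qed.

Lemma big_pairs_recr q u : big_pairs q.+1 u =
  op (big_pairs q u) (\big[op/idx]_(i < q) G (u i) (u q)).
Proof. by rewrite /big_pairs big_ord_recr. Qed.

Lemma big_pairs_le p q u : (q <= p)%N -> big_pairs q (swap p u) = big_pairs q u.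
Proof.
move=> qp; apply: eq_bigr => j _; apply: eq_bigr => i _.
by rewrite !swapD //; have := ltn_ord i; have := ltn_ord j; lia.
Qed.

(** Only the entries at the positions [p] and [p.+1] change their relative order; [r] collects all
    other pairs, which are merely permuted. *)
Lemma big_pairs_swap p q u : (p.+1 < q)%N -> exists r : T,
  big_pairs q u = op r (G (u p) (u p.+1)) /\
  big_pairs q (swap p u) = op r (G (u p.+1) (u p)).
Proof.
elim: q => // q IH; rewrite ltnS leq_eqVlt => /predU1P[<-|pq]; last first.
  have [r [h1 h2]] := IH pq; exists (op r (\big[op/idx]_(i < q) G (u i) (u q))).
  rewrite !big_pairs_recr h1 h2 [swap p u q]swapD; [|lia..].
  rewrite (big_swap (fun a => G a (u q))) //.
  by split; rewrite -!Monoid.mulmA; congr (op _ _); apply: Monoid.mulmC.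
rewrite !big_pairs_recr !big_ord_recr /= !swapL !swapR big_pairs_le //.
exists (op (big_pairs p u) (op (\big[op/idx]_(i < p) G (u i) (u p))
  (\big[op/idx]_(i < p) G (u i) (u p.+1)))).
have e a : \big[op/idx]_(i < p) G (swap p u i) a = \big[op/idx]_(i < p) G (u i) a.
  by apply: eq_bigr => i _; rewrite swapD //; have := ltn_ord i; lia.
rewrite !e; split; rewrite -!Monoid.mulmA //; congr (op _ _).
by rewrite !Monoid.mulmA; congr (op _ _); apply: Monoid.mulmC.
Qed.

End PairProducts.

Section Minors.
Variable F : fieldType.
Implicit Types (Z : nat -> nat -> F) (u v : nat -> nat).

Definition minor Z p u v : F := \det (\matrix_(i < p, j < p) Z (u i) (v j)).

Definition inversion_sign p u : F :=
  big_pairs *%R (fun a b => (-1) ^+ (b < a)%N) p u.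

(* The minor on the sets {u 0, ..., u (p-1)}, {v 0, ..., v (p-1)}, whatever
   the order in which [u] and [v] list them. *)
Definition set_minor Z p u v : F :=
  inversion_sign p u * inversion_sign p v * minor Z p u v.

Lemma minor_tr Z p u v : minor (fun a b => Z b a) p v u = minor Z p u v.
Proof.
by rewrite /minor -det_tr; congr (\det _); apply/matrixP => i j; rewrite !mxE.
Qed.

Lemma set_minor_tr Z p u v :
  set_minor (fun a b => Z b a) p v u = set_minor Z p u v.
Proof. by rewrite /set_minor minor_tr [inversion_sign p v * _]mulrC. Qed.

Lemma set_minor0 Z u v : set_minor Z 0 u v = 1.
Proof.
by rewrite /set_minor /inversion_sign /big_pairs /minor !big_ord0 det_mx00 !mulr1.
Qed.

Lemma minor_swap Z p q u v : (p.+1 < q)%N ->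
  minor Z q (swap p u) v = - minor Z q u v.
Proof.
move=> pq; have hp : (p < q)%N by apply: ltn_trans pq.
pose a := Ordinal hp; pose b := Ordinal pq.
have ab : a != b by rewrite -val_eqE /=; lia.
have e : \matrix_(i < q, j < q) Z (swap p u i) (v j) =
    row_perm (tperm a b) (\matrix_(i < q, j < q) Z (u i) (v j)).
  apply/matrixP => i j; rewrite !mxE; congr (Z _ _).
  case: tpermP => [->|->|ia ib]; rewrite ?swapL ?swapR //.
  by rewrite swapD //; apply/eqP => E; [apply: ia | apply: ib]; apply: val_inj.
by rewrite /minor e row_permE det_mulmx det_perm odd_tperm ab expr1 mulN1r.
Qed.

Lemma inversion_sign_swap p q u : (p.+1 < q)%N -> u p != u p.+1 ->
  inversion_sign q (swap p u) = - inversion_sign q u.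
Proof.
move=> pq ne; rewrite /inversion_sign.
have [r [-> ->]] := @big_pairs_swap F 1 *%R (fun a b => (-1) ^+ (b < a)%N) p q u pq.
rewrite -mulrN; congr (_ * _).
by case: (ltngtP (u p) (u p.+1)) ne => // _ _; rewrite ?expr1 ?expr0 ?opprK.
Qed.

(** If both swapped positions are among the first [q], the sign of the determinant cancels that of
    the listing; otherwise [q != p.+1] puts both outside and nothing changes. *)
Lemma set_minor_swapl Z p q u v : q != p.+1 -> u p != u p.+1 ->
  set_minor Z q (swap p u) v = set_minor Z q u v.
Proof.
move=> qp ne; rewrite /set_minor; have [lt|ge] := ltnP p.+1 q.
  by rewrite minor_swap // inversion_sign_swap // mulNr mulrNN.
have le : (q <= p)%N by lia.
rewrite /inversion_sign big_pairs_le //; congr (_ * _); congr (\det _).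
apply/matrixP => i j; rewrite !mxE swapD //; have := ltn_ord i; lia.
Qed.

Lemma set_minor_swapr Z p q u v : q != p.+1 -> v p != v p.+1 ->
  set_minor Z q u (swap p v) = set_minor Z q u v.
Proof.
by move=> qp ne; rewrite -!(set_minor_tr Z) set_minor_swapl.
Qed.

Lemma inversion_sign_neq0 p u : inversion_sign p u != 0.
Proof.
by apply/prodf_neq0 => j _; apply/prodf_neq0 => i _; rewrite signr_eq0.
Qed.

Lemma set_minor_neq0 Z p u v : (set_minor Z p u v != 0) = (minor Z p u v != 0).
Proof. by rewrite /set_minor !mulf_eq0 !(negPf (inversion_sign_neq0 _ _)). Qed.

Lemma inversion_sign_sq p u : inversion_sign p u * inversion_sign p u = 1.
Proof.
rewrite /inversion_sign /big_pairs -big_split big1 //= => j _.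
by rewrite -big_split big1 //= => i _; rewrite -expr2 sqrr_sign.
Qed.

Lemma det_block_schur p r (X : 'M[F]_p) (Y : 'M_(p, r)) (W : 'M_(r, p))
    (V : 'M_r) : X \in unitmx ->
  \det (block_mx X Y W V) = \det X * \det (V - W *m invmx X *m Y).
Proof.
move=> uX; have -> : block_mx X Y W V = block_mx 1%:M 0 (W *m invmx X) 1%:M *m
    block_mx X Y 0 (V - W *m invmx X *m Y).
  rewrite mulmx_block !mul1mx !mul0mx !addr0 mulmxKV //; congr (block_mx _ _ _ _).
  by rewrite addrC subrK.
by rewrite det_mulmx det_lblock det_ublock !det1 !mul1r.
Qed.

(** An entry of the Schur complement of the leading block: when that block is invertible, the
    quotient by its minor of the minor bordered with row [a] and column [b]. *)
Definition schur Z p u v (a b : nat) : F :=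
  Z a b - ((\row_(j < p) Z a (v j)) *m invmx (\matrix_(i < p, j < p) Z (u i) (v j))
     *m (\col_(i < p) Z (u i) b)) 0 0.

(** Minors that extend a common nonzero minor become small minors of Schur complements. The
    identities below then only involve determinants of size at most 2 and are polynomial identities
    in a few entries. *)
Lemma minor_schur Z p r u v : minor Z p u v != 0 ->
  minor Z (p + r) u v = minor Z p u v *
    \det (\matrix_(i < r, j < r) schur Z p u v (u (p + i)%N) (v (p + j)%N)).
Proof.
move=> nz; pose X := \matrix_(i < p, j < p) Z (u i) (v j).
rewrite {1}/minor; have -> : \matrix_(i < p + r, j < p + r) Z (u i) (v j) =
  block_mx X (\matrix_(i, j) Z (u i) (v (p + j)%N))
    (\matrix_(i, j) Z (u (p + i)%N) (v j))
    (\matrix_(i, j) Z (u (p + i)%N) (v (p + j)%N)).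
  apply/matrixP => i j; rewrite -(splitK i) -(splitK j).
  case: (split i) => i'; case: (split j) => j' /=;
  by rewrite ?block_mxEul ?block_mxEur ?block_mxEdl ?block_mxEdr !mxE.
rewrite det_block_schur; last by rewrite unitmxE unitfE.
congr (_ * \det _); apply/matrixP => i j; rewrite !mxE; congr (_ - _).
rewrite [RHS]mxE; apply: eq_bigr => h _; rewrite !mxE; congr (_ * _).
by apply: eq_bigr => h' _; rewrite !mxE.
Qed.

Lemma minor_schur1 Z p u v : minor Z p u v != 0 ->
  minor Z p.+1 u v = minor Z p u v * schur Z p u v (u p) (v p).
Proof.
by move=> nz; rewrite -addn1 minor_schur // det_mx11 mxE !addn0.
Qed.

Lemma minor_schur2 Z p u v : minor Z p u v != 0 ->
  minor Z p.+2 u v = minor Z p u v *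
    (schur Z p u v (u p) (v p) * schur Z p u v (u p.+1) (v p.+1)
     - schur Z p u v (u p) (v p.+1) * schur Z p u v (u p.+1) (v p)).
Proof.
move=> nz; rewrite -addn2 minor_schur //; congr (_ * _).
rewrite (expand_det_row _ ord0) !big_ord_recl big_ord0 /cofactor !det_mx11 !mxE.
rewrite /= !addn0 !addn1 expr0 expr1; ring.
Qed.

Lemma eq_schur Z p u u' v v' a b :
  (forall i, (i < p)%N -> u i = u' i) -> (forall i, (i < p)%N -> v i = v' i) ->
  schur Z p u v a b = schur Z p u' v' a b.
Proof.
move=> eu ev; rewrite /schur; congr (_ - (_ *m invmx _ *m _) _ _).
- by apply/rowP => j; rewrite !mxE ev.
- by apply/matrixP => i j; rewrite !mxE eu // ev.
- by apply/colP => i; rewrite !mxE eu.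
Qed.

Lemma eq_minor Z p u u' v v' :
  (forall i, (i < p)%N -> u i = u' i) -> (forall i, (i < p)%N -> v i = v' i) ->
  minor Z p u v = minor Z p u' v'.
Proof.
by move=> eu ev; congr (\det _); apply/matrixP => i j; rewrite !mxE eu // ev.
Qed.

Lemma inversion_sign_recr p u : inversion_sign p.+1 u =
  inversion_sign p u * \prod_(i < p) (-1) ^+ (u p < u i)%N.
Proof. exact: big_pairs_recr. Qed.

Lemma inversion_sign_recr2 p u : inversion_sign p.+2 u =
  inversion_sign p u * (\prod_(i < p) (-1) ^+ (u p < u i)%N) *
  (\prod_(i < p) (-1) ^+ (u p.+1 < u i)%N) * (-1) ^+ (u p.+1 < u p)%N.
Proof. by rewrite !inversion_sign_recr big_ord_recr /= !mulrA. Qed.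

Lemma eq_inversion_sign p u u' : (forall i, (i < p)%N -> u i = u' i) ->
  inversion_sign p u = inversion_sign p u'.
Proof.
move=> eu; apply: eq_bigr => j _; apply: eq_bigr => i _.
by rewrite !eu // (ltn_trans (ltn_ord i)).
Qed.

Lemma eq_prod_sign p u u' a : (forall i, (i < p)%N -> u i = u' i) ->
  \prod_(i < p) (-1) ^+ (a < u i)%N = \prod_(i < p) (-1) ^+ (a < u' i)%N :> F.
Proof. by move=> eu; apply: eq_bigr => i _; rewrite eu. Qed.

Lemma swap_lt p q u : (q <= p)%N -> forall i, (i < q)%N -> swap p u i = u i.
Proof. by move=> qp i iq; rewrite swapD //; lia. Qed.

(* The Desnanot-Jacobi identity. *)
Lemma set_minor_mixed Z p u v : set_minor Z p u v != 0 ->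
  (u p < u p.+1)%N -> (v p.+1 < v p)%N ->
  set_minor Z p.+1 (swap p u) v * set_minor Z p.+1 u (swap p v) =
  set_minor Z p.+1 u v * set_minor Z p.+1 (swap p u) (swap p v) +
  set_minor Z p u v * set_minor Z p.+2 u v.
Proof.
rewrite set_minor_neq0 => nz hu hv.
have hu' : (u p.+1 < u p)%N = false by lia.
have eu := swap_lt u (leqnn p); have ev := swap_lt v (leqnn p).
have e0 a b : minor Z p (if a then swap p u else u) (if b then swap p v else v)
    = minor Z p u v.
  by apply: eq_minor => i ip; [case: a | case: b]; rewrite ?eu ?ev.
have := (e0 true true); have := (e0 false true); have := (e0 true false).
move=> /= e10 e01 e11; rewrite /set_minor !inversion_sign_recr2 !inversion_sign_recr.
rewrite !(eq_inversion_sign eu) !(eq_inversion_sign ev) minor_schur2 //.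
rewrite !minor_schur1 ?e10 ?e01 ?e11 // !swapL hu' hv !(eq_prod_sign _ eu).
rewrite !(eq_prod_sign _ ev).
rewrite !(@eq_schur Z p (swap p u) u _ v) // !(@eq_schur Z p _ u (swap p v) v) //.
rewrite expr0 expr1; ring.
Qed.

(* The three-term Pluecker relation. *)
Lemma set_minor_braid Z p u v (b : bool) : set_minor Z p u v != 0 ->
  (u p.+1 < u p)%N = b -> (u p.+2 < u p.+1)%N = b -> (u p.+2 < u p)%N = b ->
  set_minor Z p.+1 (swap p u) v * set_minor Z p.+2 (swap p.+1 u) v =
  set_minor Z p.+1 u v * set_minor Z p.+2 (swap p.+1 (swap p u)) v +
  set_minor Z p.+1 (swap p (swap p.+1 (swap p u))) v * set_minor Z p.+2 u v.
Proof.
rewrite set_minor_neq0 => nz h01 h12 h02.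
have e1 := swap_lt u (leqnn p).
have e2 i : (i < p)%N -> swap p.+1 u i = u i by apply: swap_lt.
have e3 i : (i < p)%N -> swap p.+1 (swap p u) i = u i.
  by move=> ip; rewrite (@swap_lt p.+1 p) ?e1.
have e4 i : (i < p)%N -> swap p (swap p.+1 (swap p u)) i = u i.
  by move=> ip; rewrite (@swap_lt p p) ?e3.
have em u' : (forall i, (i < p)%N -> u' i = u i) -> minor Z p u' v = minor Z p u v.
  by move=> e; apply: eq_minor.
rewrite /set_minor !inversion_sign_recr2 !inversion_sign_recr.
rewrite (eq_inversion_sign e1) (eq_inversion_sign e2) (eq_inversion_sign e3).
rewrite (eq_inversion_sign e4) !minor_schur2 ?em // !minor_schur1 ?em //.
have s1 : swap p u p = u p.+1 by rewrite swapL.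
have s20 : swap p.+1 u p = u p by rewrite swapD //; lia.
have s21 : swap p.+1 u p.+1 = u p.+2 by rewrite swapL.
have s30 : swap p.+1 (swap p u) p = u p.+1 by rewrite swapD ?swapL //; lia.
have s31 : swap p.+1 (swap p u) p.+1 = u p.+2.
  by rewrite swapL swapD //; lia.
have s4 : swap p (swap p.+1 (swap p u)) p = u p.+2 by rewrite swapL s31.
rewrite s1 s20 s21 s30 s31 s4 h01 h12 h02.
rewrite !(eq_prod_sign _ e1) !(eq_prod_sign _ e2) !(eq_prod_sign _ e3).
rewrite !(eq_prod_sign _ e4).
rewrite !(@eq_schur Z p (swap p u) u v v) // !(@eq_schur Z p (swap p.+1 u) u v v) //.
rewrite !(@eq_schur Z p (swap p.+1 (swap p u)) u v v) //.
rewrite !(@eq_schur Z p (swap p (swap p.+1 (swap p u))) u v v) //.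
ring.
Qed.

End Minors.

(** * Double wiring diagrams *)

(* A double wiring diagram is read from left to right as a word. The letter
   [(c, p)] is a crossing of the wires at the heights [p] and [p.+1], red when
   [c] is true and blue otherwise. In a state [(u, v)] the red wires are
   [u 0, u 1, ...] and the blue ones [v 0, v 1, ...] from bottom to top, and the
   chamber at level [q] stands for the minor with rows [u i] and columns [v i],
   [i < q]. *)
Definition letter := (bool * nat)%type.
Definition state := ((nat -> nat) * (nat -> nat))%type.

Definition step (st : state) (y : letter) : state :=
  if y.1 then (swap y.2 st.1, st.2) else (st.1, swap y.2 st.2).

(** Red wires cross only while in increasing order and blue ones only while in decreasing order, so
    two wires of one color cross at most once. *)
Definition admissible (k : nat) (st : state) (y : letter) : bool :=
  (y.2.+1 < k)%N && (if y.1 then st.1 y.2 < st.1 y.2.+1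
                     else st.2 y.2.+1 < st.2 y.2)%N.

Fixpoint valid (k : nat) (st : state) (w : seq letter) : bool :=
  if w is y :: w' then admissible k st y && valid k (step st y) w' else true.

Definition run (st : state) (w : seq letter) : state := foldl step st w.

Lemma valid_cat k st w w' :
  valid k st (w ++ w') = valid k st w && valid k (run st w) w'.
Proof. by elim: w st => //= y w IH st; rewrite IH andbA. Qed.

Section Labels.
Variable V : eqType.
Implicit Types (phi : nat -> V) (w : seq (letter * V)).

(* Chambers carry labels: [phi q] is the label of the current chamber at level
   [q], and [(y, a)] is a crossing that opens a chamber labelled [a]. *)
Definition relabel phi (p : nat) (a : V) : nat -> V :=
  fun q => if q == p.+1 then a else phi q.

Definition run_labels phi w : nat -> V :=
  foldl (fun phi t => relabel phi t.1.2 t.2) phi w.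

Lemma relabelE phi p a : relabel phi p a p.+1 = a.
Proof. by rewrite /relabel eqxx. Qed.

Lemma relabel_neq phi p a q : q != p.+1 -> relabel phi p a q = phi q.
Proof. by rewrite /relabel => /negPf ->. Qed.

(* Level [0] carries no chamber. *)
Definition chamber_at phi (q : nat) (i : V) : int := ((0 < q)%N && (phi q == i))%:R.

Definition color_sign (c : bool) : int := if c then 1 else -1.

Definition wedge (x y : V -> int) (i j : V) : int := x i * y j - y i * x j.

(** Expanded, the wedge is twice [old] with [new], plus [new - old] with the chambers below and
    above. Writing the quiver as a form in indicator functions reduces the comparison of quivers
    before and after a move to polynomial identities. *)
Definition step_form phi (t : letter * V) : V -> V -> int :=
  let p := t.1.2 in
  let old := chamber_at phi p.+1 in let new := fun i => (t.2 == i)%:R in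
  fun i j => color_sign t.1.1 * wedge (fun h => new h - old h)
    (fun h => chamber_at phi p h + chamber_at phi p.+2 h - old h - new h) i j.

(* Twice the exchange form of the diagram: each crossing contributes the
   arrow from its left to its right chamber and four half-arrows making two
   oriented triangles with the chambers above and below. *)
Fixpoint word_form phi w (i j : V) : int :=
  if w is t :: w' then
    step_form phi t i j + word_form (relabel phi t.1.2 t.2) w' i j
  else 0.

Lemma word_form_cat phi w w' i j : word_form phi (w ++ w') i j =
  word_form phi w i j + word_form (run_labels phi w) w' i j.
Proof. by elim: w phi => [|t w IH] phi /=; rewrite ?add0r // IH addrA. Qed.

Lemma word_form_antisym phi w i j : word_form phi w i j = - word_form phi w j i.
Proof.
elim: w phi => [|t w IH] phi /=; first by rewrite oppr0.
by rewrite IH /step_form /wedge; ring.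
Qed.

Variable k : nat.

Definition on_level phi (a : V) : Prop := exists2 q, (0 < q <= k)%N & phi q = a.

Definition fresh_labels phi w : Prop :=
  [/\ forall q q', (0 < q <= k)%N -> (0 < q' <= k)%N -> phi q = phi q' -> q = q',
      forall a, a \in map snd w -> ~ on_level phi a & uniq (map snd w)].

Lemma chamber_at_notin phi q a : (q <= k)%N -> ~ on_level phi a ->
  chamber_at phi q a = 0.
Proof.
rewrite /chamber_at => qk na; case: ltnP => //= q0.
by case: eqP => // e; case: na; exists q => //; rewrite q0.
Qed.

Lemma word_form_notin phi w i j : (forall t, t \in w -> (t.1.2.+1 < k)%N) ->
  ~ on_level phi i -> i \notin map snd w -> word_form phi w i j = 0.
Proof.
elim: w phi => [//|t w IH] phi hk ni /=; rewrite inE negb_or => /andP[it iw].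
have pk : (t.1.2.+1 < k)%N by apply: hk; rewrite mem_head.
rewrite IH //; last 2 first.
- by move=> t' tw; apply: hk; rewrite inE tw orbT.
- case=> q qk; rewrite /relabel; case: eqP => [_ e | _ e].
    by rewrite e eqxx in it.
  by case: ni; exists q.
rewrite /step_form /wedge /= [_ == i]eq_sym (negPf it).
rewrite !(chamber_at_notin _ ni); [rewrite mulr0n; ring|lia..].
Qed.

Lemma fresh_labels_relabel phi t w : (t.1.2.+1 < k)%N ->
  fresh_labels phi (t :: w) -> fresh_labels (relabel phi t.1.2 t.2) w.
Proof.
move=> pk [inj fr /= /andP[tw uw]]; split=> //.
- move=> q q' hq hq'; rewrite /relabel; case: eqP => [->|_]; case: eqP => //.
  + by move=> _ e; case: (fr t.2 (mem_head _ _)); exists q'.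
  + by move=> _ e; case: (fr t.2 (mem_head _ _)); exists q.
  + by move=> _; apply: inj.
- move=> a aw [q hq]; rewrite /relabel; case: eqP => [_ e|_ e].
    by rewrite e aw in tw.
  have ain : a \in map snd (t :: w) by rewrite inE aw orbT.
    by case: (fr a ain); exists q.
Qed.

Lemma fresh_labels_run phi w w' : (forall t, t \in w -> (t.1.2.+1 < k)%N) ->
  fresh_labels phi (w ++ w') -> fresh_labels (run_labels phi w) w'.
Proof.
elim: w phi => [//|t w IH] phi hk /= fr; apply: IH.
  by move=> t' tw; apply: hk; rewrite inE tw orbT.
by apply: fresh_labels_relabel => //; apply: hk; rewrite mem_head.
Qed.

Lemma chamber_at_relabel phi p a : chamber_at (relabel phi p a) p.+1 =
  fun i => (a == i)%:R.
Proof. by rewrite /chamber_at relabelE. Qed.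

Lemma chamber_at_relabel_neq phi p a q : q != p.+1 ->
  chamber_at (relabel phi p a) q = chamber_at phi q.
Proof. by rewrite /chamber_at => qp; rewrite relabel_neq. Qed.

(* [Om] and [Om'] are twice the exchange forms before and after the mutation at
   [a]; [A] and [C] mark the chambers joined to [a] by arrows of either
   direction. *)
Definition form_mutation (a : V) (e : int) (A C : V -> int) (Om Om' : V -> V -> int) :=
  [/\ forall i, Om i a = 2 * e * (A i - C i),
      forall i j, i != a -> j != a ->
        Om' i j = Om i j + 2 * e * (A i * C j - C i * A j)
    & forall i, Om' i a = - Om i a].

(** The chamber [a] is four-valent: its left and right neighbours stand against those below and
    above, as in the Desnanot-Jacobi identity. *)
Lemma word_form_mixed phi c p a d :
  (p.+1 < k)%N -> ~ on_level phi a -> a != d ->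
  form_mutation a (color_sign c)
    (fun i => chamber_at phi p.+1 i + (d == i)%:R)
    (fun i => chamber_at phi p i + chamber_at phi p.+2 i)
    (word_form phi [:: (c, p, a); (~~ c, p, d)])
    (word_form phi [:: (~~ c, p, a); (c, p, d)]).
Proof.
move=> pk na ad; have n1 := chamber_at_notin _ na.
have sN : color_sign (~~ c) = - color_sign c by case: (c).
split=> [i | i j ia ja | i] /=; rewrite /step_form /= ?sN !addr0
  !chamber_at_relabel !chamber_at_relabel_neq ?eqn_leq ?ltnn ?andbF //;
  try lia; rewrite /wedge.
- rewrite eqxx [d == a]eq_sym (negPf ad) !n1; [rewrite mulr0n mulr1n; ring | lia..].
- rewrite ![a == _]eq_sym (negPf ia) (negPf ja) mulr0n; ring.
Qed.

(** The move replaces the chamber [a], which leaves level [p.+1] and reappears at level [q.+1]. The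
    chambers [b] and [d] keep their levels and only change their order in the word. *)
Lemma word_form_braid phi c p q a b d : q = p.+1 \/ p = q.+1 ->
  (p.+1 < k)%N -> (q.+1 < k)%N -> ~ on_level phi a -> uniq [:: a; b; d] ->
  form_mutation a (color_sign c)
    (fun i => chamber_at phi p.+1 i + (b == i)%:R)
    (fun i => chamber_at phi q.+1 i + (d == i)%:R)
    (word_form phi [:: (c, p, a); (c, q, b); (c, p, d)])
    (word_form phi [:: (c, q, a); (c, p, d); (c, q, b)]).
Proof.
move=> pq pk qk na; have n1 := chamber_at_notin _ na.
rewrite /= !inE negb_or andbT => /andP[/andP[ab ad] bd].
have ba := ab; have da := ad; rewrite eq_sym in ba; rewrite eq_sym in da.
case: pq => e; subst; split=> [i | i j ia ja | i] /=; rewrite /step_form /= !addr0;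
  rewrite !(chamber_at_relabel, chamber_at_relabel_neq); try lia; rewrite /wedge.
all: rewrite ?eqxx ?(negPf ba) ?(negPf da) ?mulr0n ?mulr1n.
all: try by rewrite !n1; [ring | lia..].
all: rewrite ![a == _]eq_sym (negPf ia) (negPf ja) mulr0n; ring.
Qed.

End Labels.

(** * Seeds of double wiring diagrams *)

Definition is_perm (k : nat) (u : nat -> nat) : Prop :=
  [/\ forall i, (i < k)%N -> (u i < k)%N,
      forall i j, (i < k)%N -> (j < k)%N -> u i = u j -> i = j
    & forall i, (k <= i)%N -> u i = i].

Definition perm_state k (st : state) : Prop := is_perm k st.1 /\ is_perm k st.2.

Lemma is_perm_swap k p u : (p.+1 < k)%N -> is_perm k u -> is_perm k (swap p u).
Proof.
move=> pk [lt_u inj_u id_u].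
have tr_lt i : (i < k)%N -> (transpose_at p i < k)%N.
  by rewrite /transpose_at; case: eqP => [_|_]; [|case: eqP => [_|_]]; lia.
split=> [i ik | i j ik jk /inj_u e | i ik]; rewrite ?/swap.
- by apply: lt_u; apply: tr_lt.
- by apply: (can_inj (transpose_atK p)); apply: e; apply: tr_lt.
- by rewrite -[RHS](id_u i) // /transpose_at; congr u; case: eqP => [|_]; [lia|]; case: eqP => [|//]; lia.
Qed.

Lemma perm_state_step k st y : admissible k st y -> perm_state k st ->
  perm_state k (step st y).
Proof.
by case/andP=> pk _ [h1 h2]; rewrite /step; case: ifP => _; split=> //=;
  apply: is_perm_swap.
Qed.

Lemma perm_state_run k st w : valid k st w -> perm_state k st ->
  perm_state k (run st w).
Proof.
elim: w st => //= y w IH st /andP[ad va] ps.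
by apply: IH => //; apply: perm_state_step.
Qed.

Lemma valid_lt k st (V : eqType) (w : seq (letter * V)) :
  valid k st (map fst w) -> forall t, t \in w -> (t.1.2.+1 < k)%N.
Proof.
elim: w st => //= t w IH st /andP[/andP[pk _] /IH h] t'.
by rewrite inE => /orP[/eqP->|/h].
Qed.

Lemma swap_braid p u :
  swap p (swap p.+1 (swap p u)) = swap p.+1 (swap p (swap p.+1 u)).
Proof.
apply: functional_extensionality => i; rewrite /swap; congr u.
have [->|i0] := eqVneq i p.
  by rewrite /transpose_at eqxx !(eqn_leq, ltnn, leqnn, leqnSn, ltnS, andbF) /=;
     do ?case: ifP; lia.
have [->|i1] := eqVneq i p.+1.
  by rewrite /transpose_at eqxx !(eqn_leq, ltnn, leqnn, leqnSn, ltnS, andbF) /=;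
     do ?case: ifP; lia.
by rewrite /transpose_at (negPf i0) (negPf i1); do ?case: ifP; lia.
Qed.

Lemma step_braid c p q st : q = p.+1 \/ p = q.+1 ->
  run st [:: (c, p); (c, q); (c, p)] = run st [:: (c, q); (c, p); (c, q)].
Proof.
case: st => u v; rewrite /run /step; case: c => -[->|->] /=;
by rewrite swap_braid.
Qed.

Lemma valid_braid k c p q st : q = p.+1 \/ p = q.+1 ->
  valid k st [:: (c, p); (c, q); (c, p)] ->
  valid k st [:: (c, q); (c, p); (c, q)].
Proof.
case: st => u v; rewrite /= /admissible /step; case: c => -[->|->] /=;
  rewrite /swap /transpose_at !eqxx !(eqn_leq, ltnn, leqnn, leqnSn, andbF, andbT) /=;
  do ?case: ifP; lia.
Qed.

Section Representation.
Variables (F : fieldType) (n f k : nat) (Z : nat -> nat -> F).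
Implicit Types (st : state) (phi : nat -> 'I_(n + f)) (x : 'I_(n + f) -> F).
Implicit Types (w : seq (letter * 'I_(n + f))) (s : seed_data F n f).

Definition chamber_minor st q : F := set_minor Z q st.1 st.2.

Definition state_vars x st phi : Prop :=
  forall q, (0 < q <= k)%N -> x (phi q) = chamber_minor st q.

Fixpoint word_vars x st phi w : Prop :=
  state_vars x st phi /\
  if w is t :: w' then word_vars x (step st t.1) (relabel phi t.1.2 t.2) w'
  else True.

Record represents s st phi w : Prop := Represents {
  rep_valid : valid k st (map fst w);
  rep_fresh : fresh_labels k phi w;
  rep_inner : forall a, a \in map snd w ->
    on_level k (run_labels phi w) a \/ exists l, a = lshift f l;
  rep_mx : forall i (j : 'I_n),
    2 * seed_mx s i j = word_form phi w i (lshift f j);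
  rep_vars : word_vars (seed_var s) st phi w }.

Lemma word_vars_cat x st phi w w' : word_vars x st phi (w ++ w') <->
  word_vars x st phi w /\
  word_vars x (run st (map fst w)) (run_labels phi w) w'.
Proof.
elim: w st phi => [|t w IH] st phi /=; last by rewrite IH; tauto.
split=> [h|[]//]; split=> //; split=> //.
by case: w' h => [|t w] [].
Qed.

Lemma word_vars_head x st phi w : word_vars x st phi w -> state_vars x st phi.
Proof. by case: w => [|t w] []. Qed.

Lemma state_vars_ext x x' a st phi : (forall i, i != a -> x i = x' i) ->
  ~ on_level k phi a -> state_vars x st phi -> state_vars x' st phi.
Proof.
move=> e na h q qk; rewrite -h // e //.
by apply/eqP => pa; apply: na; exists q.
Qed.

Lemma word_vars_ext x x' a st phi w : (forall i, i != a -> x i = x' i) ->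
  ~ on_level k phi a -> a \notin map snd w -> word_vars x st phi w ->
  word_vars x' st phi w.
Proof.
move=> e; elim: w st phi => [|t w IH] st phi na /=.
  by move=> _ [h _]; split=> //; apply: (state_vars_ext e na h).
rewrite inE negb_or => /andP[at1 aw] [h hw]; split.
  exact: (state_vars_ext e na h).
apply: IH hw => //; case=> q qk; rewrite /relabel; case: eqP => [_ e1|_ e1].
  by rewrite e1 eqxx in at1.
by apply: na; exists q.
Qed.

Lemma chamber_minor_step st y q : admissible k st y -> q != y.2.+1 ->
  chamber_minor (step st y) q = chamber_minor st q.
Proof.
rewrite /admissible /step /chamber_minor => /andP[_].
by case: ifP => _ lt qp /=; rewrite ?set_minor_swapl ?set_minor_swapr //; lia.
Qed.

Lemma state_vars_step x st phi y a : admissible k st y ->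
  state_vars x st phi -> x a = chamber_minor (step st y) y.2.+1 ->
  state_vars x (step st y) (relabel phi y.2 a).
Proof.
move=> ad h xa q qk; rewrite /relabel; case: eqP => [->//|/eqP qp].
by rewrite h // chamber_minor_step.
Qed.

Lemma prod_expr_add x (A C : 'I_(n + f) -> int) :
  (forall i, 0 <= A i) -> (forall i, 0 <= C i) ->
  \prod_h x h ^+ absz (A h + C h) = (\prod_h x h ^+ `|A h|%N) * \prod_h x h ^+ `|C h|%N.
Proof.
move=> A0 C0; rewrite -big_split; apply: eq_bigr => h _ /=; rewrite -exprD.
by congr (_ ^+ _); have := A0 h; have := C0 h; lia.
Qed.

Lemma prod_expr_delta x a : \prod_h x h ^+ absz ((a == h)%:R : int) = x a.
Proof.
rewrite (bigD1 a) //= eqxx big1 ?mulr1 // => h ha.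
by rewrite eq_sym (negPf ha).
Qed.

Lemma prod_expr_chamber x st phi q : (q <= k)%N -> state_vars x st phi ->
  \prod_h x h ^+ absz (chamber_at phi q h) = chamber_minor st q.
Proof.
move=> qk h; rewrite /chamber_at; have [->|q0] := posnP q.
  by rewrite big1 // /chamber_minor set_minor0.
by rewrite /= prod_expr_delta h // q0.
Qed.

Lemma chamber_at_ge0 phi q i : 0 <= chamber_at phi q i.
Proof. by rewrite /chamber_at; case: (_ && _). Qed.

Lemma binomial_of_form m (y : 'I_m -> F) e (A C : 'I_m -> int) :
  e = 1 \/ e = -1 -> (forall i, 0 <= A i) -> (forall i, 0 <= C i) ->
  (forall i, A i + C i <= 1) ->
  binomial_of y (fun i => e * (A i - C i)) =
  \prod_h y h ^+ `|A h|%N + \prod_h y h ^+ `|C h|%N.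
Proof.
move=> e1 A0 C0 AC1; have E b i : pos_part (b * (A i - C i)) =
    if b == 1 then `|A i|%N else if b == -1 then `|C i|%N else
    pos_part (b * (A i - C i)).
  have := A0 i; have := C0 i; have := AC1 i.
  case: eqP => [->|_]; last case: eqP => [->|_] //; rewrite /pos_part; case: ifP; lia.
case: e1 => ->; [|rewrite addrC]; congr (_ + _); apply: eq_bigr => h _;
  by rewrite -?mulNr ?opprK E.
Qed.

(** Column [l] is, up to sign, a difference of disjoint 0/1 indicators. For such values the
    piecewise linear mutation rule agrees with the bilinear correction of [form_mutation], by
    inspection of the three possible values at [i] and at [j]. *)
Lemma mutate_mx_form (B : 'M[int]_(n + f, n)) l e A C Om Om' :
  (forall i (j : 'I_n), 2 * B i j = Om i (lshift f j)) ->
  (forall i j, Om i j = - Om j i) -> (forall i j, Om' i j = - Om' j i) ->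
  e = 1 \/ e = -1 -> (forall i, 0 <= A i) -> (forall i, 0 <= C i) ->
  (forall i, A i + C i <= 1) -> form_mutation (lshift f l) e A C Om Om' ->
  forall i (j : 'I_n), 2 * mutate_mx B l i j = Om' i (lshift f j).
Proof.
move=> hB anti anti' e1 A0 C0 AC1 [h1 h2 h3] i j.
have Bl i' : B i' l = e * (A i' - C i').
  by apply: (@mulfI _ (2 : int)) => //; rewrite hB h1 mulrA.
have [/orP h|] := boolP ((i == lshift f l) || (j == l)).
  rewrite mutate_mx_flip ?mulrN ?hB; last by apply/orP.
  by case: h => /eqP ->; [rewrite anti -h3 -anti' | rewrite h3].
rewrite negb_or => /andP[il jl]; rewrite mutate_mxE // h2 ?lshift_eq // -hB.
have Blj : B (lshift f l) j = - (e * (A (lshift f j) - C (lshift f j))).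
  apply: (@mulfI _ (2 : int)) => //; rewrite hB anti h1; ring.
rewrite Bl Blj opprK; move: (lshift f j) => J.
have := A0 i; have := C0 i; have := AC1 i.
have := A0 J; have := C0 J; have := AC1 J.
move: (A i) (C i) (A J) (C J) => a c a' c' *.
have [[-> ->]|[[-> ->]|[-> ->]]] : a = 0 /\ c = 0 \/ a = 1 /\ c = 0 \/ a = 0 /\ c = 1.
  lia.
all: have [[-> ->]|[[-> ->]|[-> ->]]] : a' = 0 /\ c' = 0 \/ a' = 1 /\ c' = 0 \/
  a' = 0 /\ c' = 1 by lia.
all: have [P1 P0 PN] : [/\ pos_part 1 = 1%N, pos_part 0 = 0%N & pos_part (-1) = 0%N]
  by [].
all: by case: e1 => ->;
  rewrite !(subr0, sub0r, oppr0, mulr0, mul1r, mulN1r, opprK) ?P1 ?P0 ?PN; lia.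
Qed.

(** From local to global: the chamber [a] is opened and closed inside [m], so the outer words
    contribute nothing to its column and carry none of its values. *)
Lemma represents_mutate s st phi w1 m m' w2 l e A C y :
  let a := lshift f l in let st1 := run st (map fst w1) in
  let phi1 := run_labels phi w1 in let x := seed_var s in
  represents s st phi (w1 ++ m ++ w2) -> e = 1 \/ e = -1 ->
  (forall i, 0 <= A i) -> (forall i, 0 <= C i) -> (forall i, A i + C i <= 1) ->
  form_mutation a e A C (word_form phi1 m) (word_form phi1 m') ->
  a \in map snd m -> ~ on_level k (run_labels phi1 m) a ->
  perm_eq (map snd m') (map snd m) ->
  valid k st1 (map fst m') ->
  run st1 (map fst m') = run st1 (map fst m) ->
  run_labels phi1 m' = run_labels phi1 m -> x a != 0 ->
  \prod_h x h ^+ `|A h|%N + \prod_h x h ^+ `|C h|%N = x a * y ->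
  word_vars (fun i => if i == a then y else x i) st1 phi1 m' ->
  represents (mutate s l) st phi (w1 ++ m' ++ w2).
Proof.
move=> a st1 phi1 x [va fr inn mx vars] e1 A0 C0 AC1 fm am na2 pm vm' rst rphi xa0 exy vm.
have va1 := va; rewrite !map_cat !valid_cat -/st1 in va1.
have /and3P[v1 v2 v3] := va1.
have pm' : perm_eq (map snd (w1 ++ m' ++ w2)) (map snd (w1 ++ m ++ w2)).
  by rewrite !map_cat perm_cat2l perm_cat2r.
have lt1 := valid_lt v1; have ltm := valid_lt v2; have lt2 := valid_lt v3.
have na0 : ~ on_level k phi a.
  by case: fr => _ h _; apply: h; rewrite !map_cat !mem_cat am orbT.
have [aw1 aw2] : a \notin map snd w1 /\ a \notin map snd w2.
  case: fr => _ _; rewrite !map_cat cat_uniq => /and3P[_ /hasPn h1].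
  rewrite cat_uniq => /and3P[_ /hasPn h2 _]; split.
    by apply: h1; rewrite mem_cat am.
  by apply/negP => /h2; rewrite /= am.
have runE m0 : run_labels phi (w1 ++ m0) = run_labels phi1 m0.
  by rewrite /run_labels foldl_cat.
have fm' : form_mutation a e A C (word_form phi (w1 ++ m ++ w2))
    (word_form phi (w1 ++ m' ++ w2)).
  have E m0 i j : word_form phi (w1 ++ m0 ++ w2) i j = word_form phi w1 i j +
      word_form phi1 m0 i j + word_form (run_labels phi1 m0) w2 i j.
    by rewrite !word_form_cat addrA.
  have z1 i : word_form phi w1 i a = 0.
    by rewrite word_form_antisym (word_form_notin (k := k)) ?oppr0.
  have z2 i : word_form (run_labels phi1 m) w2 i a = 0.
    by rewrite word_form_antisym (word_form_notin (k := k)) ?oppr0.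
  case: fm => h1 h2 h3; split=> [i|i j ia ja|i]; rewrite !E ?rphi.
  - by rewrite z1 z2 h1; ring.
  - by rewrite h2 //; ring.
  - by rewrite z1 z2 h3; ring.
have x'E i : i != a -> mutate_var s l i = x i by apply: mutate_var_id.
have x'a : mutate_var s l a = y.
  apply: (mulfI xa0); rewrite -exy mutate_varM // -(binomial_of_form _ e1) //.
  have Bl i : seed_mx s i l = e * (A i - C i).
    by case: fm' => h1 _ _; apply: (@mulfI _ (2 : int)) => //; rewrite mx h1 mulrA.
  by congr (_ + _); apply: eq_bigr => h _; rewrite Bl.
split.
- rewrite !map_cat !valid_cat -/st1 v1 vm' rst; exact: v3.
- case: fr => h1 h2 h3; split=> //; last by rewrite (perm_uniq pm').
  by move=> b; rewrite (perm_mem pm'); apply: h2.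
- move=> b; rewrite (perm_mem pm') => /inn[].
    by rewrite /run_labels !foldl_cat -!/(run_labels _ _) -/phi1 rphi; left.
  by right.
- move=> i j; apply: (mutate_mx_form mx _ _ e1 A0 C0 AC1 fm').
    by move=> *; apply: word_form_antisym.
  by move=> *; apply: word_form_antisym.
- apply/word_vars_cat; case/word_vars_cat: vars => hv1 /word_vars_cat[hvm hv2].
  split; first by apply: (word_vars_ext _ na0 aw1 hv1) => i ia; rewrite /= x'E.
  apply/word_vars_cat; split.
    have -> // : seed_var (mutate s l) = fun i => if i == a then y else x i.
    apply: functional_extensionality => i.
    by case: eqP => [->//|/eqP ia]; apply: x'E.
  by rewrite rst rphi; apply: (word_vars_ext _ na2 aw2 hv2) => i ia; rewrite /= x'E.
Qed.

Lemma on_level_run phi w a :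
  on_level k (run_labels phi w) a -> on_level k phi a \/ a \in map snd w.
Proof.
elim: w phi => [|t w IH] phi; first by left.
move=> /IH[[q qk]|aw]; last by right; rewrite /= inE aw orbT.
rewrite /relabel; case: eqP => [_ <-|_ e]; first by right; apply: mem_head.
by left; exists q.
Qed.

Lemma not_on_level_overwrite phi p a b c : ~ on_level k phi a -> b != a ->
  ~ on_level k (relabel (relabel phi p c) p b) a.
Proof.
move=> na ba [q qk]; rewrite /relabel; case: eqP => [_ e|_ e].
  by rewrite e eqxx in ba.
by apply: na; exists q.
Qed.

(** Labels are never reused, so a chamber closed inside [m] does not reach the right end and must be
    mutable. *)
Lemma represents_inner s st phi w1 m w2 a :
  represents s st phi (w1 ++ m ++ w2) -> a \in map snd m ->
  ~ on_level k (run_labels (run_labels phi w1) m) a ->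
  exists l, a = lshift f l.
Proof.
move=> [va fr inn _ _] am na.
have: a \in map snd (w1 ++ m ++ w2) by rewrite !map_cat !mem_cat am orbT.
move=> /inn[|//]; rewrite /run_labels !foldl_cat -!/(run_labels _ _).
move=> /on_level_run[//|aw2]; case: fr => _ _.
rewrite !map_cat !cat_uniq => /and3P[_ _ /and3P[_ /hasPn h _]].
by have := h a aw2; rewrite /= am.
Qed.

Lemma represents_local s st phi w1 m w2 : represents s st phi (w1 ++ m ++ w2) ->
  [/\ valid k (run st (map fst w1)) (map fst m),
      fresh_labels k (run_labels phi w1) (m ++ w2)
    & word_vars (seed_var s) (run st (map fst w1)) (run_labels phi w1) m].
Proof.
move=> [va fr _ _ /word_vars_cat[_ /word_vars_cat[vm _]]].
move: va; rewrite !map_cat !valid_cat => /and3P[v1 v2 _].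
by split=> //; apply: fresh_labels_run fr; apply: valid_lt v1.
Qed.

Lemma chamber_at_disjoint phi q q' i :
  (forall q q', (0 < q <= k)%N -> (0 < q' <= k)%N -> phi q = phi q' -> q = q') ->
  (q <= k)%N -> (q' <= k)%N -> q != q' ->
  chamber_at phi q i + chamber_at phi q' i <= 1.
Proof.
move=> inj qk qk' qq'; rewrite /chamber_at.
case: ltnP => q0 /=; case: ltnP => q0' //=; do 2 case: eqP => //.
move=> e e'; case/eqP: qq'; apply: inj; rewrite ?q0 ?q0' // e e' //.
Qed.

Lemma color_signP c : color_sign c = 1 \/ color_sign c = -1.
Proof. by case: c; [left | right]. Qed.

Lemma delta_ge0 (d i : 'I_(n + f)) : 0 <= (d == i)%:R :> int.
Proof. by case: eqP. Qed.

Lemma chamber_minor_braid_up c p st : chamber_minor st p != 0 ->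
  valid k st [:: (c, p); (c, p.+1); (c, p)] ->
  chamber_minor (run st [:: (c, p)]) p.+1 *
    chamber_minor (run st [:: (c, p.+1)]) p.+2 =
  chamber_minor st p.+1 * chamber_minor (run st [:: (c, p); (c, p.+1)]) p.+2 +
  chamber_minor (run st [:: (c, p); (c, p.+1); (c, p)]) p.+1 *
    chamber_minor st p.+2.
Proof.
have e2 u : swap p u p.+2 = u p.+2 by apply: swapD; lia.
have e3 u : swap p.+1 (swap p u) p = u p.+1 by rewrite swapD ?swapL //; lia.
have e4 u : swap p.+1 (swap p u) p.+1 = u p.+2 by rewrite swapL.
case: st => u v nz; case: c.
- move=> /and4P[/andP[_ /= h1] /andP[_ /= h2] /andP[_ /= h3] _].
  rewrite swapR e2 in h2; rewrite e3 e4 in h3.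
  by apply: (@set_minor_braid _ _ _ _ _ false nz); apply/negbTE; rewrite -leqNgt ltnW.
- move=> /and4P[/andP[_ /= h1] /andP[_ /= h2] /andP[_ /= h3] _].
  rewrite swapR e2 in h2; rewrite e3 e4 in h3.
  rewrite /chamber_minor /= -!(set_minor_tr Z).
  by apply: (@set_minor_braid _ _ _ _ _ true) => //; rewrite set_minor_tr.
Qed.

(** If [q] lies below [p], the relation is the one for the other side of the hexagon: both sides end
    in the same state, and the two factors of each product trade places. *)
Lemma chamber_minor_braid c p q st : q = p.+1 \/ p = q.+1 ->
  chamber_minor st (minn p q) != 0 ->
  valid k st [:: (c, p); (c, q); (c, p)] ->
  chamber_minor (run st [:: (c, p)]) p.+1 *
    chamber_minor (run st [:: (c, q)]) q.+1 =
  chamber_minor st p.+1 * chamber_minor (run st [:: (c, p); (c, q)]) q.+1 +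
  chamber_minor (run st [:: (c, p); (c, q); (c, p)]) p.+1 *
    chamber_minor st q.+1.
Proof.
move=> pq nz va; have va' := valid_braid pq va.
case: pq => e; subst; last first.
  have -> : chamber_minor (run st [:: (c, q.+1); (c, q); (c, q.+1)]) q.+2 =
      chamber_minor (run st [:: (c, q); (c, q.+1)]) q.+2.
    rewrite step_braid; last by right.
    by case/and4P: va' => _ _ h _; rewrite /= (chamber_minor_step h) // eqn_leq ltnn.
  have -> : chamber_minor (run st [:: (c, q.+1); (c, q)]) q.+1 =
      chamber_minor (run st [:: (c, q); (c, q.+1); (c, q)]) q.+1.
    rewrite step_braid; last by left.
    case/and4P: va => _ _ h _; rewrite /= (chamber_minor_step h) //.
    by rewrite eqn_leq ltnn andbF.
  rewrite [LHS]mulrC chamber_minor_braid_up //; last by rewrite (minn_idPr _) in nz.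
  by rewrite addrC mulrC; congr (_ + _); rewrite mulrC.
by apply: chamber_minor_braid_up => //; rewrite (minn_idPl _) in nz.
Qed.

Hypothesis minor_neq0 : forall st q, perm_state k st -> (q <= k)%N ->
  chamber_minor st q != 0.

Lemma represents_mixed s st phi w1 w2 c p a d : perm_state k st ->
  represents s st phi (w1 ++ [:: (c, p, a); (~~ c, p, d)] ++ w2) ->
  exists l, represents (mutate s l) st phi
    (w1 ++ [:: (~~ c, p, a); (c, p, d)] ++ w2).
Proof.
move=> ps rep; set m := [:: _; _] in rep.
have [vm fr vars] := represents_local rep.
set st1 := run st _ in vm fr vars; set phi1 := run_labels phi w1 in fr vars.
have ps1 : perm_state k st1.
  apply: perm_state_run => //; case: rep => va _ _ _ _.
  by move: va; rewrite map_cat valid_cat => /andP[].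
have [inj fresh] := fr; rewrite map_cat cat_uniq /= inE andbT => /andP[ad _].
have na : ~ on_level k phi1 a by apply: fresh; rewrite /= inE eqxx.
have nd : ~ on_level k phi1 d by apply: fresh; rewrite /= !inE eqxx orbT.
move: vm => /= /and3P[ad1 ad2 _].
have pk : (p.+1 < k)%N by case/andP: ad1.
have na2 : ~ on_level k (run_labels phi1 m) a.
  by apply: not_on_level_overwrite; rewrite // eq_sym.
have [l el] : exists l, a = lshift f l.
  by apply: (represents_inner rep _ na2); rewrite mem_head.
have ad1' : admissible k st1 (~~ c, p).
  by move: ad2; rewrite /admissible /step /=; case: (c).
have ad2' : admissible k (step st1 (~~ c, p)) (c, p).
  by move: ad1; rewrite /admissible /step /=; case: (c).
have stE : step (step st1 (~~ c, p)) (c, p) = step (step st1 (c, p)) (~~ c, p).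
  by rewrite /step; case: (c).
move: vars => /= [sv1 [sv2 [sv3 _]]].
have xa : seed_var s a = chamber_minor (step st1 (c, p)) p.+1.
  by rewrite -sv2 ?relabelE //; lia.
have xd : seed_var s d = chamber_minor (step (step st1 (c, p)) (~~ c, p)) p.+1.
  by rewrite -sv3 ?relabelE //; lia.
subst a; exists l; have fm := @word_form_mixed _ k phi1 c p _ d pk na ad.
apply: (represents_mutate (y := chamber_minor (step st1 (~~ c, p)) p.+1) rep
  (color_signP c) _ _ _ fm).
- by move=> i; rewrite addr_ge0 ?chamber_at_ge0 ?delta_ge0.
- by move=> i; rewrite addr_ge0 ?chamber_at_ge0.
- move=> i; case: eqP => [<-|_].
    by rewrite !(chamber_at_notin _ nd) //; lia.
  have h1 := @chamber_at_disjoint phi1 p.+1 p i inj; have h2 := @chamber_at_disjoint phi1 p.+1 p.+2 i inj.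
  have h3 := @chamber_at_disjoint phi1 p p.+2 i inj.
  have := h1 _ _ _; have := h2 _ _ _; have := h3 _ _ _; lia.
- by rewrite mem_head.
- exact: na2.
- by [].
- by rewrite /= ad1' ad2'.
- by rewrite /= stE.
- by [].
- by rewrite xa minor_neq0 //; [apply: perm_state_step | lia].
- rewrite !prod_expr_add; try by move=> i; rewrite ?chamber_at_ge0 ?delta_ge0.
  rewrite !(prod_expr_chamber _ sv1); [|lia..].
  rewrite prod_expr_delta xa xd /chamber_minor.
  have nzp : chamber_minor st1 p != 0 by apply: minor_neq0 => //; lia.
  move: ad1 ad2; rewrite /admissible /step; case: (c) => /= /andP[_ h1] /andP[_ h2].
    by rewrite set_minor_mixed.
  by rewrite [RHS]mulrC set_minor_mixed.
- rewrite /=; split; last split.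
  + by apply: (state_vars_ext _ na sv1) => i /negPf ->.
  + apply: state_vars_step => //; last by rewrite eqxx.
    by apply: (state_vars_ext _ na sv1) => i /negPf ->.
  + by split=> //; rewrite stE; apply: (state_vars_ext _ na2 sv3) => i /negPf ->.
Qed.

Lemma represents_braid s st phi w1 w2 c p q a b d : q = p.+1 \/ p = q.+1 ->
  perm_state k st ->
  represents s st phi (w1 ++ [:: (c, p, a); (c, q, b); (c, p, d)] ++ w2) ->
  exists l, represents (mutate s l) st phi
    (w1 ++ [:: (c, q, a); (c, p, d); (c, q, b)] ++ w2).
Proof.
move=> pq; have neq_pq : p != q by lia.
move=> ps rep; set m := [:: _; _; _] in rep.
have [vm fr vars] := represents_local rep.
set st1 := run st _ in vm fr vars; set phi1 := run_labels phi w1 in fr vars.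
have ps1 : perm_state k st1.
  apply: perm_state_run => //; case: rep => va _ _ _ _.
  by move: va; rewrite map_cat valid_cat => /andP[].
have [inj fresh] := fr; rewrite map_cat cat_uniq => /and3P[uq _ _].
have na : ~ on_level k phi1 a by apply: fresh; rewrite /= inE eqxx.
have nb : ~ on_level k phi1 b by apply: fresh; rewrite /= !inE eqxx orbT.
have nd : ~ on_level k phi1 d by apply: fresh; rewrite /= !inE eqxx !orbT.
have vm' := valid_braid pq vm; have exch := @chamber_minor_braid c p q st1 pq.
have stE := step_braid c st1 pq.
have [ad1 ad2 ad3] : [/\ admissible k st1 (c, p),
    admissible k (run st1 [:: (c, p)]) (c, q)
  & admissible k (run st1 [:: (c, p); (c, q)]) (c, p)] by case/and4P: vm.
have [ad1' ad2' ad3'] : [/\ admissible k st1 (c, q),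
    admissible k (run st1 [:: (c, q)]) (c, p)
  & admissible k (run st1 [:: (c, q); (c, p)]) (c, q)] by case/and4P: vm'.
have pk : (p.+1 < k)%N by case/andP: ad1.
have qk : (q.+1 < k)%N by case/andP: ad1'.
have pk1 : (0 < p.+1 <= k)%N := ltnW pk.
have qk1 : (0 < q.+1 <= k)%N := ltnW qk.
move: (uq); rewrite /= !inE negb_or andbT => /andP[/andP[ab ad] bd].
have na2 : ~ on_level k (run_labels phi1 m) a.
  move=> [r rk]; rewrite /run_labels /= /relabel.
  case: (r =P p.+1) => [_ e|_]; first by rewrite e eqxx in ad.
  case: (r =P q.+1) => [_ e|_ e]; first by rewrite e eqxx in ab.
  by apply: na; exists r.
have [l el] : exists l, a = lshift f l.
  by apply: (represents_inner rep _ na2); rewrite mem_head.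
have phiE : relabel (relabel (relabel phi1 q a) p d) q b =
    relabel (relabel (relabel phi1 p a) q b) p d.
  apply: functional_extensionality => r; rewrite /relabel.
  case rq: (r == q.+1); case rp: (r == p.+1) => //.
  by rewrite (eqP rq) eqSS eq_sym (negPf neq_pq) in rp.
move: vars => /= [sv1 [sv2 [sv3 [sv4 _]]]].
have xa : seed_var s a = chamber_minor (run st1 [:: (c, p)]) p.+1.
  by rewrite -sv2 ?relabelE.
have xb : seed_var s b = chamber_minor (run st1 [:: (c, p); (c, q)]) q.+1.
  by rewrite -sv3 ?relabelE.
have xd : seed_var s d = chamber_minor (run st1 [:: (c, p); (c, q); (c, p)]) p.+1.
  by rewrite -sv4 ?relabelE.
subst a; exists l.
have fm := @word_form_braid _ k phi1 c p q _ b d pq pk qk na uq.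
apply: (represents_mutate (y := chamber_minor (run st1 [:: (c, q)]) q.+1) rep
  (color_signP c) _ _ _ fm).
- by move=> i; rewrite addr_ge0 ?chamber_at_ge0 ?delta_ge0.
- by move=> i; rewrite addr_ge0 ?chamber_at_ge0 ?delta_ge0.
- move=> i; have neq_pq' : p.+1 != q.+1 by rewrite eqSS.
  have h := @chamber_at_disjoint phi1 p.+1 q.+1 i inj (ltnW pk) (ltnW qk) neq_pq'.
  have [<-|_] := eqVneq b i.
    by rewrite !(chamber_at_notin _ nb) 1?[d == b]eq_sym ?(negPf bd) ?(ltnW pk) ?(ltnW qk).
  have [<-|_] := eqVneq d i; last by rewrite !addr0.
  by rewrite !(chamber_at_notin _ nd) ?(ltnW pk) ?(ltnW qk).
- by rewrite mem_head.
- exact: na2.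
- by rewrite /= perm_cons (perm_catC [:: d] [:: b]).
- exact: vm'.
- exact: esym stE.
- by rewrite /run_labels /= phiE.
- by rewrite xa minor_neq0 ?(ltnW pk) //; apply: perm_state_step.
- rewrite !prod_expr_add; try by move=> i; rewrite ?chamber_at_ge0 ?delta_ge0.
  rewrite !(prod_expr_chamber _ sv1) ?(ltnW pk) ?(ltnW qk) //.
  rewrite !prod_expr_delta xa xb xd exch //; first by rewrite [X in _ + X]mulrC.
  apply: minor_neq0 => //; rewrite geq_min.
  by rewrite (ltnW (ltnW pk)).
- have ext : forall i, i != lshift f l -> seed_var s i =
    (if i == lshift f l then chamber_minor (run st1 [:: (c, q)]) q.+1 else seed_var s i).
    by move=> i /negPf ->.
  have sv2' := state_vars_step ad1' (state_vars_ext ext na sv1).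
  have {}sv2' := sv2' (lshift f l); rewrite eqxx in sv2'.
  have {}sv2' := sv2' erefl.
  split; first exact: state_vars_ext ext na sv1.
  split; first exact: sv2'.
  split.
    apply: (state_vars_step ad2' sv2'); rewrite eq_sym (negPf ad) xd stE.
    by rewrite /= (chamber_minor_step ad3') // eqSS.
  split=> //; rewrite -/phi1 phiE.
  have -> : step (step (step st1 (c, q)) (c, p)) (c, q) =
    step (step (step st1 (c, p)) (c, q)) (c, p) by rewrite -!/(run _ _) in stE *.
  exact: state_vars_ext ext na2 sv4.
Qed.

End Representation.

(** * Counting crossings *)

Section Counting.
Variable k : nat.

Definition inversions u : nat := big_pairs addn (fun a b => (b < a)%N : nat) k u.
Definition noninversions u : nat :=
  big_pairs addn (fun a b => (a < b)%N : nat) k u.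

Lemma noninversions_swap p u : (p.+1 < k)%N -> (u p < u p.+1)%N ->
  noninversions u = (noninversions (swap p u)).+1.
Proof.
move=> pk lt; rewrite /noninversions.
have [r [-> ->]] :=
  @big_pairs_swap nat 0%N addn (fun a b => (a < b)%N : nat) p k u pk.
by rewrite lt ltnNge (ltnW lt) /= addn0 addn1.
Qed.

Lemma inversions_swap p u : (p.+1 < k)%N -> (u p.+1 < u p)%N ->
  inversions u = (inversions (swap p u)).+1.
Proof.
move=> pk lt; rewrite /inversions.
have [r [-> ->]] :=
  @big_pairs_swap nat 0%N addn (fun a b => (b < a)%N : nat) p k u pk.
by rewrite lt ltnNge (ltnW lt) /= addn0 addn1.
Qed.

Definition reversal (i : nat) : nat := if (i < k)%N then (k.-1 - i)%N else i.

Lemma is_perm_id : is_perm k id.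
Proof. by []. Qed.

Lemma is_perm_reversal : is_perm k reversal.
Proof.
split=> [i ik|i j ik jk|i ik]; rewrite /reversal ?ik ?jk; try lia.
by rewrite ltnNge ik.
Qed.

Lemma is_perm_increasing u : is_perm k u ->
  (forall p, (p.+1 < k)%N -> (u p < u p.+1)%N) -> u = id.
Proof.
move=> [lt_u inj_u id_u] inc; apply: functional_extensionality => i.
have [ki|ik] := leqP k i; first exact: id_u.
have up d j : (j + d < k)%N -> (u j + d <= u (j + d))%N.
  elim: d => [|d IH]; first by rewrite !addn0.
  rewrite !addnS => h; have := inc _ h; have := IH (ltnW h); lia.
have := up i 0%N; have := up (k.-1 - i)%N i; have := lt_u k.-1.
have -> : (i + (k.-1 - i))%N = k.-1 by lia.
rewrite add0n; lia.
Qed.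

Lemma is_perm_decreasing u : is_perm k u ->
  (forall p, (p.+1 < k)%N -> (u p.+1 < u p)%N) -> u = reversal.
Proof.
move=> [lt_u inj_u id_u] dec.
have E : (fun i => reversal (u i)) = id.
  apply: is_perm_increasing => [|p pk].
    split=> [i ik | i j ik jk | i ik]; rewrite /reversal.
    - by rewrite lt_u //; have := lt_u i ik; lia.
    - rewrite !lt_u // => e; apply: inj_u => //.
      by have := lt_u i ik; have := lt_u j jk; lia.
    - by rewrite id_u // ltnNge ik.
  rewrite /reversal !lt_u ?(ltnW pk) //.
  by have := dec p pk; have := lt_u p (ltnW pk); lia.
apply: functional_extensionality => i.
have [ki|ik] := leqP k i; first by rewrite id_u // /reversal ltnNge ki.
have := congr1 (fun g => g i) E; rewrite /reversal lt_u // ik.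
by have := lt_u i ik; lia.
Qed.

Lemma noninversions_id : noninversions id = 'C(k, 2).
Proof.
rewrite -triangular_sum /noninversions /big_pairs big_mkord.
apply: eq_bigr => j _; rewrite (eq_bigr (fun _ => 1%N)) => [|i _].
  by rewrite sum1_card card_ord.
by rewrite ltn_ord.
Qed.

Lemma noninversions_reversal : noninversions reversal = 0%N.
Proof.
rewrite /noninversions /big_pairs big1 // => j _; rewrite big1 // => i _.
by rewrite /reversal (ltn_trans (ltn_ord i)) // ltn_ord; have := ltn_ord i; lia.
Qed.

Lemma inversions_reversal : inversions reversal = 'C(k, 2).
Proof.
rewrite -triangular_sum /inversions /big_pairs big_mkord.
apply: eq_bigr => j _; rewrite (eq_bigr (fun _ => 1%N)) => [|i _].
  by rewrite sum1_card card_ord.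
by rewrite /reversal (ltn_trans (ltn_ord i)) // ltn_ord; have := ltn_ord i;
   have := ltn_ord j; lia.
Qed.

Lemma inversions_id : inversions id = 0%N.
Proof.
rewrite /inversions /big_pairs big1 // => j _; rewrite big1 // => i _.
by have := ltn_ord i; lia.
Qed.

(** The number of crossings still to come: each step lowers it by one, so maximal words exist and
    have the same length. *)
Definition remaining (st : state) : nat :=
  (noninversions st.1 + inversions st.2)%N.

Lemma remaining_step st y : admissible k st y ->
  remaining st = (remaining (step st y)).+1.
Proof.
rewrite /admissible /step /remaining => /andP[pk]; case: ifP => _ lt /=.
  by rewrite (noninversions_swap pk lt).
by rewrite (inversions_swap pk lt) addnS.
Qed.

Lemma run_cat st w w' : run st (w ++ w') = run (run st w) w'.
Proof. exact: foldl_cat. Qed.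

Lemma remaining_run st w : valid k st w ->
  remaining st = (size w + remaining (run st w))%N.
Proof.
elim: w st => //= y w IH st /andP[ad va].
by rewrite (remaining_step ad) (IH _ va).
Qed.

Definition terminal (st : state) : Prop := forall y, ~~ admissible k st y.

Lemma admissible_or_terminal st : (exists y, admissible k st y) \/ terminal st.
Proof.
have [/existsP[p hp]|h1] := boolP [exists p : 'I_k, admissible k st (true, p : nat)].
  by left; exists (true, p : nat).
have [/existsP[p hp]|h2] := boolP [exists p : 'I_k, admissible k st (false, p : nat)].
  by left; exists (false, p : nat).
right=> -[c p]; apply/negP => ad.
have pk : (p < k)%N by case/andP: ad => /ltnW.
case: c ad => ad; [case/existsP: h1 | case/existsP: h2];
  by exists (Ordinal pk).
Qed.

Lemma extend_to_terminal st : exists r, valid k st r /\ terminal (run st r).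
Proof.
have [N] := ubnP (remaining st); elim: N st => // N IH st ltN.
have [[y ad]|t] := admissible_or_terminal st; last by exists [::].
have [|r [h1 h2]] := IH (step st y); first by rewrite (remaining_step ad) in ltN.
by exists (y :: r) => /=; rewrite ad.
Qed.

Lemma terminal_state st : perm_state k st -> terminal st -> st = (reversal, id).
Proof.
case: st => u v [pu pv] t; congr (_, _).
- apply: is_perm_decreasing => // p pk; have := t (true, p).
  rewrite /admissible pk /= -leqNgt leq_eqVlt => /orP[/eqP e|//].
  case: pu => _ inj _; have := inj _ _ pk (ltnW pk) e; lia.
- apply: is_perm_increasing => // p pk; have := t (false, p).
  rewrite /admissible pk /= -leqNgt leq_eqVlt => /orP[/eqP e|//].
  case: pv => _ inj _; have := inj _ _ (ltnW pk) pk e; lia.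
Qed.

Definition initial_state : state := (id, reversal).

Lemma perm_state_initial : perm_state k initial_state.
Proof. by split; [exact: is_perm_id | exact: is_perm_reversal]. Qed.

(** Read backwards, an adjacent inversion of the red wires or noninversion of the blue wires is a
    crossing that can be undone, and only the initial state has neither. *)
Lemma reach_state st : perm_state k st ->
  exists w, valid k initial_state w /\ run initial_state w = st.
Proof.
have [N] := ubnP (inversions st.1 + noninversions st.2)%N.
elim: N st => // N IH [u v] /= ltN [pu pv].
have [/existsP[p /andP[pk lt]]|hu] :=
  boolP [exists p : 'I_k, (p.+1 < k) && (u p.+1 < u p)]%N.
  have [||w [h1 h2]] := IH (swap p u, v).
  - by move: ltN; rewrite /= (inversions_swap pk lt).
  - by split=> //=; apply: is_perm_swap.
  exists (rcons w (true, p : nat)); rewrite -cats1 valid_cat run_cat h1 h2 /= /admissible pk /= swapL swapR lt.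
  by rewrite /step /= swapK.
have [/existsP[p /andP[pk lt]]|hv] :=
  boolP [exists p : 'I_k, (p.+1 < k) && (v p < v p.+1)]%N.
  have [||w [h1 h2]] := IH (u, swap p v).
  - by move: ltN; rewrite /= (noninversions_swap pk lt) addnS.
  - by split=> //=; apply: is_perm_swap.
  exists (rcons w (false, p : nat)); rewrite -cats1 valid_cat run_cat h1 h2 /= /admissible pk /= swapL swapR lt.
  by rewrite /step /= swapK.
exists [::]; split=> //=; congr (_, _); symmetry.
- apply: is_perm_increasing => // p pk; rewrite ltn_neqAle; apply/andP; split.
    by apply/eqP => e; case: pu => _ inj _; have := inj _ _ (ltnW pk) pk e; lia.
  rewrite leqNgt; apply/negP => lt; case/existsP: hu.
  by exists (Ordinal (ltnW pk)); rewrite /= pk.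
- apply: is_perm_decreasing => // p pk; rewrite ltn_neqAle; apply/andP; split.
    by apply/eqP => e; case: pv => _ inj _; have := inj _ _ pk (ltnW pk) e; lia.
  rewrite leqNgt; apply/negP => lt; case/existsP: hv.
  by exists (Ordinal (ltnW pk)); rewrite /= pk.
Qed.

(** Each color contributes ['C(k, 2)] crossings. Together with the [k] chambers at the left end this
    makes [k * k] variables. *)
Lemma size_maximal_word w : valid k initial_state w ->
  terminal (run initial_state w) -> size w = (k * k.-1)%N.
Proof.
move=> va t; have := remaining_run va.
rewrite (terminal_state _ t); last exact: perm_state_run perm_state_initial.
rewrite /remaining /= noninversions_id inversions_reversal.
rewrite noninversions_reversal inversions_id !addn0 => <-.
by rewrite addnn -mul2n mul_bin_left bin1 subn1 mulnC; case: k.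
Qed.

End Counting.

(** * Connectedness by local moves *)

Definition commuting (y z : letter) : bool := (y.2 != z.2) &&
  ((y.1 != z.1) || (y.2.+1 != z.2) && (z.2.+1 != y.2)).

Lemma step_commute y z st : commuting y z ->
  step (step st y) z = step (step st z) y.
Proof.
case: y z st => [c p] [c' q] [u v]; rewrite /commuting /step /= => /andP[pq].
have far w : (p.+1 != q) && (q.+1 != p) -> swap q (swap p w) = swap p (swap q w).
  move=> /andP[h1 h2]; apply: functional_extensionality => i.
  rewrite /swap; congr w; rewrite /transpose_at.
  clear -pq h1 h2; case: (eqVneq i p) => [->|ip]; first by do ?case: ifP; lia.
  by case: (eqVneq i p.+1) => [->|ip']; do ?case: ifP; lia.
by case: c; case: c' => //= /far h; rewrite h.
Qed.

Lemma admissible_commute k y z st : commuting y z ->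
  admissible k (step st y) z = admissible k st z.
Proof.
case: y z st => [c p] [c' q] [u v]; rewrite /commuting /admissible /step /=.
move=> /andP[pq]; case: c; case: c' => //= /andP[h1 h2];
  by rewrite !swapD // ?eqSS // eq_sym.
Qed.

Lemma commuting_sym y z : commuting y z = commuting z y.
Proof.
rewrite /commuting; congr (_ && (_ || _)); last exact: andbC.
  by rewrite eq_sym.
by rewrite eq_sym.
Qed.

Lemma run_labels_commute (V : eqType) (phi : nat -> V) y z a b : y.2 != z.2 ->
  run_labels phi [:: (y, a); (z, b)] = run_labels phi [:: (z, b); (y, a)].
Proof.
move=> yz; apply: functional_extensionality => q; rewrite /run_labels /= /relabel.
case qz: (q == z.2.+1); case qy: (q == y.2.+1) => //.
by rewrite (eqP qy) eqSS (negPf yz) in qz.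
Qed.

(** Crossings of opposite colors at neighbouring heights do see each other. Exchanging them changes
    the form by the wedge of their two differences [new - old], taken in both orders with equal
    signs, and this vanishes by antisymmetry. *)
Lemma word_form_commute (V : eqType) (phi : nat -> V) y z a b i j :
  commuting y z -> word_form phi [:: (y, a); (z, b)] i j =
  word_form phi [:: (z, b); (y, a)] i j.
Proof.
case: y z => [c p] [c' q]; rewrite /commuting /= !addr0 => /andP[pq].
have qp : q != p by rewrite eq_sym.
have pqS : p.+1 != q.+1 by rewrite eqSS.
have qpS : q.+1 != p.+1 by rewrite eqSS.
case: (eqVneq p.+1 q) => [e|h1].
  rewrite /= orbF => cc; subst q; have -> : c' = ~~ c by case: (c) (c') cc => [] [].
  have sN : color_sign (~~ c) = - color_sign c by case: (c).
  rewrite /step_form /= sN !(chamber_at_relabel, chamber_at_relabel_neq) ?eqSS //; try lia.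
  by rewrite /wedge; ring.
case: (eqVneq q.+1 p) => [e|h2] /=.
  rewrite orbF => cc; subst p; have -> : c' = ~~ c by case: (c) (c') cc => [] [].
  have sN : color_sign (~~ c) = - color_sign c by case: (c).
  rewrite /step_form /= sN !(chamber_at_relabel, chamber_at_relabel_neq) ?eqSS //; try lia.
  by rewrite /wedge; ring.
move=> _; rewrite /step_form /= !chamber_at_relabel_neq ?eqSS //; lia.
Qed.

Lemma valid_hexagon k c p q st : q = p.+1 \/ p = q.+1 ->
  admissible k st (c, p) -> admissible k st (c, q) ->
  valid k st [:: (c, p); (c, q); (c, p)].
Proof.
have up c' p' : admissible k st (c', p') -> admissible k st (c', p'.+1) ->
    valid k st [:: (c', p'); (c', p'.+1); (c', p')].
  have e2 u : swap p' u p'.+2 = u p'.+2 by apply: swapD; lia.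
  have e3 u : swap p'.+1 (swap p' u) p' = u p'.+1 by rewrite swapD ?swapL //; lia.
  have e4 u : swap p'.+1 (swap p' u) p'.+1 = u p'.+2 by rewrite swapL.
  rewrite /admissible; case: c' => /= /andP[h1 h2] /andP[h3 h4];
    rewrite /admissible /= ?swapR ?e2 ?e3 ?e4 h1 h2 h3 ?h4 andbT //=.
    by rewrite (ltn_trans h2 h4).
  by rewrite (ltn_trans h4 h2).
case=> ->; first exact: up.
move=> ad ad'; apply: (@valid_braid k c q q.+1); first by left.
exact: up.
Qed.

Section Connectivity.
Variables (F : fieldType) (n f k : nat) (Z : nat -> nat -> F).
Variables (s0 : seed_data F n f) (st0 : state) (phi0 : nat -> 'I_(n + f)).
Hypothesis minor_neq0 : forall st q, perm_state k st -> (q <= k)%N ->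
  chamber_minor Z st q != 0.
Hypothesis perm_st0 : perm_state k st0.

Notation represents := (@represents F n f k Z).

Lemma represents_commute s st phi w1 w2 y z a b : commuting y z ->
  represents s st phi (w1 ++ [:: (y, a); (z, b)] ++ w2) ->
  represents s st phi (w1 ++ [:: (z, b); (y, a)] ++ w2).
Proof.
move=> yz; have zy := yz; rewrite commuting_sym in zy.
have neq : y.2 != z.2 by case/andP: yz.
have pm : perm_eq (map snd (w1 ++ [:: (z, b); (y, a)] ++ w2))
    (map snd (w1 ++ [:: (y, a); (z, b)] ++ w2)).
  by rewrite !map_cat perm_cat2l perm_cat2r (perm_catC [:: b] [:: a]).
case=> va fr inn mx vars.
have phiE w : run_labels phi (w1 ++ [:: (z, b); (y, a)] ++ w) =
    run_labels phi (w1 ++ [:: (y, a); (z, b)] ++ w).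
  rewrite /run_labels !foldl_cat; congr foldl.
  exact: esym (run_labels_commute _ _ _ neq).
split.
- move: va; rewrite !map_cat !valid_cat /= (step_commute _ yz).
  rewrite (admissible_commute _ _ yz) (admissible_commute _ _ zy).
  by rewrite !andbT => /and3P[-> /andP[-> ->] ->].
- case: fr => h1 h2 h3; split=> //; last by rewrite (perm_uniq pm).
  by move=> c; rewrite (perm_mem pm); apply: h2.
- by move=> c; rewrite (perm_mem pm) phiE; apply: inn.
- move=> i j; rewrite mx !word_form_cat; congr (_ + (_ + _)).
    exact: word_form_commute.
  by rewrite (run_labels_commute _ _ _ neq).
- case/word_vars_cat: vars => hv1 /word_vars_cat[[sv1 [sv2 [sv3 _]]] hv2].
  set st1 := run st _ in sv1 sv2 sv3 hv2.
  have [va1 [ady adz]] : valid k st (map fst w1) /\ admissible k st1 y /\ admissible k st1 z.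
    move: va; rewrite !map_cat !valid_cat /= (admissible_commute _ _ yz).
    by rewrite andbT => /and3P[-> /andP[-> ->] _].
  have adzy : admissible k (step st1 z) y by rewrite (admissible_commute _ _ zy).
  have zk : (z.2.+1 < k)%N by case/andP: adz.
  have xb : seed_var s b = chamber_minor Z (step st1 z) z.2.+1.
    have := sv3 z.2.+1; rewrite relabelE => -> //; last exact: ltnW.
    by rewrite /= (step_commute _ yz) (chamber_minor_step _ adzy) // eqSS eq_sym.
  apply/word_vars_cat; split=> //; apply/word_vars_cat; split; last first.
    rewrite -(run_labels_commute _ _ _ neq) /= -(step_commute _ yz); exact: hv2.
  split=> //; split; first exact: state_vars_step.
  split=> //; rewrite -(step_commute _ yz).
  have E := esym (run_labels_commute (run_labels phi w1) a b neq).
  by move: E; rewrite /run_labels /= => ->.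
Qed.

Variable fin0 : nat -> 'I_(n + f).

(** The labels at the right end are recorded because they identify, in every diagram, the chambers
    that are not closed by a crossing. *)
Definition realized (w : seq (letter * 'I_(n + f))) : Prop :=
  run_labels phi0 w = fin0 /\
  exists ls, represents (foldl (@mutate F n f) s0 ls) st0 phi0 w.

Lemma run_labels_context (w1 m m' w2 : seq (letter * 'I_(n + f))) :
  (forall phi, run_labels phi m' = run_labels phi m) ->
  run_labels phi0 (w1 ++ m' ++ w2) = run_labels phi0 (w1 ++ m ++ w2).
Proof.
by move=> e; rewrite /run_labels !foldl_cat -!/(run_labels _ _) e.
Qed.

Lemma realized_mutate w w' : run_labels phi0 w' = run_labels phi0 w ->
  (forall s, represents s st0 phi0 w ->
     exists l, represents (mutate s l) st0 phi0 w') ->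
  realized w -> realized w'.
Proof.
move=> e h [fe [ls /h[l hl]]]; split; first by rewrite e.
by exists (rcons ls l); rewrite -cats1 foldl_cat.
Qed.

Lemma realized_commute w1 w2 y z a b : commuting y z ->
  realized (w1 ++ [:: (y, a); (z, b)] ++ w2) ->
  realized (w1 ++ [:: (z, b); (y, a)] ++ w2).
Proof.
move=> yz [fe [ls h]]; split; last by exists ls; apply: represents_commute.
rewrite -fe; apply: run_labels_context => phi.
by rewrite -run_labels_commute //; case/andP: yz.
Qed.

Lemma realized_mixed w1 w2 c p a b :
  realized (w1 ++ [:: (c, p, a); (~~ c, p, b)] ++ w2) ->
  realized (w1 ++ [:: (~~ c, p, a); (c, p, b)] ++ w2).
Proof.
apply: realized_mutate; first exact: run_labels_context.
by move=> s; apply: represents_mixed.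
Qed.

Lemma realized_braid w1 w2 c p q a b d : q = p.+1 \/ p = q.+1 ->
  realized (w1 ++ [:: (c, p, a); (c, q, b); (c, p, d)] ++ w2) ->
  realized (w1 ++ [:: (c, q, a); (c, p, d); (c, q, b)] ++ w2).
Proof.
move=> pq; apply: realized_mutate; last by move=> s; apply: represents_braid.
apply: run_labels_context => phi; apply: functional_extensionality => r.
rewrite /run_labels /= /relabel.
case rq: (r == q.+1); case rp: (r == p.+1) => //.
by case: pq rq rp => -> /eqP ->; rewrite eqSS; lia.
Qed.

(* Two distinct letters that are admissible in the same state open a local
   diamond: a commutation square, a mixed move or a braid hexagon. *)
Lemma realized_connected N (S Q : seq (letter * 'I_(n + f)))
    (w' : seq letter) : size S = N ->
  valid k (run st0 (map fst Q)) w' ->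
  terminal k (run st0 (map fst (Q ++ S))) ->
  terminal k (run (run st0 (map fst Q)) w') ->
  realized (Q ++ S) ->
  exists S', [/\ map fst S' = w', perm_eq (map snd S') (map snd S) &
                 realized (Q ++ S')].
Proof.
elim: N S Q w' => [|N IH] S Q w'.
  move=> /size0nil -> va t1 t2 re; exists [::]; split=> //.
  case: w' va t2 => // y w' /= /andP[ad _]; rewrite cats0 in t1.
  by have := t1 y; rewrite ad.
case: S => // [[y a] S] /= [sS] va t1 t2 re.
set st := run st0 (map fst Q) in va t2.
have [_ [ls rep]] := re; have vaS := rep_valid rep.
have ady : admissible k st y.
  by move: vaS; rewrite map_cat valid_cat => /and3P[].
case: w' va t2 => [|z w'] /=; first by move=> _ t2; have := t2 y; rewrite ady.
move=> /andP[adz vaw'] t2.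
(* [finish] concludes from a realized diagram whose next letter is already [z], and [divert]
   reroutes the tail after [y] along any maximal word. Each case below diverts into the side of the
   diamond that starts with [y], applies the move and finishes. *)
have finish b R : perm_eq (map snd ((z, b) :: R)) (map snd ((y, a) :: S)) ->
    terminal k (run st0 (map fst (Q ++ (z, b) :: R))) ->
    realized (Q ++ (z, b) :: R) -> exists S',
    [/\ map fst S' = z :: w', perm_eq (map snd S') (map snd ((y, a) :: S))
      & realized (Q ++ S')].
  move=> pm tR reR; have sR : size R = N.
    by have := perm_size pm; rewrite /= !size_map sS => -[].
  have [||||S' [h1 h2 h3]] := IH R (rcons Q (z, b)) w' sR.
  - by rewrite map_rcons -cats1 run_cat.
  - by rewrite cat_rcons.
  - by rewrite map_rcons -cats1 run_cat.
  - by rewrite cat_rcons.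
  exists ((z, b) :: S'); split; first by rewrite /= h1.
    by apply: perm_trans pm; rewrite /= perm_cons.
  by rewrite -cat_rcons.
have divert r : valid k (step st y) r -> terminal k (run (step st y) r) ->
    exists S', [/\ map fst S' = r, perm_eq (map snd S') (map snd S)
      & realized (Q ++ (y, a) :: S')].
  move=> vr tr; have [||||S' [h1 h2 h3]] := IH S (rcons Q (y, a)) r sS.
  - by rewrite map_rcons -cats1 run_cat.
  - by rewrite cat_rcons.
  - by rewrite map_rcons -cats1 run_cat.
  - by rewrite cat_rcons.
  by exists S'; rewrite -cat_rcons.
have runQ (w : seq (letter * 'I_(n + f))) : run st0 (map fst (Q ++ w)) = run st (map fst w).
  by rewrite map_cat run_cat.
have [eyz|neq] := eqVneq y z; first by subst z; apply: (finish a S); rewrite ?perm_refl.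
have [cyz|ncyz] := boolP (commuting y z).
  have adyz : admissible k (step st y) z by rewrite (admissible_commute _ _ cyz).
  have [r [vr tr]] := extend_to_terminal k (step (step st y) z).
  have [||S' [e h2 h3]] := divert (z :: r); rewrite /= ?adyz //.
  case: S' e h2 h3 => [//|[z' b] R] /= [-> h1] h2 h3.
  apply: (finish b ((y, a) :: R)).
  - apply: (perm_trans (permEl (perm_catCA [:: b] [:: a] (map snd R)))).
    by rewrite /= perm_cons.
  - by rewrite runQ /= h1 -(step_commute _ cyz).
  - exact: (@realized_commute Q R y z a b).
have [epz|npz] := eqVneq y.2 z.2.
  have ez : z = (~~ y.1, y.2).
    case: (y) (z) neq epz => [c p] [c' q] /= neq e; subst q.
    by case: c c' neq => [] []; rewrite ?eqxx.
  have adyz : admissible k (step st y) z.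
    by move: adz ady; rewrite ez /admissible /step; case: (y.1).
  have [r [vr tr]] := extend_to_terminal k (step (step st y) z).
  have [||S' [e h2 h3]] := divert (z :: r); rewrite /= ?adyz //.
  case: S' e h2 h3 => [//|[z' b] R] /= [-> h1] h2 h3.
  apply: (finish a ((y, b) :: R)).
  - by rewrite /= perm_cons.
  - rewrite runQ /= h1.
    have -> // : step (step st z) y = step (step st y) z.
    by rewrite ez /step; case: (y.1).
  - move: h3; rewrite ez; case: (y) => c p; exact: realized_mixed.
have [ec pq] : z.1 = y.1 /\ (z.2 = y.2.+1 \/ y.2 = z.2.+1).
  move: ncyz; rewrite /commuting npz /= negb_or negbK => /andP[/eqP -> h].
  split=> //; move: h; rewrite negb_and !negbK => /orP[/eqP|/eqP] <-; tauto.
destruct y as [c p], z as [c' q]; rewrite /= in ec pq; subst c'.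
have hex := valid_hexagon pq ady adz.
have [r [vr tr]] := extend_to_terminal k (run st [:: (c, p); (c, q); (c, p)]).
have [||S' [e h2 h3]] := divert ((c, q) :: (c, p) :: r) => //.
  by case/and4P: hex => _ h h' _; rewrite /= h h'.
case: S' e h2 h3 => [//|[z' b] [//|[y' d] R]] /= [-> -> h1] h2 h3.
apply: (finish a ((c, p, d) :: (c, q, b) :: R)).
- rewrite /= perm_cons; apply: perm_trans h2.
  exact: permEl (perm_catCA [:: d] [:: b] (map snd R)).
- by rewrite runQ /= h1 -[step _ (c, q)](step_braid c st pq).
- exact: realized_braid.
Qed.

End Connectivity.

(** * Parity and unimodularity of exchange matrices *)

Section Parity.
Variables (V : eqType) (k : nat).
Implicit Types (phi : nat -> V) (w : seq (letter * V)).

(** Vertical neighbours along one cut of the diagram. Modulo 2, a crossing contributes the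
    adjacencies of the cuts on its two sides, so over a whole word only those of the two ends
    survive. This makes the columns of inner chambers even, and halving exact. *)
Definition level_adjacency phi (i j : V) : int :=
  \sum_(q < k) (chamber_at phi q.+1 j * chamber_at phi q i
                + chamber_at phi q j * chamber_at phi q.+1 i).

Lemma step_form_parity phi t i j : (t.1.2.+1 < k)%N -> exists c : int,
  step_form phi t i j = level_adjacency phi i j +
    level_adjacency (relabel phi t.1.2 t.2) i j + 2 * c.
Proof.
case: t => [[c p] a] /= pk; have hp : (p < k)%N by apply: ltnW.
pose P := Ordinal hp; pose Q := Ordinal pk.
have PQ : Q != P by rewrite -val_eqE /= (gtn_eqF (ltnSn p)).
pose E psi (q : nat) := chamber_at psi q.+1 j * chamber_at psi q i
                + chamber_at psi q j * chamber_at psi q.+1 i.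
have split_sum psi : level_adjacency psi i j =
    E psi p + (E psi p.+1 + \sum_(q < k | (q != P) && (q != Q)) E psi q).
  by rewrite /level_adjacency (bigD1 P) //= (bigD1 Q).
have rest : \sum_(q < k | (q != P) && (q != Q)) E (relabel phi p a) q =
    \sum_(q < k | (q != P) && (q != Q)) E phi q.
  apply: eq_bigr => q /andP[]; rewrite -!val_eqE /= => qP qQ.
  by rewrite /E !chamber_at_relabel_neq // eqSS.
rewrite !split_sum rest /E chamber_at_relabel !chamber_at_relabel_neq; [|lia..].
rewrite /step_form /=; set S := \sum_(q < k | _) _.
rewrite /wedge; set Ni := chamber_at phi p i; set Nj := chamber_at phi p j.
set Ui := chamber_at phi p.+2 i; set Uj := chamber_at phi p.+2 j.
set Oi := chamber_at phi p.+1 i; set Oj := chamber_at phi p.+1 j.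
move: (_%:R : int) (_%:R : int) => x y.
case: c => /=.
  by exists (- S - Oi * (Nj + Uj) - y * (Ni + Ui) - x * Oj + Oi * y); ring.
by exists (- S - x * (Nj + Uj) - Oj * (Ni + Ui) + x * Oj - Oi * y); ring.
Qed.

Lemma word_form_parity phi w i j : (forall t, t \in w -> (t.1.2.+1 < k)%N) ->
  exists c : int, word_form phi w i j = level_adjacency phi i j +
    level_adjacency (run_labels phi w) i j + 2 * c.
Proof.
elim: w phi => [|t w IH] phi hk /=.
  by exists (- level_adjacency phi i j); rewrite /run_labels /=; ring.
have [|c1 ->] := @step_form_parity phi t i j; first by apply: hk; rewrite mem_head.
have [|c2 ->] := IH (relabel phi t.1.2 t.2).
  by move=> t' tw; apply: hk; rewrite inE tw orbT.
by exists (level_adjacency (relabel phi t.1.2 t.2) i j + c1 + c2); rewrite /run_labels /=; ring.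
Qed.

Lemma word_form_even phi w i j : (forall t, t \in w -> (t.1.2.+1 < k)%N) ->
  ~ on_level k phi j -> ~ on_level k (run_labels phi w) j ->
  exists c : int, word_form phi w i j = 2 * c.
Proof.
move=> hk n1 n2; have [c ->] := word_form_parity phi i j hk; exists c.
have z psi : ~ on_level k psi j -> level_adjacency psi i j = 0.
  move=> na; rewrite /level_adjacency big1 // => q _.
  by rewrite !(chamber_at_notin _ na) ?mul0r ?addr0 // ltnW.
by rewrite !z // !add0r.
Qed.

(* The chamber [a] ends at the crossing where the chamber [R] begins. *)
Definition closed_by phi w (a R : V) : Prop := exists w1 y w2,
  w = w1 ++ (y, R) :: w2 /\ run_labels phi w1 y.2.+1 = a.

Lemma closed_by_ex phi w a : (forall t, t \in w -> (t.1.2.+1 < k)%N) ->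
  on_level k phi a \/ a \in map snd w ->
  ~ on_level k (run_labels phi w) a -> exists R, closed_by phi w a R.
Proof.
elim: w phi => [|[[c p] b] w IH] phi hk /=; first by case.
have pk : (p.+1 < k)%N by apply: (hk (c, p, b)); rewrite mem_head.
move=> ha na; have [e|ne] := eqVneq (phi p.+1) a.
  by exists b, [::], (c, p), w.
have [||//|R [w1 [y [w2 [e1 e2]]]]] := IH (relabel phi p b).
- by move=> t tw; apply: hk; rewrite inE tw orbT.
- case: ha => [[q qk e]|].
    left; exists q => //; rewrite relabel_neq //.
    by apply: contraNneq ne => <-; rewrite e eqxx.
  rewrite inE => /orP[/eqP ->|]; last by right.
  by left; exists p.+1; [exact: ltnW | exact: relabelE].
by exists R, ((c, p, b) :: w1), y, w2; rewrite e1.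
Qed.

(** Once [a] is closed, no later crossing involves it. So [R], opened by the closing crossing, is
    the last row in which column [a] is nonzero, and its entry is one full arrow. *)
Lemma closed_by_form phi w a R : (forall t, t \in w -> (t.1.2.+1 < k)%N) ->
  fresh_labels k phi w -> closed_by phi w a R ->
  (word_form phi w R a = 2 \/ word_form phi w R a = -2) /\
  (forall i, i \in map snd w -> (index R (map snd w) < index i (map snd w))%N ->
     word_form phi w i a = 0).
Proof.
move=> hk fr [w1 [[c p] [w2 [e ea]]]].
have hk1 t : t \in w1 -> (t.1.2.+1 < k)%N.
  by move=> tw; apply: hk; rewrite e mem_cat tw.
have hk2 t : t \in w2 -> (t.1.2.+1 < k)%N.
  by move=> tw; apply: hk; rewrite e mem_cat inE tw !orbT.
have pk : (p.+1 < k)%N.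
  by apply: (hk (c, p, R)); rewrite e mem_cat mem_head orbT.
have pk1 : (0 < p.+1 <= k)%N := ltnW pk.
have fr1 : fresh_labels k (run_labels phi w1) ((c, p, R) :: w2).
  by apply: fresh_labels_run => //; rewrite -e.
move: (fr) => [_ fr0 uq]; have [Rw1 Rw2] : R \notin map snd w1 /\ R \notin map snd w2.
  move: uq; rewrite e map_cat cat_uniq /= negb_or.
  by case/and3P=> _ /andP[Rw1 _] /andP[Rw2 _].
have na2 : ~ on_level k (relabel (run_labels phi w1) p R) a.
  case: fr1 => inj frR _ [q qk]; rewrite /relabel; case: eqP => [_ eR|ne eq].
    by apply: (frR R (mem_head _ _)); exists p.+1; rewrite ?ea ?eR.
  by apply: ne; apply: inj => //; rewrite eq ea.
have aw2 : a \notin map snd w2.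
  apply/negP => aw; case: fr1 => _ frR _; apply: (frR a).
    by rewrite /= inE aw orbT.
  by exists p.+1.
have Ra : R != a.
  apply/eqP => eRa; case: fr1 => _ frR _; apply: (frR R (mem_head _ _)).
  by exists p.+1; rewrite ?ea ?eRa.
have col2 i : word_form (relabel (run_labels phi w1) p R) w2 i a = 0.
  by rewrite word_form_antisym (word_form_notin (k := k)) ?oppr0.
have colE i : i \notin map snd w1 -> i \in map snd w ->
    word_form phi w i a = step_form (run_labels phi w1) (c, p, R) i a.
  move=> iw1 iw; rewrite e word_form_cat /= col2 addr0.
  by rewrite (word_form_notin (k := k)) ?add0r //; apply: fr0.
have idxR : index R (map snd w) = size w1.
  by rewrite e map_cat index_cat (negPf Rw1) /= eqxx addn0 size_map.
have [inj frR _] := fr1.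
have na i : i \in R :: map snd w2 -> ~ on_level k (run_labels phi w1) i.
  exact: frR.
have pk2 : (p <= k)%N by do 2 apply: ltnW.
have oldE : chamber_at (run_labels phi w1) p.+1 a = 1.
  by rewrite /chamber_at /= ea eqxx.
have nbr q : (q <= k)%N -> q != p.+1 -> chamber_at (run_labels phi w1) q a = 0.
  move=> qk qp; rewrite /chamber_at; case: ltnP => //= q0; case: eqP => // eq.
  by case/eqP: qp; apply: inj; rewrite ?q0 ?qk ?ea ?eq.
split.
  rewrite colE //; last by rewrite e map_cat mem_cat mem_head orbT.
  rewrite /step_form /wedge /= eqxx (negPf Ra) oldE !nbr //; [|lia..].
  rewrite !(chamber_at_notin _ (na R (mem_head _ _))) ?(ltnW pk) //.
  by case: (c); [right | left].
move=> i iw; rewrite idxR => lt; have iw1 : i \notin map snd w1.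
  apply: contraTN lt => iw1; rewrite e map_cat index_cat iw1 -leqNgt.
  by rewrite -(size_map snd w1) index_size.
have iR : i != R by apply: contraTneq lt => ->; rewrite idxR ltnn.
have iw2 : i \in R :: map snd w2.
  by move: iw; rewrite e map_cat mem_cat (negPf iw1).
rewrite colE // /step_form /wedge /= [R == i]eq_sym (negPf iR).
rewrite !(chamber_at_notin _ (na i iw2)) ?(ltnW pk) //.
by rewrite mulr0n; ring.
Qed.

Lemma closed_by_inj phi w a a' R : uniq (map snd w) ->
  closed_by phi w a R -> closed_by phi w a' R -> a = a'.
Proof.
move=> uq [w1 [y [w2 [e <-]]]] [w1' [y' [w2' [e' <-]]]].
have idx v1 z v2 : w = v1 ++ (z, R) :: v2 -> index R (map snd w) = size v1.
  move=> ew; move: uq; rewrite ew map_cat cat_uniq /= negb_or.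
  case/and3P=> _ /andP[Rv _] _.
  by rewrite index_cat (negPf Rv) /= eqxx addn0 size_map.
have sz : size w1 = size w1' by rewrite -(idx _ _ _ e) (idx _ _ _ e').
have e1 : w1 = w1'.
  by have := congr1 (take (size w1)) e; rewrite e' {1}sz !take_size_cat.
by move: e; rewrite e' e1 => /(congr1 (drop (size w1')));
   rewrite !drop_size_cat // => -[-> _].
Qed.

End Parity.

(** Substitution along the pivots [next j]: the equations are solved by increasing position of the
    pivot. A correction at a new pivot leaves the earlier equations intact, and is integral because
    the pivot is a sign. *)
Lemma unimodular_echelon (n f : nat) (B : 'M[int]_(n + f, n))
    (next : 'I_n -> 'I_(n + f)) (pos : 'I_(n + f) -> nat) :
  (forall j, B (next j) j = 1 \/ B (next j) j = -1) ->
  (forall i j, (pos (next j) < pos i)%N -> B i j = 0) ->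
  (forall j j', pos (next j) = pos (next j') -> j = j') ->
  unimodular B.
Proof.
move=> h1 h2 h3 v.
have step N : exists w : 'I_(n + f) -> int,
    forall j, (pos (next j) < N)%N -> \sum_i w i * B i j = v j.
  elim: N => [|N [w hw]]; first by exists (fun _ => 0).
  have [/existsP[j0 /eqP e0]|none] := boolP [exists j, pos (next j) == N]; last first.
    exists w => j; rewrite ltnS leq_eqVlt => /orP[e|]; last exact: hw.
    by case/existsP: none; exists j.
  pose c := B (next j0) j0 * (v j0 - \sum_i w i * B i j0).
  exists (fun i => w i + (i == next j0)%:R * c) => j.
  have -> : \sum_i (w i + (i == next j0)%:R * c) * B i j =
      \sum_i w i * B i j + c * B (next j0) j.
    under eq_bigr do rewrite mulrDl.
    rewrite big_split /=; congr (_ + _); rewrite (bigD1 (next j0)) //= eqxx mul1r.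
    by rewrite big1 ?addr0 // => i /negPf ->; rewrite !mul0r.
  rewrite ltnS leq_eqVlt => /orP[/eqP e|lt]; last first.
    by rewrite hw // h2 ?mulr0 ?addr0 // e0.
  have <- : j0 = j by apply: h3; rewrite e0 e.
  by rewrite /c; case: (h1 j0) => ->; ring.
have [w hw] := step (\max_j pos (next j)).+1.
by exists w => j; apply: hw; rewrite ltnS; apply: leq_bigmax.
Qed.

(** * The initial seed *)

Lemma run_labels_map (V V' : eqType) (g : V -> V') (phi : nat -> V)
    (w : seq (letter * V)) :
  run_labels (g \o phi) [seq (t.1, g t.2) | t <- w] = g \o run_labels phi w.
Proof.
elim: w phi => [//|t w IH] phi; rewrite /run_labels /= -!/(run_labels _ _) -IH.
congr run_labels; apply: functional_extensionality => q.
by rewrite /relabel /=; case: ifP.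
Qed.

Section Initial.
Variables (F : fieldType) (k : nat) (Z : nat -> nat -> F).

Lemma word_vars_exists n f st (phi : nat -> 'I_(n + f)) w :
  valid k st (map fst w) -> fresh_labels k phi w ->
  exists x, word_vars k Z x st phi w.
Proof.
elim: w st phi => [|[y a] w IH] st phi /=.
  move=> _ [inj _ _]; exists (fun h => if [pick q : 'I_k | phi q.+1 == h] is Some q
    then chamber_minor Z st q.+1 else 0); split=> // q /andP[q0 qk].
  case: pickP => [q' /eqP e|none].
    by congr chamber_minor; apply: inj; rewrite ?q0 //= ltn_ord.
  have qk' : (q.-1 < k)%N by rewrite prednK.
  by have := none (Ordinal qk'); rewrite /= prednK ?eqxx.
case/andP=> ad va fr; have pk : (y.2.+1 < k)%N by case/andP: ad.
have fr' := @fresh_labels_relabel _ k phi (y, a) w pk fr.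
have [x hx] := IH _ _ va fr'; have [inj frl /= /andP[aw uq]] := fr.
have na : ~ on_level k phi a by apply: frl; rewrite /= mem_head.
have nb : phi y.2.+1 \notin map snd w.
  apply/negP => bw; apply: (frl (phi y.2.+1)); first by rewrite /= inE bw orbT.
  by exists y.2.+1 => //; exact: ltnW.
have nl : ~ on_level k (relabel phi y.2 a) (phi y.2.+1).
  case=> q qk; rewrite /relabel; case: eqP => [_ e|ne e].
    by apply: na; exists y.2.+1 => //; exact: ltnW.
  by apply: ne; apply: inj => //; exact: ltnW.
(* The tail supplies every chamber except the one closed by this first crossing, whose label does
   not occur later. *)
exists (fun h => if h == phi y.2.+1 then chamber_minor Z st y.2.+1 else x h).
split; last by apply: (word_vars_ext _ nl nb hx) => i /negPf ->.
move=> q qk; case: eqP => [e|ne].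
  by congr chamber_minor; apply: inj => //; exact: ltnW.
have qp : q != y.2.+1 by apply/eqP => e; apply: ne; rewrite e.
by rewrite -(chamber_minor_step _ ad qp) -(word_vars_head hx qk) relabel_neq.
Qed.

Lemma initial_diagram st r : (0 < k)%N -> valid k st r ->
  exists n f (s0 : seed_data F n f) phi w,
  [/\ (n + f)%N = (k + size r)%N, map fst w = r, represents k Z s0 st phi w,
      skew_principal (seed_mx s0) /\ unimodular (seed_mx s0)
    & (forall h, on_level k phi h \/ h \in map snd w) /\
      (forall l, ~ on_level k phi (lshift f l) /\
         ~ on_level k (run_labels phi w) (lshift f l))].
Proof.
move=> k0 va; pose m := (k + size r)%N.
(* Provisional labels are natural numbers: [q.-1] for the chamber at level [q] of the left end, then
   [k], [k.+1] and so on in order of opening. A seed lists its mutable variables first, so [g]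
   renumbers them below. *)
pose w0 : seq (letter * nat) := zip r (iota k (size r)).
have fst_w0 : map fst w0 = r by rewrite /w0 -/(unzip1 _) unzip1_zip // size_iota.
have snd_w0 : map snd w0 = iota k (size r).
  by rewrite /w0 -/(unzip2 _) unzip2_zip // size_iota.
pose fin0 := run_labels predn w0.
have fin_lt q : (0 < q <= k)%N -> (fin0 q < m)%N.
  move=> qk; have : on_level k fin0 (fin0 q) by exists q.
  rewrite /on_level => _.
  have gen w phi : (forall q, (0 < q <= k)%N -> (phi q < m)%N) ->
     (forall a, a \in map snd w -> (a < m)%N) ->
     forall q, (0 < q <= k)%N -> (run_labels phi w q < m)%N.
    elim: w phi => [//|t w IH] phi h1 h2; apply: IH => [q' q'k|a aw].
      by rewrite /relabel; case: ifP => // _; [apply: h2; rewrite mem_head | exact: h1].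
    by apply: h2; rewrite inE aw orbT.
  apply: gen => // [q' q'k | a].
    by rewrite /m; lia.
  by rewrite snd_w0 mem_iota => /andP[].
pose fr a := has (fun q => (q.-1 == a) || (fin0 q == a)) (iota 1 k).
pose s1 := filter (predC fr) (iota 0 m); pose s2 := filter fr (iota 0 m).
pose n := size s1; pose f := size s2.
have nfE : (n + f)%N = m.
  rewrite /n /f !size_filter addnC -[RHS](size_iota 0).
  exact: count_predC.
have m0 : (0 < n + f)%N by rewrite nfE /m addn_gt0 k0.
pose L := s1 ++ s2.
have inL a : (a < m)%N -> a \in L.
  by move=> am; rewrite mem_cat !mem_filter mem_iota am /= andbT andbT orNb.
have uqL : uniq L.
  rewrite cat_uniq !filter_uniq ?iota_uniq //= andbT; apply/hasPn => a.
  by rewrite !mem_filter /= => /andP[-> _].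
pose g a : 'I_(n + f) := insubd (Ordinal m0) (index a L).
have gE a : (a < m)%N -> g a = index a L :> nat.
  move=> am; rewrite val_insubd; suff -> : (index a L < n + f)%N by [].
  by rewrite -size_cat index_mem inL.
have g_inj a b : (a < m)%N -> (b < m)%N -> g a = g b -> a = b.
  move=> am bm /(congr1 val) /=; rewrite !gE // => e.
  by rewrite -[a](nth_index 0 (inL a am)) e nth_index ?inL.
have g_mut a : (a < m)%N -> ~~ fr a -> exists l, g a = lshift f l.
  move=> am nfr; have as1 : a \in s1 by rewrite mem_filter /= nfr mem_iota.
  have lt : (index a s1 < n)%N by rewrite index_mem.
  by exists (Ordinal lt); apply: val_inj; rewrite /= gE // index_cat as1.
have g_frozen a l : (a < m)%N -> fr a -> g a = lshift f l -> False.
  move=> am fra /(congr1 val) /=; rewrite gE // index_cat mem_filter /= fra /=.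
  by have := ltn_ord l; rewrite -/n; lia.
pose phi := g \o predn; pose w := [seq (t.1, g t.2) | t <- w0].
have fst_w : map fst w = r by rewrite /w -map_comp -[RHS]fst_w0; apply: eq_map.
have snd_w : map snd w = map g (iota k (size r)).
  by rewrite /w -map_comp -snd_w0 -map_comp; apply: eq_map.
have finE : run_labels phi w = g \o fin0 by exact: run_labels_map.
have fresh_w : fresh_labels k phi w.
  split.
  - move=> q q' /andP[q0 qk] /andP[q'0 q'k] /g_inj e.
    have : q.-1 = q'.-1 by apply: e; rewrite /m; lia.
    by move=> {}e; lia.
  - move=> a; rewrite snd_w => /mapP[b]; rewrite mem_iota => /andP[kb bm] ->.
    case=> q /andP[q0 qk] /g_inj e.
    have : q.-1 = b by apply: e; rewrite /m; lia.
    by lia.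
  - rewrite snd_w map_inj_in_uniq ?iota_uniq // => a b.
    by rewrite !mem_iota => /andP[_ am] /andP[_ bm]; apply: g_inj.
have va' : valid k st (map fst w) by rewrite fst_w.
have hk := valid_lt va'.
have inner_l l : ~ on_level k phi (lshift f l) /\
    ~ on_level k (run_labels phi w) (lshift f l).
  split=> -[q qk]; rewrite ?finE /=; apply: g_frozen; rewrite ?fin_lt //.
  - by rewrite /m; lia.
  - by apply/hasP; exists q; rewrite ?eqxx // mem_iota; lia.
  - by apply/hasP; exists q; rewrite ?eqxx ?orbT // mem_iota; lia.
have cover h : on_level k phi h \/ h \in map snd w.
  have hL : (h < size L)%N by rewrite size_cat.
  pose a := nth 0%N L h; have aL : a \in L by rewrite mem_nth.
  have am : (a < m)%N.
    by move: aL; rewrite mem_cat !mem_filter mem_iota => /orP[] /andP[_ /andP[_]].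
  have ha : h = g a by apply: val_inj; rewrite /= gE // index_uniq.
  have [lt|ge] := ltnP a k; first by left; exists a.+1; rewrite ?ha.
  right; rewrite snd_w ha; apply: map_f; rewrite mem_iota ge /=; exact: am.
have [x hx] := word_vars_exists va' fresh_w.
(* The form counts half-arrows; on mutable columns the division is exact by parity. *)
pose B := \matrix_(i < n + f, j < n) (word_form phi w i (lshift f j) %/ 2)%Z.
have BE i (j : 'I_n) : 2 * B i j = word_form phi w i (lshift f j).
  have [n1 n2] := inner_l j; have [c hc] := word_form_even i hk n1 n2.
  by rewrite mxE hc mulKz.
exists n, f, (SeedData x B), phi, w; split=> //.
- split=> // a; rewrite snd_w => /mapP[b]; rewrite mem_iota => /andP[kb bm] ->.
  have [/hasP[q]|] := boolP (fr b); last by right; apply: g_mut.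
  rewrite mem_iota => qk /orP[/eqP e|/eqP e]; first by lia.
  by left; exists q; rewrite ?finE /= ?e //; lia.
- split.
    move=> i j; apply: (@mulfI _ (2 : int)) => //.
    by rewrite mulrN !BE word_form_antisym.
  have /fin_all_exists[next hn] : forall j : 'I_n, exists R,
      closed_by phi w (lshift f j) R.
    move=> j; have [_ n2] := inner_l j.
    exact: closed_by_ex hk (cover _) n2.
  have uqw : uniq (map snd w) by case: fresh_w.
  have nextw j : next j \in map snd w.
    by have [w1 [y [w2 [-> _]]]] := hn j; rewrite map_cat mem_cat mem_head orbT.
  (* Chambers are ordered by the crossing that opens them, and those at the left end share position
     0. *)
  apply: (@unimodular_echelon _ _ _ next (fun i => if i \in map snd w
     then (index i (map snd w)).+1 else 0%N)).
  + move=> j; have [h1 _] := closed_by_form hk fresh_w (hn j).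
    by case: h1 => h1; [left|right]; apply: (@mulfI _ (2 : int)); rewrite // BE h1.
  + move=> i j; rewrite nextw; case: ifP => // iw; rewrite ltnS => lt.
    have [_ h2] := closed_by_form hk fresh_w (hn j).
    by apply: (@mulfI _ (2 : int)); rewrite // BE h2 ?mulr0.
  + move=> j j'; rewrite !nextw => -[e].
    have eR : next j = next j'.
      by rewrite -[next j](nth_index (next j) (nextw j)) e nth_index.
    apply: (@lshift_inj n f); apply: (closed_by_inj uqw (hn j)).
    by rewrite eR; apply: hn.
Qed.

End Initial.

(** * Divisibility between minors *)

Definition divides (R : comNzRingType) (d a : R) : Prop := exists q, a = d * q.

Definition prime_element (R : comNzRingType) (d : R) : Prop :=
  forall a b, divides d (a * b) -> divides d a \/ divides d b.

Lemma prime_element_exp (R : comNzRingType) (d g : R) N :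
  prime_element d -> ~ divides d 1 -> ~ divides d g -> ~ divides d (g ^+ N).
Proof.
by move=> pd n1 ng; elim: N => [//|N IH]; rewrite exprS => /pd[].
Qed.

Lemma det_last_entry (R : comNzRingType) p (M : nat -> nat -> R) (t : R) :
  \det (\matrix_(i < p.+1, j < p.+1)
     if (i == p :> nat) && (j == p :> nat) then t else M i j) =
  t * \det (\matrix_(i < p, j < p) M i j) +
  \det (\matrix_(i < p.+1, j < p.+1)
     if (i == p :> nat) && (j == p :> nat) then 0 else M i j).
Proof.
pose e := \matrix_(i < p.+1, j < p.+1) if i == p :> nat then (j == p :> nat)%:R else M i j.
have -> : \det (\matrix_(i < p, j < p) M i j) = \det e.
  rewrite (expand_det_row e ord_max) (bigD1 ord_max) //= big1 ?addr0.
    rewrite mxE /= !eqxx mul1r /cofactor /= addnn -signr_odd odd_double mul1r.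
    by congr (\det _); apply/matrixP => i j; rewrite !mxE !lift_max (ltn_eqF (ltn_ord i)).
  move=> j ne; rewrite mxE /= eqxx; case: eqP => [ej|_]; last by rewrite mul0r.
  by case/eqP: ne; apply: val_inj.
set A := \matrix_(i, j) _; set C := \matrix_(i, j) (if _ then 0 else _).
rewrite (@determinant_multilinear _ _ A e C ord_max t 1) ?mul1r //.
- apply/rowP => j; rewrite !mxE /= eqxx; case: eqP => _ //=; ring.
- apply/matrixP => i j; rewrite !mxE.
  by rewrite lift_max (ltn_eqF (ltn_ord i)).
- apply/matrixP => i j; rewrite !mxE.
  by rewrite lift_max (ltn_eqF (ltn_ord i)).
Qed.

Section GenericMinors.
Variables (K : fieldType) (k : nat).

Notation R := {mpoly K[k * k]}.

Definition coordinate (a b : nat) : R :=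
  match insub a, insub b with
  | Some i, Some j => generic_matrix K k i j
  | _, _ => 0
  end.

Lemma coordinateE (i j : 'I_k) : coordinate i j = 'X_(mxvec_index i j).
Proof. by rewrite /coordinate !valK mxE. Qed.

Definition poly_minor p (u v : nat -> nat) : R :=
  \det (\matrix_(i < p, j < p) coordinate (u i) (v j)).

Definition at_point (A : nat -> nat -> K) (q : R) : K :=
  meval (fun t => mxvec (\matrix_(i < k, j < k) A i j) 0 t) q.

Lemma at_point_coordinate A a b : (a < k)%N -> (b < k)%N ->
  at_point A (coordinate a b) = A a b.
Proof.
move=> ak bk; rewrite (coordinateE (Ordinal ak) (Ordinal bk)) /at_point mevalXU.
by rewrite mxvecE mxE.
Qed.

Lemma at_point_minor A p u v : (forall i, (i < p)%N -> (u i < k)%N) ->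
  (forall i, (i < p)%N -> (v i < k)%N) ->
  at_point A (poly_minor p u v) = \det (\matrix_(i < p, j < p) A (u i) (v j)).
Proof.
move=> uk vk; rewrite /at_point /poly_minor -det_map_mx; congr (\det _).
apply/matrixP => i j; rewrite !mxE.
exact: at_point_coordinate (uk _ (ltn_ord i)) (vk _ (ltn_ord j)).
Qed.

Lemma at_point_divides A d q : divides d q -> at_point A d = 0 -> at_point A q = 0.
Proof. by case=> r ->; rewrite /at_point mevalM => ->; rewrite mul0r. Qed.

Definition partial_permutation p (u v : nat -> nat) (tau : 'S_p) : nat -> nat -> K :=
  fun a b => [exists y : 'I_p, (a == u (tau y)) && (b == v y)]%:R.

Lemma partial_permutation_det p u v (tau : 'S_p) :
  (forall i j, (i < p)%N -> (j < p)%N -> u i = u j -> i = j) ->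
  (forall i j, (i < p)%N -> (j < p)%N -> v i = v j -> i = j) ->
  \det (\matrix_(i < p, j < p) partial_permutation u v tau (u i) (v j)) != 0.
Proof.
move=> iu iv; have -> : \matrix_(i < p, j < p)
    partial_permutation u v tau (u i) (v j) = (perm_mx tau)^T.
  apply/matrixP => i j; rewrite !mxE /partial_permutation; congr ((nat_of_bool _)%:R).
  apply/existsP/idP => [[y /andP[/eqP e1 /eqP e2]]|/eqP <-].
    have -> : j = y by apply/val_inj/(iv _ _ (ltn_ord j) (ltn_ord y) e2).
    by apply/eqP/val_inj/esym/(iu _ _ (ltn_ord i) (ltn_ord _) e1).
  by exists j; rewrite !eqxx.
by rewrite det_tr det_perm signr_eq0.
Qed.

Definition injective_below p (u : nat -> nat) : Prop :=
  (forall i, (i < p)%N -> (u i < k)%N) /\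
  (forall i j, (i < p)%N -> (j < p)%N -> u i = u j -> i = j).

Lemma poly_minor_neq0 p u v : injective_below p u -> injective_below p v ->
  poly_minor p u v != 0.
Proof.
move=> [uk iu] [vk iv]; apply/eqP => e.
have := partial_permutation_det 1%g iu iv; rewrite -at_point_minor // e.
by rewrite /at_point meval0 eqxx.
Qed.

Lemma det_zero_row (S : comNzRingType) p (M : 'M[S]_p) i :
  (forall j, M i j = 0) -> \det M = 0.
Proof. by move=> z; rewrite (expand_det_row M i) big1 // => j _; rewrite z mul0r. Qed.

Lemma det_zero_col (S : comNzRingType) p (M : 'M[S]_p) j :
  (forall i, M i j = 0) -> \det M = 0.
Proof. by move=> z; rewrite -det_tr (@det_zero_row _ _ _ j) // => i; rewrite mxE z. Qed.

Definition index_set p (u : nat -> nat) : seq nat := [seq u i | i <- iota 0 p].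

Lemma index_setP p u a :
  reflect (exists2 i, (i < p)%N & a = u i) (a \in index_set p u).
Proof.
apply: (iffP mapP) => [[i h ->]|[i h ->]]; exists i => //.
  by rewrite mem_iota in h.
by rewrite mem_iota.
Qed.

Lemma uniq_index_set p u : injective_below p u -> uniq (index_set p u).
Proof.
move=> [_ iu]; rewrite map_inj_in_uniq ?iota_uniq // => i j.
by rewrite !mem_iota; apply: iu.
Qed.

(** A partial permutation matrix supported on the rows [u'] and columns [v'] gives the second minor
    the value 1 or -1. Unless the index sets agree, some such matrix makes the first minor
    vanish. *)
Lemma poly_minor_divides p u v p' u' v' : (0 < p)%N ->
  injective_below p u -> injective_below p v ->
  injective_below p' u' -> injective_below p' v' ->
  divides (poly_minor p u v) (poly_minor p' u' v') ->
  [/\ p = p', perm_eq (index_set p u) (index_set p' u')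
    & perm_eq (index_set p v) (index_set p' v')].
Proof.
move=> p0 hu hv hu' hv' dv; have [uk iu] := hu; have [vk iv] := hv.
have [uk' iu'] := hu'; have [vk' iv'] := hv'.
have contra (tau : 'S_p') : \det (\matrix_(i < p, j < p)
    partial_permutation u' v' tau (u i) (v j)) = 0 -> False.
  rewrite -at_point_minor // => z; have := at_point_divides dv z.
  by rewrite at_point_minor // => /eqP; apply/negP; apply: partial_permutation_det.
have sub_u : {subset index_set p u <= index_set p' u'}.
  move=> a /index_setP[i ip ->]; apply/negPn/negP => nin.
  apply: (contra 1%g); apply: (@det_zero_row _ _ _ (Ordinal ip)) => j.
  rewrite mxE /partial_permutation /=; case: existsP => //; case=> [y /andP[/eqP e _]].
  by case/negP: nin; apply/index_setP; exists (y : nat) => //; rewrite e perm1.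
have sub_v : {subset index_set p v <= index_set p' v'}.
  move=> a /index_setP[i ip ->]; apply/negPn/negP => nin.
  apply: (contra 1%g); apply: (@det_zero_col _ _ _ (Ordinal ip)) => j.
  rewrite mxE /partial_permutation /=; case: existsP => //; case=> [y /andP[_ /eqP e]].
  by case/negP: nin; apply/index_setP; exists (y : nat) => //; rewrite e.
have pp' : (p <= p')%N.
  by have := uniq_leq_size (uniq_index_set hu) sub_u; rewrite !size_map !size_iota.
have epp : p = p'.
  apply/eqP; rewrite eqn_leq pp' /= leqNgt; apply/negP => lt.
  have [/allP sub|/allPn[b /index_setP[y yp ->] nin]] :=
      boolP (all (mem (index_set p v)) (index_set p' v')).
    have := uniq_leq_size (uniq_index_set hv') sub.
    by rewrite !size_map !size_iota leqNgt lt.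
  have /sub_u/index_setP[x xp ex] : u 0%N \in index_set p u.
    by apply/index_setP; exists 0%N.
  (* The transposition puts the only 1 of row [u 0] into the column [v' y], which the smaller minor
     does not contain. *)
  apply: (contra (tperm (Ordinal xp) (Ordinal yp))).
  apply: (@det_zero_row _ _ _ (Ordinal p0)) => j.
  rewrite mxE /partial_permutation /=; case: existsP => //; case=> [z /andP[/eqP e1 /eqP e2]].
  case/negP: nin; apply/index_setP; exists (j : nat) => //; rewrite e2; congr v'.
  have ez : tperm (Ordinal xp) (Ordinal yp) z = Ordinal xp.
    by apply/val_inj/(iu' _ _ (ltn_ord _) xp); rewrite -e1.
  by rewrite -[z](tpermK (Ordinal xp) (Ordinal yp)) ez tpermL.
subst p'; split=> //; apply: uniq_perm; rewrite ?uniq_index_set //.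
  by case: (uniq_min_size (uniq_index_set hu) sub_u); rewrite ?size_map ?size_iota.
by case: (uniq_min_size (uniq_index_set hv) sub_v); rewrite ?size_map ?size_iota.
Qed.

Lemma mxvec_index_inj (a b a' b' : 'I_k) :
  mxvec_index a b = mxvec_index a' b' -> a = a' /\ b = b'.
Proof. by move=> /cast_ord_inj/enum_rank_inj[-> ->]. Qed.

Notation frac := (@FracField.tofrac R).

Lemma tofrac_inj (a b : R) : frac a = frac b -> a = b.
Proof. by move/eqP; rewrite tofrac_eq => /eqP. Qed.

(* Sending the corner variable [z] of [D = z g + h] to [- h / g] is a morphism
   to the fraction field whose kernel is generated by [D], as [g] is prime to
   [D]. *)
Lemma poly_minor_prime_step p u v : injective_below p.+1 u ->
  injective_below p.+1 v ->
  (p = 0%N \/ prime_element (poly_minor p u v)) ->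
  prime_element (poly_minor p.+1 u v).
Proof.
move=> hu hv gprime; have [uk iu] := hu; have [vk iv] := hv.
have below w : injective_below p.+1 w -> injective_below p w.
  move=> [wk iw]; split=> [i ip|i j ip jp]; first by apply: wk; apply: ltnW.
  by apply: iw; apply: ltnW.
set D := poly_minor p.+1 u v; set g := poly_minor p u v in gprime.
have g0 : g != 0 by apply: poly_minor_neq0; apply: below.
pose M i j := coordinate (u i) (v j); pose z := M p p.
pose h := \det (\matrix_(i < p.+1, j < p.+1)
     if (i == p :> nat) && (j == p :> nat) then 0 else M i j).
have DE : D = z * g + h.
  rewrite /D /poly_minor -det_last_entry; congr (\det _).
  by apply/matrixP => i j; rewrite !mxE; case: ifP => // /andP[/eqP -> /eqP ->].
pose U := Ordinal (uk p (ltnSn p)); pose V := Ordinal (vk p (ltnSn p)).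
have zE : z = 'X_(mxvec_index U V) by rewrite -coordinateE.
pose X t := if t == mxvec_index U V then - frac h / frac g else frac 'X_t.
pose psi := mmap (scalar_in_field K k) X.
have fg0 : frac g != 0 by rewrite tofrac_eq0.
have psiM i j : (i < p.+1)%N -> (j < p.+1)%N -> psi (M i j) =
    if (i == p) && (j == p) then - frac h / frac g else frac (M i j).
  move=> ip jp; have ME : M i j = 'X_(mxvec_index (Ordinal (uk i ip)) (Ordinal (vk j jp))).
    by rewrite -coordinateE.
  rewrite /psi {1}ME mmap_var /X; case: eqP => [/mxvec_index_inj[e1 e2]|ne].
    have -> : i = p by apply: iu => //; case: e1.
    have -> : j = p by apply: iv => //; case: e2.
    by rewrite eqxx.
  case: andP => [[/eqP ei /eqP ej]|_]; last by rewrite ME.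
  by case: ne; congr mxvec_index; apply: val_inj; rewrite /= ?ei ?ej.
have frac_det q (A : 'M[R]_q) : frac (\det A) = \det (map_mx frac A).
  by rewrite -det_map_mx.
have psiD : psi D = 0.
  have -> : psi D = \det (\matrix_(i < p.+1, j < p.+1) if (i == p :> nat) &&
      (j == p :> nat) then - frac h / frac g else frac (M i j)).
    rewrite /D /poly_minor /psi -det_map_mx; congr (\det _).
    apply/matrixP => i j; rewrite !mxE.
    exact: psiM (ltn_ord i) (ltn_ord j).
  rewrite (det_last_entry p (fun i j => frac (M i j))).
  have -> : \det (\matrix_(i < p, j < p) frac (M i j)) = frac g.
    by rewrite frac_det; congr (\det _); apply/matrixP => i j; rewrite !mxE.
  have -> : \det (\matrix_(i < p.+1, j < p.+1) if (i == p :> nat) &&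
      (j == p :> nat) then 0 else frac (M i j)) = frac h.
    rewrite frac_det; congr (\det _); apply/matrixP => i j; rewrite !mxE.
    by case: ifP => // _; rewrite tofrac0.
  by rewrite divfK // addNr.
(* After multiplication by a power of [g], replacing [z] by [- h / g] changes [q] only by a multiple
   of [D]. *)
have lift q : exists N e r, g ^+ N * q = e + D * r /\ psi q * frac g ^+ N = frac e.
  elim/mpoly_alg_ind: q => [c | t | q1 q2 [N1 [e1 [r1 [h1 k1]]]] [N2 [e2 [r2 [h2 k2]]]]
    | q1 q2 [N1 [e1 [r1 [h1 k1]]]] [N2 [e2 [r2 [h2 k2]]]]].
  - by exists 0%N, c%:MP, 0; rewrite mul1r mulr0 addr0 mulr1 /psi mmap_const.
  - rewrite /psi mmap_var /X; case: eqP => [->|_].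
      exists 1%N, (- h), 1; rewrite -zE DE expr1 mulr1; split; first by ring.
      by rewrite expr1 tofracN divfK.
    by exists 0%N, 'X_t, 0; rewrite mul1r mulr0 addr0 mulr1.
  - exists (N1 + N2)%N, (g ^+ N2 * e1 + g ^+ N1 * e2), (g ^+ N2 * r1 + g ^+ N1 * r2).
    split.
      transitivity (g ^+ N2 * (g ^+ N1 * q1) + g ^+ N1 * (g ^+ N2 * q2)).
        by rewrite exprD; ring.
      by rewrite h1 h2; ring.
    rewrite tofracD !tofracM !tofracXn -k1 -k2 /psi mmap_add exprD mulrDl.
    by congr (_ + _); [rewrite mulrA mulrC | rewrite mulrCA].
  - exists (N1 + N2)%N, (e1 * e2), (e1 * r2 + r1 * e2 + D * r1 * r2); split.
      by rewrite exprD mulrACA h1 h2; ring.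
    by rewrite tofracM -k1 -k2 /psi mmap_mul exprD mulrACA.
have ndiv : (0 < p)%N -> ~ divides g D.
  move=> p0 /poly_minor_divides[]//; try exact: below.
  by move=> /eqP; rewrite (ltn_eqF (ltnSn p)).
(* Here [D] divides [g ^+ N * q]. The factors [g] are cancelled one at a time, since [g] is 1 or a
   prime that does not divide [D], a minor of another size. *)
have ker q : psi q = 0 -> divides D q.
  move=> q0; have [N [e [r [h1 k1]]]] := lift q.
  have e0 : e = 0 by apply: tofrac_inj; rewrite -k1 q0 mul0r tofrac0.
  rewrite e0 add0r in h1; case: gprime => [p0|gp].
    exists r; rewrite -h1.
    have -> : g = 1 by rewrite /g /poly_minor; move: p0 => ->; rewrite det_mx00.
    by rewrite expr1n mul1r.
  have [p0|p0] := posnP p.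
    exists r; rewrite -h1.
    have -> : g = 1 by rewrite /g /poly_minor p0 det_mx00.
    by rewrite expr1n mul1r.
  elim: N r h1 {k1} => [|N IHN] r h1; first by exists r; rewrite -h1 mul1r.
  have /gp[/(ndiv p0)//|[r' er]] : divides g (D * r).
    by exists (g ^+ N * q); rewrite -h1 exprS mulrA.
  apply: (IHN r'); apply: (mulfI g0); rewrite mulrA -exprS h1 er; ring.
move=> a b [q eq].
have : psi a * psi b = 0 by rewrite -mmap_mul eq mmap_mul -/(psi _) psiD mul0r.
by move/eqP; rewrite mulf_eq0 => /orP[/eqP|/eqP] /ker; [left | right].
Qed.

Lemma poly_minor_prime p u v : (0 < p)%N -> injective_below p u ->
  injective_below p v -> prime_element (poly_minor p u v).
Proof.
case: p => // p _; elim: p => [|p IH] hu hv.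
  by apply: poly_minor_prime_step => //; left.
apply: poly_minor_prime_step => //; right; apply: IH.
  by case: hu => h1 h2; split=> [i ip|i j ip jp]; [apply: h1 | apply: h2]; apply: ltnW.
by case: hv => h1 h2; split=> [i ip|i j ip jp]; [apply: h1 | apply: h2]; apply: ltnW.
Qed.

End GenericMinors.

(** * The Jacobian criterion *)

Section Jacobian.
Variables (K : numFieldType) (N : nat).

Lemma mderiv_var (m : nat) (i j : 'I_m) :
  ('X_i : {mpoly K[m]})^`M(j) = (i == j)%:R.
Proof.
rewrite mderivX mnm1E; case: eqP => [->|_]; last by rewrite scale0r.
by rewrite scale1r -[X in 'X_[X - _]]add0m addmK mpolyX0.
Qed.

Lemma mderiv_comp m (X : 'I_m -> {mpoly K[N]}) (p : {mpoly K[m]}) j :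
  (mmap (@mpolyC N K) X p)^`M(j) =
  \sum_l mmap (@mpolyC N K) X p^`M(l) * (X l)^`M(j).
Proof.
elim/mpoly_alg_ind: p => [c | i | p q hp hq | p q hp hq].
- rewrite mmap_const mderivC big1 // => l _.
  by rewrite mderivC mmap_zero mul0r.
- rewrite mmap_var (bigD1 i) //= mderiv_var eqxx mmap_one mul1r big1 ?addr0 //.
  by move=> l li; rewrite mderiv_var eq_sym (negPf li) mmap_zero mul0r.
- rewrite mmap_add mderivD hp hq -big_split /=; apply: eq_bigr => l _.
  by rewrite mderivD mmap_add mulrDl.
- rewrite mmap_mul mderivM hp hq mulr_suml mulr_sumr -big_split /=.
  apply: eq_bigr => l _; rewrite mderivM mmap_add !mmap_mul mulrDl.
  by congr (_ + _); [rewrite mulrAC | rewrite mulrA].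
Qed.

Lemma msize_mderiv m (p : {mpoly K[m]}) i d :
  (msize p <= d.+1)%N -> (msize p^`M(i) <= d)%N.
Proof.
move=> hp; rewrite msizeE; apply/bigmax_leqP_seq => mm hm _.
have : (mm + U_(i))%MM \in msupp p.
  move: hm; rewrite !mcoeff_msupp mcoeff_mderiv; apply: contraNneq => ->.
  by rewrite mul0rn.
by move=> /msize_mdeg_lt; rewrite mdegD mdeg1 addn1 => /leq_trans/(_ hp).
Qed.

Lemma mderiv_eq0 m (p : {mpoly K[m]}) :
  (forall i, p^`M(i) = 0) -> p = (p@_0)%:MP.
Proof.
move=> h; apply/mpolyP => mm; rewrite mcoeffC.
have [->|nz] := eqVneq mm 0%MM; first by rewrite mulr1.
rewrite mulr0; have /existsP[i hi] : [exists i, mm i != 0%N].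
  apply: contraNT nz; rewrite negb_exists => /forallP z; apply/eqP/mnmP => i.
  by rewrite mnm0E; apply/eqP; move: (z i); rewrite negbK.
have /(congr1 (mcoeff (mm - U_(i))%MM)) := h i.
rewrite mcoeff_mderiv mcoeff0 submK; last by rewrite lep1mP.
by move/eqP; rewrite mulrn_eq0 /= => /eqP.
Qed.

(* Chain rule: the Jacobian matrix of a generating family is invertible. *)
Lemma jacobian_alg_independent m (X : 'I_m -> {mpoly K[N]}) : m = N ->
  (forall i, exists P Q : {mpoly K[m]}, mmap (@mpolyC N K) X Q != 0 /\
     mmap (@mpolyC N K) X Q * 'X_i = mmap (@mpolyC N K) X P) ->
  forall p, mmap (@mpolyC N K) X p = 0 -> p = 0.
Proof.
move=> e; subst m => gen; set c := mmap _ X.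
have /fin_all_exists[PQ hPQ] : forall i : 'I_N, exists PQ : _ * _,
    c PQ.2 != 0 /\ c PQ.2 * 'X_i = c PQ.1.
  by move=> i; have [P [Q h]] := gen i; exists (P, Q).
pose P i := (PQ i).1; pose Q i := (PQ i).2.
pose J := \matrix_(l < N, j < N) (X l)^`M(j).
(* Differentiating [c (Q i) * 'X_i = c (P i)] gives row [i] of [A *m J], which is diagonal with the
   nonzero entries [c (Q i)]. *)
pose A := \matrix_(i < N, l < N) (c (P i)^`M(l) - 'X_i * c (Q i)^`M(l)).
have AJ : A *m J = diag_mx (\row_i c (Q i)).
  apply/matrixP => i j; rewrite !mxE.
  have [_ /(congr1 (mderiv j))] := hPQ i.
  rewrite mderivM !mderiv_comp mderiv_var => eq.
  transitivity (\sum_l (c (P i)^`M(l) * (X l)^`M(j) - 'X_i * (c (Q i)^`M(l) * (X l)^`M(j)))).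
    by apply: eq_bigr => l _; rewrite !mxE mulrBl mulrA.
  rewrite big_split /= sumrN -mulr_sumr -eq [_ * 'X_i]mulrC addrAC subrr add0r.
  by rewrite mulr_natr.
have J0 : \det J != 0.
  have : \det (A *m J) != 0.
    by rewrite AJ det_diag; apply/prodf_neq0 => i _; rewrite mxE; case: (hPQ i).
  by rewrite det_mulmx mulf_eq0 negb_or => /andP[].
(* If [p] vanishes at [X], its gradient at [X] is killed by the invertible [J]. So the partial
   derivatives vanish at [X], are zero by induction, and [p] is constant in characteristic 0. *)
move=> p; have [d] := ubnP (msize p); elim: d p => // d IH p hd p0.
have [sz|sz] := posnP (msize p); first by apply/eqP; rewrite -msize_poly_eq0 sz.
have dp l : p^`M(l) = 0.
  apply: IH.
  - have le : (msize p <= (msize p).-1.+1)%N by rewrite prednK.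
    by apply: leq_ltn_trans (msize_mderiv l le) _; rewrite prednK.
  pose v := \row_l c p^`M(l).
  have vJ : v *m J = 0.
    apply/rowP => j; rewrite !mxE; have := mderiv_comp X p j.
    rewrite (p0 : mmap _ X p = 0).
    rewrite mderiv0 => e; rewrite [RHS]e; apply: eq_bigr => l' _.
    by rewrite !mxE.
  have : \det J *: v = 0.
    by rewrite -[v]mulmx1 scalemxAr -mul_mx_scalar mul1mx -mul_mx_adj mulmxA vJ mul0mx.
  by move=> /rowP/(_ l)/eqP; rewrite !mxE mulf_eq0 (negPf J0) => /eqP.
have pc := mderiv_eq0 dp; move: p0; rewrite pc /c mmap_const => /eqP.
by rewrite mpolyC_eq0 => /eqP ->; rewrite mpolyC0.
Qed.

End Jacobian.

(** * Diagrams with separated colors *)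

(* A step at level [q] enlarges the row set or lowers the column set, so the
   height of the chambers at a given level increases along a diagram. *)
Definition height (q : nat) (st : state) : int :=
  (\sum_(i < q) st.1 i)%N%:Z - (\sum_(i < q) st.2 i)%N%:Z.

Lemma sum_swap_other p q u : q != p.+1 ->
  (\sum_(i < q) swap p u i = \sum_(i < q) u i)%N.
Proof.
move=> ne; have [lt|ge] := ltnP p.+1 q.
  exact: (@big_swap nat 0%N addn id p q u lt).
by apply: eq_bigr => i _; rewrite swapD //; have := ltn_ord i; lia.
Qed.

Lemma sum_swap_same p u : (\sum_(i < p.+1) swap p u i + u p =
  \sum_(i < p.+1) u i + u p.+1)%N.
Proof.
rewrite !big_ord_recr /= swapL addnAC; congr (_ + _)%N.
by congr (_ + _)%N; apply: eq_bigr => i _; rewrite swapD //; have := ltn_ord i; lia.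
Qed.

Lemma height_step k q st y : admissible k st y ->
  if q == y.2.+1 then (height q st < height q (step st y) : Prop)
  else height q (step st y) = height q st.
Proof.
rewrite /admissible /step /height => /andP[_].
case: eqP => [->|/eqP ne]; last by case: ifP => _ _ /=; rewrite sum_swap_other.
case: ifP => _ lt /=.
  rewrite ltrD2r ltz_nat -(ltn_add2r (st.1 y.2)) sum_swap_same.
  by rewrite ltn_add2l.
rewrite ltrD2l ltrN2 ltz_nat -(ltn_add2r (st.2 y.2)) sum_swap_same.
by rewrite ltn_add2l.
Qed.

Lemma height_run (V : eqType) k q st (phi : nat -> V) w :
  valid k st (map fst w) ->
  height q st <= height q (run st (map fst w)) /\
  (run_labels phi w q != phi q -> height q st < height q (run st (map fst w))).
Proof.
elim: w st phi => [|[y a] w IH] st phi /=; first by rewrite eqxx.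
case/andP=> ad va; have [h1 h2] := IH _ (relabel phi y.2 a) va.
have := height_step q ad; case: eqP => [_ lt|/eqP ne e].
  by split=> [|_]; [apply: ltW|]; apply: lt_le_trans h1.
by rewrite -e; split=> // h3; apply: h2; rewrite relabel_neq.
Qed.

Lemma perm_eq_index_set_sum q u u' : perm_eq (index_set q u) (index_set q u') ->
  (\sum_(i < q) u i = \sum_(i < q) u' i)%N.
Proof.
have sumE (w : nat -> nat) : (\sum_(i < q) w i)%N = sumn (index_set q w).
  by rewrite sumnE /index_set big_map -(big_mkord xpredT w) /index_iota subn0.
by rewrite !sumE => /perm_sumn.
Qed.

Section Monochrome.
Variable k : nat.

Lemma red_word u v : is_perm k u -> exists w,
  [/\ valid k (u, v) w, all fst w & run (u, v) w = (reversal k, v)].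
Proof.
have [N] := ubnP (noninversions k u); elim: N u => // N IH u ltN pu.
have [/existsP[p /andP[pk lt]]|none] :=
  boolP [exists p : 'I_k, (p.+1 < k) && (u p < u p.+1)]%N.
  have [||w [h1 h2 h3]] := IH (swap p u).
  - by move: ltN; rewrite (noninversions_swap pk lt).
  - exact: is_perm_swap.
  by exists ((true, p : nat) :: w); split=> //=; rewrite /admissible /= pk lt.
exists [::]; split=> //=; congr (_, _); apply: is_perm_decreasing => // p pk.
rewrite ltn_neqAle; apply/andP; split.
  by apply/eqP => e; case: pu => _ inj _; have := inj _ _ pk (ltnW pk) e; lia.
rewrite leqNgt; apply/negP => lt; case/existsP: none.
by exists (Ordinal (ltnW pk)); rewrite /= pk.
Qed.

Lemma blue_word u v : is_perm k v -> exists w,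
  [/\ valid k (u, v) w, all (fun y => ~~ y.1) w & run (u, v) w = (u, id)].
Proof.
have [N] := ubnP (inversions k v); elim: N v => // N IH v ltN pv.
have [/existsP[p /andP[pk lt]]|none] :=
  boolP [exists p : 'I_k, (p.+1 < k) && (v p.+1 < v p)]%N.
  have [||w [h1 h2 h3]] := IH (swap p v).
  - by move: ltN; rewrite (inversions_swap pk lt).
  - exact: is_perm_swap.
  by exists ((false, p : nat) :: w); split=> //=; rewrite /admissible /= pk lt.
exists [::]; split=> //=; congr (_, _); apply: (@is_perm_increasing k) => // p pk.
rewrite ltn_neqAle; apply/andP; split.
  by apply/eqP => e; case: pv => _ inj _; have := inj _ _ (ltnW pk) pk e; lia.
rewrite leqNgt; apply/negP => lt; case/existsP: none.
by exists (Ordinal (ltnW pk)); rewrite /= pk.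
Qed.

Lemma run_red st w : all fst w -> (run st w).2 = st.2.
Proof.
by elim: w st => //= y w IH st /andP[hy /IH ->]; rewrite /step hy.
Qed.

Lemma run_blue st w : all (fun y : letter => ~~ y.1) w -> (run st w).1 = st.1.
Proof.
by elim: w st => //= y w IH st /andP[/negPf hy /IH ->]; rewrite /step hy.
Qed.

Lemma all_take (T : Type) (P : pred T) m s : all P s -> all P (take m s).
Proof. by elim: s m => [|a s IH] [|m] //= /andP[-> /IH ->]. Qed.

Lemma red_first_prefix st a b p q :
  all fst a -> all (fun y => ~~ y.1) b -> (a ++ b = p ++ q)%SEQ ->
  (run st p).2 = st.2 \/ (run st p).1 = (run st a).1.
Proof.
move=> ra rb e; have := congr1 (take (size p)) e.
rewrite [in RHS]take_size_cat // take_cat; case: ltnP => _ <-.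
  by left; apply: run_red; apply: all_take.
by right; rewrite run_cat run_blue //; apply: all_take.
Qed.

Lemma blue_first_prefix st a b p q :
  all (fun y => ~~ y.1) a -> all fst b -> (a ++ b = p ++ q)%SEQ ->
  (run st p).1 = st.1 \/ (run st p).2 = (run st a).2.
Proof.
move=> ra rb e; have := congr1 (take (size p)) e.
rewrite [in RHS]take_size_cat // take_cat; case: ltnP => _ <-.
  by left; apply: run_blue; apply: all_take.
by right; rewrite run_cat run_red //; apply: all_take.
Qed.

Lemma terminal_final : terminal k (reversal k, id).
Proof.
move=> [c p]; rewrite /admissible /=; apply/negP => /andP[pk].
by rewrite /reversal pk (ltnW pk); case: c; lia.
Qed.

Lemma red_first_word : exists a b, [/\ all fst a, all (fun y => ~~ y.1) b,
  valid k (initial_state k) (a ++ b), (run (initial_state k) a).1 = reversal k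
  & run (initial_state k) (a ++ b) = (reversal k, id)].
Proof.
have [a [a1 a2 a3]] := @red_word id (reversal k) (is_perm_id k).
have [b [b1 b2 b3]] := @blue_word (reversal k) (reversal k) (is_perm_reversal k).
by exists a, b; split; rewrite ?valid_cat ?run_cat ?a3 ?a1.
Qed.

Lemma blue_first_word : exists a b, [/\ all (fun y => ~~ y.1) a, all fst b,
  valid k (initial_state k) (a ++ b), (run (initial_state k) a).2 = id
  & run (initial_state k) (a ++ b) = (reversal k, id)].
Proof.
have [a [a1 a2 a3]] := @blue_word id (reversal k) (is_perm_reversal k).
have [b [b1 b2 b3]] := @red_word id id (is_perm_id k).
by exists a, b; split; rewrite ?valid_cat ?run_cat ?a3 ?a1.
Qed.

Lemma reversal_id_disjoint q : (0 < q < k)%N ->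
  ~ perm_eq (index_set q (reversal k)) (index_set q id).
Proof.
move=> /andP[q0 qk] /perm_mem/(_ 0%N); have -> : 0%N \in index_set q id.
  by apply/index_setP; exists 0%N.
case/index_setP => i iq; rewrite /reversal; case: ifP; lia.
Qed.

(** If the index sets agreed, either the first [q] values of [reversal k] and of [id] would form the
    same set, impossible for [q < k], or [st] would have the height of one end of the diagram. *)
Lemma chambers_disjoint q st q' st' : (0 < q < k)%N ->
  (st.2 = reversal k \/ st.1 = reversal k) -> (st'.1 = id \/ st'.2 = id) ->
  height q (initial_state k) < height q st ->
  height q st < height q (reversal k, id) ->
  ~ [/\ q = q', perm_eq (index_set q st.1) (index_set q' st'.1)
      & perm_eq (index_set q st.2) (index_set q' st'.2)].
Proof.
move=> qk hst hst' h1 h2 [e e1 e2]; subst q'.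
case: hst => hs; case: hst' => hs'.
- move: h1; rewrite /height hs hs' in e1 *.
  by rewrite /= (perm_eq_index_set_sum e1) ltxx.
- by apply: (reversal_id_disjoint qk); rewrite -hs -hs'.
- by apply: (reversal_id_disjoint qk); rewrite -hs -hs'.
- move: h2; rewrite /height hs hs' in e2 *.
  by rewrite /= (perm_eq_index_set_sum e2) ltxx.
Qed.

End Monochrome.

(** * Values where a frozen variable vanishes *)

Section Rational.
Variables (K F : fieldType) (iota : {rmorphism K -> F}) (m : nat).
Variable x : 'I_m -> F.

Definition rational (y : F) : Prop := exists p q : {mpoly K[m]},
  mmap iota x q != 0 /\ y * mmap iota x q = mmap iota x p.

Lemma rational_const c : rational (iota c).
Proof.
by exists c%:MP, 1; rewrite mmap_one oner_neq0 mmap_const mulr1.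
Qed.

Lemma rational_var h : rational (x h).
Proof. by exists 'X_h, 1; rewrite mmap_one oner_neq0 mmap_var mulr1. Qed.

Lemma rationalD y z : rational y -> rational z -> rational (y + z).
Proof.
move=> [p [q [q0 e]]] [p' [q' [q'0 e']]]; exists (p * q' + p' * q), (q * q').
by rewrite mmap_add !mmap_mul mulf_neq0 // -e -e'; split=> //; ring.
Qed.

Lemma rationalM y z : rational y -> rational z -> rational (y * z).
Proof.
move=> [p [q [q0 e]]] [p' [q' [q'0 e']]]; exists (p * p'), (q * q').
by rewrite !mmap_mul mulf_neq0 // -e -e'; split=> //; ring.
Qed.

Lemma rationalV y : rational y -> rational y^-1.
Proof.
move=> ry; have [->|y0] := eqVneq y 0.
  by rewrite invr0 -(rmorph0 iota); apply: rational_const.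
have [p [q [q0 e]]] := ry; exists q, p; rewrite -e mulf_neq0 //; split=> //.
by rewrite mulKf.
Qed.

Lemma rational_prod (I : Type) (r : seq I) (P : pred I) (E : I -> F) :
  (forall i, rational (E i)) -> rational (\prod_(i <- r | P i) E i).
Proof.
move=> h; apply: (big_ind rational) => //; last exact: rationalM.
by rewrite -(rmorph1 iota); apply: rational_const.
Qed.

Lemma rationalX y e : rational y -> rational (y ^+ e).
Proof.
move=> ry; rewrite -[e]card_ord -prodr_const; exact: rational_prod.
Qed.

End Rational.

Lemma rational_mutate (K F : fieldType) (iota : {rmorphism K -> F}) m n f
    (x : 'I_m -> F) (s : seed_data F n f) l h :
  (forall i, rational iota x (seed_var s i)) ->
  rational iota x (mutate_var s l h).
Proof.
move=> hs; have [->|hl] := eqVneq h (lshift f l); last by rewrite mutate_var_id.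
rewrite mutate_varE; apply: rationalM; last exact: rationalV.
by apply: rationalD; apply: rational_prod => i; apply: rationalX.
Qed.

Lemma rational_foldl (K F : fieldType) (iota : {rmorphism K -> F}) n f
    (s : seed_data F n f) ls h :
  rational iota (seed_var s) (seed_var (foldl (@mutate F n f) s ls) h).
Proof.
have : forall i, rational iota (seed_var s) (seed_var s i) by apply: rational_var.
move: {1 3}(seed_var s) => x; elim: ls s h => [|l ls IH] s h hs //=.
by apply: IH => i; apply: rational_mutate.
Qed.

Section LocalValue.
Variables (K F : fieldType) (iota : {rmorphism K -> F}) (m : nat).
Variables (x : 'I_m -> F) (xi : 'I_m -> K).
Hypothesis x_indep : alg_independent iota x.

(** [y] lies in the local ring of the point [xi] in the coordinates [x], with residue [c]. *)
Definition local_value (y : F) (c : K) : Prop := exists p q : {mpoly K[m]},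
  [/\ meval xi q != 0, y * mmap iota x q = mmap iota x p
    & c * meval xi q = meval xi p].

Let mmap_neq0 q : meval xi q != 0 -> mmap iota x q != 0.
Proof.
move=> q0; apply: contraNneq q0 => /x_indep ->.
by rewrite meval0.
Qed.

Lemma local_value_mmap p : local_value (mmap iota x p) (meval xi p).
Proof.
by exists p, 1; rewrite meval1 oner_neq0 mmap_one !mulr1.
Qed.

Lemma local_value_const c : local_value (iota c) c.
Proof. by have := local_value_mmap c%:MP; rewrite mmap_const mevalC. Qed.

Lemma local_value_var h : local_value (x h) (xi h).
Proof. by have := local_value_mmap 'X_h; rewrite mmap_var mevalXU. Qed.

Lemma local_valueD y z c d : local_value y c -> local_value z d ->
  local_value (y + z) (c + d).
Proof.
move=> [p [q [q0 e1 e2]]] [p' [q' [q'0 e1' e2']]].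
exists (p * q' + p' * q), (q * q').
rewrite mmap_add !mmap_mul mevalD !mevalM mulf_neq0 // -e1 -e1' -e2 -e2'.
by split=> //; ring.
Qed.

Lemma local_valueM y z c d : local_value y c -> local_value z d ->
  local_value (y * z) (c * d).
Proof.
move=> [p [q [q0 e1 e2]]] [p' [q' [q'0 e1' e2']]]; exists (p * p'), (q * q').
by rewrite !mmap_mul !mevalM mulf_neq0 // -e1 -e1' -e2 -e2'; split=> //; ring.
Qed.

Lemma local_valueV y c : c != 0 -> local_value y c -> local_value y^-1 c^-1.
Proof.
move=> c0 [p [q [q0 e1 e2]]]; have p0 : meval xi p != 0 by rewrite -e2 mulf_neq0.
have y0 : y != 0.
  by have := mmap_neq0 p0; rewrite -e1 mulf_eq0 negb_or => /andP[].
by exists q, p; rewrite -e1 -e2 !mulKf // mulf_neq0.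
Qed.

Lemma local_valueX y c e : local_value y c -> local_value (y ^+ e) (c ^+ e).
Proof.
move=> h; elim: e => [|e IH]; last by rewrite !exprS; apply: local_valueM.
by rewrite !expr0 -(rmorph1 iota); apply: local_value_const.
Qed.

Lemma local_value_prod (I : Type) (r : seq I) (P : pred I) (E : I -> F) (e : I -> K) :
  (forall i, local_value (E i) (e i)) ->
  local_value (\prod_(i <- r | P i) E i) (\prod_(i <- r | P i) e i).
Proof.
move=> h; apply: (big_ind2 local_value) => //; last by move=> *; apply: local_valueM.
by rewrite -(rmorph1 iota); apply: local_value_const.
Qed.

Lemma local_value_uniq y c d : local_value y c -> local_value y d -> c = d.
Proof.
move=> [p [q [q0 e1 e2]]] [p' [q' [q'0 e1' e2']]].
have : mmap iota x (p * q' - p' * q) = 0.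
  by rewrite mmap_sub !mmap_mul -e1 -e1'; ring.
move/x_indep/(congr1 (meval xi)); rewrite mevalB !mevalM -e2 -e2' meval0.
have -> : c * meval xi q * meval xi q' - d * meval xi q' * meval xi q =
  (c - d) * (meval xi q * meval xi q') by ring.
by move/eqP; rewrite !mulf_eq0 (negPf q0) (negPf q'0) !orbF subr_eq0 => /eqP.
Qed.

Lemma local_value_comp N (z : 'I_N -> F) (zeta : 'I_N -> K) (p : {mpoly K[N]}) :
  (forall i, local_value (z i) (zeta i)) ->
  local_value (mmap iota z p) (meval zeta p).
Proof.
move=> h; elim/mpoly_alg_ind: p => [c | i | p q | p q].
- by rewrite mmap_const mevalC; apply: local_value_const.
- by rewrite mmap_var mevalXU.
- by rewrite mmap_add mevalD; apply: local_valueD.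
- by rewrite mmap_mul mevalM; apply: local_valueM.
Qed.

End LocalValue.

Section Positivity.
Variables (K : numFieldType) (F : fieldType) (iota : {rmorphism K -> F}) (n f : nat).
Variable s0 : seed_data F n f.
Hypothesis s0_indep : alg_independent iota (seed_var s0).
Variable c : 'I_f.

Definition frozen_point : 'I_(n + f) -> K := fun h => (h != rshift n c)%:R.

Definition positive_at (y : 'I_(n + f) -> F) : Prop :=
  exists v : 'I_(n + f) -> K,
    [/\ forall h, local_value iota (seed_var s0) frozen_point (y h) (v h),
        forall h, h != rshift n c -> 0 < v h & v (rshift n c) = 0].

(** The vanishing variable occurs in at most one of the two exchange monomials, so the other one is
    positive, and so is the mutable variable in the denominator. *)
Lemma positive_at_mutate s l : positive_at (seed_var s) ->
  positive_at (seed_var (mutate s l)).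
Proof.
move=> [v [hv pos zero]].
have v0 h : 0 <= v h.
  by have [->|/pos/ltW] := eqVneq h (rshift n c); rewrite ?zero.
pose w := binomial_of v (fun h => seed_mx s h l).
have mono_ge0 e : 0 <= pos_monomial v e.
  by apply: prodr_ge0 => h _; rewrite exprn_ge0.
have mono_gt0 e : e (rshift n c) <= 0 -> 0 < pos_monomial v e.
  move=> e0; apply: prodr_gt0 => h _.
  have [->|/pos vh] := eqVneq h (rshift n c); last by rewrite exprn_gt0.
  by rewrite pos_part_le0 // ltr01.
have w0 : 0 < w.
  have [le|lt] := leP (seed_mx s (rshift n c) l) 0.
    by rewrite ltr_wpDr // mono_gt0.
  by rewrite ltr_wpDl // mono_gt0 // oppr_le0 ltW.
have cl : rshift n c != lshift f l by rewrite eq_sym eq_lrshift.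
have vl : 0 < v (lshift f l) by apply: pos; rewrite eq_lrshift.
exists (fun h => if h == lshift f l then w / v (lshift f l) else v h).
split=> [h|h hc|]; last by rewrite (negPf cl).
- case: eqP => [->|/eqP hl]; last by rewrite /= mutate_var_id.
  rewrite /= mutate_varE; apply: local_valueM; last first.
    by apply: local_valueV => //; rewrite gt_eqF.
  by apply: local_valueD; apply: local_value_prod => i; apply: local_valueX.
- by case: eqP => // _; [apply: divr_gt0 | apply: pos].
Qed.

Lemma positive_at_foldl ls :
  positive_at (seed_var (foldl (@mutate F n f) s0 ls)).
Proof.
have : positive_at (seed_var s0).
  exists frozen_point; split=> [h|h hc|]; rewrite /frozen_point ?hc ?eqxx //.
  exact: local_value_var.
have gen s : positive_at (seed_var s) ->
    positive_at (seed_var (foldl (@mutate F n f) s ls)).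
  by elim: ls s => [//|l ls IH] s h /=; apply: IH; apply: positive_at_mutate.
exact: gen.
Qed.

End Positivity.

(** * Minors of the generic matrix *)

Section FunctionField.
Variables (K : numFieldType) (k : nat).

Notation R := {mpoly K[k * k]}.
Notation frac := (coord_in_field K k).
Notation iota := (scalar_in_field K k).

Definition coord_frac (a b : nat) : coord_field K k := frac (coordinate K k a b).

Lemma frac_inj : injective frac.
Proof. by move=> a b /eqP; rewrite [_ == _]tofrac_eq => /eqP. Qed.

Lemma frac_neq0 a : (frac a != 0) = (a != 0).
Proof. by rewrite -(rmorph0 frac) (inj_eq frac_inj). Qed.

Lemma frac_quotient (y : coord_field K k) :
  exists a b, b != 0 /\ y * frac b = frac a.
Proof.
elim/quotW: y => y; exists \n_y, \d_y; split; first exact: denom_ratioP.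
rewrite /coord_in_field /=; unlock FracField.tofrac; rewrite -[LHS]FracField.pi_mul.
apply/eqmodP; rewrite /= FracField.equivfE /FracField.mulf.
by rewrite !numden_Ratio ?(oner_eq0, mulf_neq0, denom_ratioP) // !mulr1 mulrC.
Qed.

Lemma mmap_frac m (X : 'I_m -> R) (p : {mpoly K[m]}) :
  mmap iota (fun h => frac (X h)) p = frac (mmap (@mpolyC (k * k) K) X p).
Proof.
elim/mpoly_alg_ind: p => [c | i | p q hp hq | p q hp hq].
- by rewrite !mmap_const.
- by rewrite !mmap_var.
- by rewrite !mmap_add hp hq rmorphD.
- by rewrite !mmap_mul hp hq rmorphM.
Qed.

Lemma inversion_sign_bool p u : exists b : bool,
  inversion_sign (coord_field K k) p u = frac ((-1) ^+ b).
Proof.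
have := @inversion_sign_sq (coord_field K k) p u; rewrite -expr2 => /eqP.
rewrite sqrf_eq1 => /orP[]/eqP ->; [exists false | exists true].
  by rewrite expr0 rmorph1.
by rewrite expr1 rmorphN1.
Qed.

Lemma minor_frac p u v : minor coord_frac p u v = frac (poly_minor K k p u v).
Proof.
rewrite /minor /poly_minor -det_map_mx; congr (\det _).
by apply/matrixP => i j; rewrite !mxE.
Qed.

Lemma set_minor_frac p u v : exists b : bool,
  set_minor coord_frac p u v = frac ((-1) ^+ b * poly_minor K k p u v).
Proof.
have [b hb] := inversion_sign_bool p u; have [c hc] := inversion_sign_bool p v.
exists (b (+) c); rewrite /set_minor hb hc minor_frac -!rmorphM.
by rewrite -signr_addb.
Qed.

Lemma is_perm_injective_below p u : (p <= k)%N -> is_perm k u ->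
  injective_below k p u.
Proof.
move=> pk [h1 h2 _]; split=> [i ip|i j ip jp].
  by apply: h1; apply: (leq_trans ip pk).
by apply: h2 => //; [apply: (leq_trans ip pk) | apply: (leq_trans jp pk)].
Qed.

Lemma chamber_minor_neq0 st q : perm_state k st -> (q <= k)%N ->
  chamber_minor coord_frac st q != 0.
Proof.
move=> [h1 h2] qk; rewrite /chamber_minor set_minor_neq0 minor_frac frac_neq0.
by apply: poly_minor_neq0; apply: is_perm_injective_below.
Qed.

Lemma divides_sign (S : comNzRingType) (b c : bool) (d a : S) :
  divides ((-1) ^+ b * d) ((-1) ^+ c * a) -> divides d a.
Proof.
move=> [q e]; exists ((-1) ^+ c * (-1) ^+ b * q).
rewrite -[a](signrMK c) e; ring.
Qed.

Definition listing (I : {set 'I_k}) : seq nat := map val (enum I ++ enum (~: I)).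

(** The default [i] makes the function the identity from [k] on, as [is_perm] demands. *)
Definition listing_fun (I : {set 'I_k}) (i : nat) : nat := nth i (listing I) i.

Lemma size_listing I : size (listing I) = k.
Proof. by rewrite size_map size_cat -!cardE cardsC card_ord. Qed.

Lemma listing_is_perm I : is_perm k (listing_fun I).
Proof.
have uq : uniq (listing I).
  rewrite map_inj_uniq; last exact: val_inj.
  rewrite cat_uniq !enum_uniq andbT; apply/hasPn => a.
  by rewrite !mem_enum inE.
split=> [i ik|i j ik jk|i ik]; rewrite /listing_fun.
- have : nth i (listing I) i \in listing I by rewrite mem_nth // size_listing.
  by case/mapP => a _ ->; apply: ltn_ord.
- rewrite (set_nth_default i j) ?size_listing // => /eqP.
  by rewrite nth_uniq ?size_listing // => /eqP.
- by rewrite nth_default // size_listing.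
Qed.

Lemma listing_enum_val (I : {set 'I_k}) (i : 'I_#|I|) :
  listing_fun I i = enum_val i.
Proof.
have iI : (i < size (enum I))%N by rewrite -cardE.
rewrite /listing_fun /listing (nth_map (enum_val i)); last first.
  by rewrite size_cat ltn_addr.
by rewrite nth_cat iI -enum_val_nth.
Qed.

Lemma listing_sign (I : {set 'I_k}) :
  inversion_sign (coord_field K k) #|I| (listing_fun I) = 1.
Proof.
have tr : transitive (relpre (val : 'I_k -> nat) ltn).
  by move=> a b c /=; apply: ltn_trans.
have srt : sorted (relpre val ltn) (enum I).
  have -> : enum I = filter (mem I) (enum 'I_k) by rewrite [in RHS]enumT.
  apply: (sorted_filter tr).
  by rewrite -sorted_map val_enum_ord iota_ltn_sorted.
rewrite /inversion_sign /big_pairs big1 // => j _; rewrite big1 // => i _.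
have ij := ltn_ord i; have iI : (i < #|I|)%N by apply: ltn_trans (ltn_ord j).
have -> : (i : nat) = Ordinal iI by [].
rewrite !listing_enum_val.
suff lt : (enum_val (Ordinal iI) < enum_val j)%N by rewrite ltnNge (ltnW lt).
have [x0 _] : exists x0 : 'I_k, True by exists (enum_val j).
rewrite !(enum_val_nth x0).
by apply: (sorted_ltn_nth tr _ srt) => //; rewrite inE -cardE.
Qed.

Lemma generic_minor_chamber (I J : {set 'I_k}) (eIJ : #|I| = #|J|) :
  exists st, perm_state k st /\
    frac (generic_minor K eIJ) = chamber_minor coord_frac st #|I|.
Proof.
exists (listing_fun I, listing_fun J).
split; first by split; exact: listing_is_perm.
rewrite /chamber_minor /set_minor listing_sign eIJ listing_sign -eIJ !mul1r.
rewrite minor_frac; congr (frac (\det _)); apply/matrixP => i j.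
rewrite !mxE /= listing_enum_val.
have -> : listing_fun J j = enum_val (cast_ord eIJ j) by rewrite -listing_enum_val.
by rewrite coordinateE.
Qed.

Lemma coordinate_chamber (i j : 'I_k) : exists st, perm_state k st /\
  frac 'X_(mxvec_index i j) = chamber_minor coord_frac st 1.
Proof.
have e : #|[set i]| = #|[set j]| by rewrite !cards1.
have [st [ps h]] := generic_minor_chamber e; exists st; split=> //.
have c1 : #|[set i]| = 1%N by rewrite cards1.
rewrite -[X in chamber_minor _ _ X]c1 -h; congr (frac _); rewrite /generic_minor.
have i1 (a : 'I_#|[set i]|) : enum_val a = i.
  by have := enum_valP a; rewrite inE => /eqP.
have j1 (a : 'I_#|[set j]|) : enum_val a = j.
  by have := enum_valP a; rewrite inE => /eqP.
have -> : mxsub enum_val (fun a => enum_val (cast_ord e a)) (generic_matrix K k)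
    = \matrix_(a < #|[set i]|, b < #|[set i]|) 'X_(mxvec_index i j).
  by apply/matrixP => a b; rewrite !mxE i1 j1.
by rewrite c1 det_mx11 mxE.
Qed.

End FunctionField.

(** * The cluster algebra of the matrix space *)

(** The primes are cancelled one at a time. If [c] is the numerator over [X h * D], the expression
    [a' / b] gives [X h * (a' * D) = c * b], and [X h] does not divide [b], so it divides [c]. *)
Lemma remove_prime_denominators (R : idomainType) (F : fieldType)
    (frac : {rmorphism R -> F}) m (X : 'I_m -> R) (y : F) N a :
  injective frac -> (forall h, X h != 0) -> (forall h, prime_element (X h)) ->
  (forall h, exists b a', y * frac b = frac a' /\ ~ divides (X h) b) ->
  y * frac ((\prod_h X h) ^+ N) = frac a -> exists q, y = frac q.
Proof.
move=> inj X0 pX hX.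
pose good D := forall a, y * frac D = frac a -> exists q, y = frac q.
have good1 : good 1 by move=> b; rewrite rmorph1 mulr1 => ->; exists b.
have goodX h D : good D -> good (X h * D).
  move=> gD c e; have [b [a' [e' nd]]] := hX h.
  have E : X h * (a' * D) = c * b.
    by apply: inj; rewrite !rmorphM -e' -e rmorphM; ring.
  have : divides (X h) (c * b) by exists (a' * D).
  case/pX => // -[c' ec]; apply: (gD c').
  apply: (@mulfI _ (frac (X h))); first by rewrite -(rmorph0 frac) (inj_eq inj).
  by rewrite -rmorphM -ec -e rmorphM; ring.
have good_prod D : good D -> good ((\prod_h X h) * D).
  move=> gD; apply: (big_ind (fun P => forall D, good D -> good (P * D))) => //.
  - by move=> D' gD'; rewrite mul1r.
  - by move=> P Q hP hQ D' gD'; rewrite -mulrA; apply/hP/hQ.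
  - by move=> h _ D'; apply: goodX.
have goodN : good ((\prod_h X h) ^+ N).
  elim: N => [|N IH]; first by rewrite expr0.
  by rewrite exprS; apply: good_prod.
exact: goodN.
Qed.

Lemma prime_element_prod (R : comNzRingType) m (X : 'I_m -> R) (d : R) :
  prime_element d -> ~ divides d 1 -> (forall h, ~ divides d (X h)) ->
  ~ divides d (\prod_h X h).
Proof.
by move=> pd n1 nX; apply: (big_ind (fun P => ~ divides d P)) => // P Q hP hQ /pd[].
Qed.

Lemma seed_var_frozen (F : fieldType) n f (s : seed_data F n f) ls j :
  seed_var (foldl (@mutate F n f) s ls) (rshift n j) = seed_var s (rshift n j).
Proof.
elim: ls s => //= l ls IH s; rewrite IH /= mutate_var_id //.
by rewrite eq_sym eq_lrshift.
Qed.

Lemma seed_var_foldl_cases (F : fieldType) n f (s : seed_data F n f) ls h :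
  let y := seed_var (foldl (@mutate F n f) s ls) h in
  is_frozen_variable s y \/ is_cluster_variable s y.
Proof.
case: (split_ordP h) => j -> /=; first by right; exists ls, j.
by left; exists j; rewrite seed_var_frozen.
Qed.

Section Assembly.
Variables (K : numFieldType) (k : nat).

Notation R := {mpoly K[k * k]}.
Notation frac := (coord_in_field K k).
Notation iota := (scalar_in_field K k).
Notation Z := (coord_frac K k).
Notation st0 := (initial_state k).

Variables (n f : nat) (s0 : seed_data (coord_field K k) n f).
Variables (phi : nat -> 'I_(n + f)) (w0 : seq (letter * 'I_(n + f))).
Hypothesis nfE : (n + f)%N = (k * k)%N.
Hypothesis rep0 : represents k Z s0 st0 phi w0.
Hypothesis term0 : terminal k (run st0 (map fst w0)).
Hypothesis skew0 : skew_principal (seed_mx s0).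
Hypothesis unim0 : unimodular (seed_mx s0).
Hypothesis cover0 : forall h, on_level k phi h \/ h \in map snd w0.
Hypothesis inner0 : forall l, ~ on_level k phi (lshift f l) /\
  ~ on_level k (run_labels phi w0) (lshift f l).

Definition reachable_seed s : Prop := exists ls, s = foldl (@mutate _ n f) s0 ls.

Lemma diagram_of_word w : valid k st0 w -> terminal k (run st0 w) ->
  exists s S, [/\ reachable_seed s, represents k Z s st0 phi S, map fst S = w,
    run_labels phi S = run_labels phi w0 & perm_eq (map snd S) (map snd w0)].
Proof.
move=> va t; have re0 : realized k Z s0 st0 phi (run_labels phi w0) ([::] ++ w0).
  by split=> //; exists [::].
have [S [h1 h2 [h3 [ls h4]]]] :=
  realized_connected (Q := [::]) (@chamber_minor_neq0 K k) (perm_state_initial k)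
    (erefl (size w0)) va term0 t re0.
by exists (foldl (@mutate _ n f) s0 ls), S; split=> //; exists ls.
Qed.

(** A word that reaches [st] extends to a maximal one, whose diagram comes from the initial diagram
    by local moves; the chamber is read off at the cut. *)
Lemma chamber_minor_reachable st q : perm_state k st -> (0 < q <= k)%N ->
  exists ls h, chamber_minor Z st q = seed_var (foldl (@mutate _ n f) s0 ls) h.
Proof.
move=> ps qk; have [w [va rw]] := reach_state ps.
have [r [vr tr]] := extend_to_terminal k st.
have [||s [S [[ls ->] rep fS _ _]]] := @diagram_of_word (w ++ r).
- by rewrite valid_cat va rw.
- by rewrite run_cat rw.
exists ls, (run_labels phi (take (size w) S) q).
have := rep_vars rep; rewrite -[S in word_vars _ _ _ _ _ S](cat_take_drop (size w)).
case/word_vars_cat => _ /word_vars_head/(_ q qk) ->.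
by rewrite map_take fS (take_size_cat _ (erefl (size w))) rw.
Qed.

Lemma coordinate_reachable t : exists ls h,
  frac 'X_t = seed_var (foldl (@mutate _ n f) s0 ls) h.
Proof.
case/mxvec_indexP: t => i j; have [st [ps ->]] := coordinate_chamber K i j.
apply: chamber_minor_reachable => //=; exact: leq_ltn_trans (ltn_ord i).
Qed.

Lemma seed_var_chamber s S h : represents k Z s st0 phi S ->
  perm_eq (map snd S) (map snd w0) ->
  (exists2 q, (0 < q <= k)%N & phi q = h /\ seed_var s h = chamber_minor Z st0 q) \/
  (exists S1 y S2, S = rcons S1 (y, h) ++ S2 /\
     seed_var s h = chamber_minor Z (run st0 (map fst (rcons S1 (y, h)))) y.2.+1).
Proof.
move=> rep pm; have := cover0 h; rewrite -(perm_mem pm) => -[[q qk e]|/mapP[[y a] yS /= ea]].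
  left; exists q => //; split=> //.
  by rewrite -e; apply: (word_vars_head (rep_vars rep)).
right; subst a; have pk : (y.2.+1 < k)%N by apply: (valid_lt (rep_valid rep) yS).
case/splitPr: yS rep pm => S1 S2 rep _; exists S1, y, S2.
rewrite cat_rcons; split=> //; have := rep_vars rep; rewrite -cat_rcons.
case/word_vars_cat => _ /word_vars_head/(_ y.2.+1 (ltnW pk)) <-.
by rewrite /run_labels foldl_rcons /= relabelE.
Qed.

Lemma seed_var_frac s S h : represents k Z s st0 phi S ->
  perm_eq (map snd S) (map snd w0) -> exists st q b,
  [/\ perm_state k st, (0 < q <= k)%N &
    seed_var s h = frac ((-1) ^+ (b : bool) * poly_minor K k q st.1 st.2)].
Proof.
move=> rep pm; have [[q qk [_ ->]]|[S1 [y [S2 [e ->]]]]] := seed_var_chamber h rep pm.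
  have [b hb] := set_minor_frac K k q st0.1 st0.2.
  by exists st0, q, b; split=> //; exact: perm_state_initial.
have va := rep_valid rep; rewrite e map_cat valid_cat in va; case/andP: va => va _.
have [b hb] := set_minor_frac K k y.2.+1 (run st0 (map fst (rcons S1 (y, h)))).1
  (run st0 (map fst (rcons S1 (y, h)))).2.
exists (run st0 (map fst (rcons S1 (y, h)))), y.2.+1, b; split=> //.
  exact: perm_state_run va (perm_state_initial k).
have := valid_lt (rep_valid rep); move/(_ (y, h)); rewrite e mem_cat mem_rcons.
by rewrite mem_head => /(_ isT) /ltnW.
Qed.

Lemma s0_frac : exists X : 'I_(n + f) -> R, seed_var s0 = fun h => frac (X h).
Proof.
have /fin_all_exists[X hX] : forall h, exists x : R, seed_var s0 h = frac x.
  move=> h; have [st [q [b [_ _ ->]]]] := seed_var_frac h rep0 (perm_refl _).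
  by eexists.
by exists X; apply: functional_extensionality.
Qed.

(** There are as many variables as coordinates, and each coordinate occurs in a mutated seed, hence
    is a rational function of the initial variables: these are the two inputs of the Jacobian
    criterion. *)
Lemma s0_alg_independent : alg_independent iota (seed_var s0).
Proof.
have [X eX] := s0_frac; move=> p; rewrite eX mmap_frac => /eqP.
rewrite -(rmorph0 frac) (inj_eq (@frac_inj K k)) => /eqP.
apply: jacobian_alg_independent => // i.
have [ls [h e]] := coordinate_reachable i.
have [P [Q [Q0 E]]] := rational_foldl iota s0 ls h.
exists P, Q; move: Q0 E; rewrite -e eX !mmap_frac frac_neq0 => Q0 E; split=> //.
by apply: frac_inj; rewrite rmorphM -E mulrC.
Qed.

Lemma s0_good : good_seed iota s0.
Proof. by split=> //; exact: s0_alg_independent. Qed.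

Lemma s0_generates : generates_field iota (seed_var s0).
Proof.
move=> y; have rat a : rational iota (seed_var s0) (frac a).
  elim/mpoly_alg_ind: a => [c|t|a b ra rb|a b ra rb].
  - exact: (rational_const iota (seed_var s0) c).
  - by have [ls [h ->]] := coordinate_reachable t; apply: rational_foldl.
  - by rewrite rmorphD; apply: rationalD.
  - by rewrite rmorphM; apply: rationalM.
have [a [b [b0 e]]] := frac_quotient y.
have -> : y = frac a * (frac b)^-1 by rewrite -e mulfK // frac_neq0.
have [p [q [q0 E]]] : rational iota (seed_var s0) (frac a * (frac b)^-1).
  by apply: rationalM => //; apply: rationalV.
by exists p, q; split=> //; rewrite -E mulfK.
Qed.

Lemma s0_is_seed : is_seed iota s0.
Proof.
split; [exact: s0_alg_independent | exact: s0_generates |].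
exists (fun _ => 1); split=> [//|i j]; rewrite !mul1r !mxE; exact: skew0.
Qed.

Lemma frac_mmap (q : R) : frac q = mmap iota (fun t => frac 'X_t) q.
Proof.
elim/mpoly_alg_ind: q => [c | i | p q hp hq | p q hp hq].
- by rewrite mmap_const.
- by rewrite mmap_var.
- by rewrite mmap_add rmorphD hp hq.
- by rewrite mmap_mul rmorphM hp hq.
Qed.

Lemma frozen_not_divides (X : 'I_(n + f) -> R) (c : 'I_f) (q : {mpoly K[n + f]}) :
  seed_var s0 = (fun h => frac (X h)) -> meval (@frozen_point K n f c) q != 0 ->
  ~ divides (X (rshift n c)) (mmap (@mpolyC (k * k) K) X q).
Proof.
move=> eX q0 [r er]; have ai := s0_alg_independent.
have /fin_all_exists[zeta hz] : forall t, exists z,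
    local_value iota (seed_var s0) (@frozen_point K n f c) (frac 'X_t) z.
  move=> t; have [ls [h ->]] := coordinate_reachable t.
  by have [v [hv _ _]] := positive_at_foldl ai c ls; exists (v h).
have val p : local_value iota (seed_var s0) (@frozen_point K n f c)
    (frac p) (meval zeta p).
  by rewrite frac_mmap; apply: local_value_comp.
have zc : meval zeta (X (rshift n c)) = 0.
  have := local_value_var iota (seed_var s0) (@frozen_point K n f c) (rshift n c).
  have -> : seed_var s0 (rshift n c) = frac (X (rshift n c)) by rewrite eX.
  by move/(local_value_uniq ai (val _)); rewrite /frozen_point eqxx.
have := local_value_mmap iota (seed_var s0) (@frozen_point K n f c) q.
have -> : mmap iota (seed_var s0) q = frac (mmap (@mpolyC (k * k) K) X q).
  by rewrite eX mmap_frac.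
by move/(local_value_uniq ai (val _)) => e; rewrite -e er mevalM zc mul0r eqxx in q0.
Qed.

Lemma prime_element_sign (b : bool) (d : R) :
  prime_element d -> prime_element ((-1) ^+ b * d).
Proof.
move=> pd x y dv; have dvd z : divides d z -> divides ((-1) ^+ b * d) z.
  by move=> [w ->]; exists ((-1) ^+ b * w); rewrite mulrACA -signr_addb addbb mul1r.
have : divides d (x * y).
  by case: dv => w ->; exists ((-1) ^+ b * w); ring.
by case/pd => /dvd; [left | right].
Qed.

Lemma poly_minor_not_unit q u v b : (0 < q)%N ->
  injective_below k q u -> injective_below k q v ->
  ~ divides ((-1) ^+ (b : bool) * poly_minor K k q u v) 1.
Proof.
move=> q0 [uk _] [vk _] dv; have : divides (poly_minor K k q u v) 1.
  by case: dv => w e; exists ((-1) ^+ b * w); rewrite mulrCA mulrA.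
move/(@at_point_divides _ _ (fun _ _ => 0)); rewrite at_point_minor // => h.
have : at_point (fun _ _ => 0) (1 : R) = 0 :> K.
  by apply: h; apply: (@det_zero_row _ _ _ (Ordinal q0)) => j; rewrite mxE.
by rewrite /at_point meval1 => /eqP; rewrite oner_eq0.
Qed.

Lemma two_neq0K : 2%:R != 0 :> K.
Proof. by rewrite pnatr_eq0. Qed.

Lemma cluster_variable_laurent s ls (X : 'I_(n + f) -> R) y :
  s = foldl (@mutate _ n f) s0 ls -> (forall h, seed_var s h = frac (X h)) ->
  is_cluster_variable s0 y -> exists N a, y * frac ((\prod_h X h) ^+ N) = frac a.
Proof.
move=> es eX cy; have [_ [j _]] := cy.
have ub := cluster_variable_upper_bound two_neq0K ls s0_good cy.
have [ai _ _] := good_seed_foldl two_neq0K ls s0_good.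
rewrite -es in ub ai.
have nz h : seed_var s h != 0 by apply: alg_independent_neq0 ai.
have [N [p e]] := exchange_ring_laurent nz (ub j).
exists N, (mmap (@mpolyC (k * k) K) X p).
have eX' : seed_var s = (fun h => frac (X h)) by apply: functional_extensionality.
by rewrite -mmap_frac -eX' -e rmorphXn rmorph_prod; congr (_ * _ ^+ N);
   apply: eq_bigr => h _; rewrite eX.
Qed.

(** A chamber that touches neither end has a crossing at its level on either side, and each of these
    raises the height strictly. *)
Lemma inner_chamber s S l : represents k Z s st0 phi S ->
  perm_eq (map snd S) (map snd w0) ->
  run_labels phi S = run_labels phi w0 ->
  run st0 (map fst S) = (reversal k, id) ->
  exists S1 y S2, let st := run st0 (map fst (rcons S1 (y, lshift f l))) in
    [/\ S = rcons S1 (y, lshift f l) ++ S2, (y.2.+1 < k)%N, perm_state k st,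
      seed_var s (lshift f l) = chamber_minor Z st y.2.+1
    & height y.2.+1 st0 < height y.2.+1 st < height y.2.+1 (reversal k, id)].
Proof.
move=> rep pm fin fst_fin; have [n1 n2] := inner0 l.
have [[q qk [e _]]|[S1 [y [S2 [e xE]]]]] := seed_var_chamber (lshift f l) rep pm.
  by case: n1; exists q.
exists S1, y, S2 => st; have va := rep_valid rep.
rewrite e map_cat valid_cat -/st in va; case/andP: va => va1 va2.
have ps : perm_state k st by apply: perm_state_run va1 (perm_state_initial k).
move: va1; rewrite map_rcons -cats1 valid_cat /= andbT => /andP[va0 ad].
have pk : (y.2.+1 < k)%N by case/andP: ad.
split=> //; apply/andP; split.
  have stE : st = step (run st0 (map fst S1)) y.
    by rewrite /st map_rcons -cats1 run_cat.
  have [h1 _] := height_run y.2.+1 phi va0; apply: le_lt_trans h1 _.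
  by have := height_step y.2.+1 ad; rewrite eqxx -stE.
have [_] := height_run y.2.+1 (run_labels phi (rcons S1 (y, lshift f l))) va2.
rewrite -run_cat -map_cat -e fst_fin; apply.
have -> : run_labels phi (rcons S1 (y, lshift f l)) y.2.+1 = lshift f l.
  by rewrite /run_labels foldl_rcons /= relabelE.
apply/eqP => e2; case: n2; rewrite -fin e; exists y.2.+1; first exact: ltnW.
by rewrite /run_labels foldl_cat.
Qed.

(* A diagram with all red crossings first and one with all blue crossings
   first have no inner chamber in common, so the denominators of the two
   Laurent expansions only share frozen variables. *)
Lemma cluster_variable_polynomial y : is_cluster_variable s0 y ->
  exists q : R, y = frac q.
Proof.
move=> cy; have [a1 [b1 [ra1 rb1 va1 e1 fin1]]] := red_first_word k.
have [a2 [b2 [ra2 rb2 va2 e2 fin2]]] := blue_first_word k.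
have [||s1 [S1 [[ls1 es1] rep1 f1 l1 pm1]]] := @diagram_of_word (a1 ++ b1) => //.
  by rewrite fin1; exact: terminal_final.
have [||s2 [S2 [[ls2 es2] rep2 f2 l2 pm2]]] := @diagram_of_word (a2 ++ b2) => //.
  by rewrite fin2; exact: terminal_final.
have /fin_all_exists[X1 hX1] : forall h, exists x : R, seed_var s1 h = frac x.
  by move=> h; have [st [q [b [_ _ ->]]]] := seed_var_frac h rep1 pm1; eexists.
have /fin_all_exists[X2 hX2] : forall h, exists x : R, seed_var s2 h = frac x.
  by move=> h; have [st [q [b [_ _ ->]]]] := seed_var_frac h rep2 pm2; eexists.
have [X0 eX0] := s0_frac.
have [N1 [d1 lau1]] := cluster_variable_laurent es1 hX1 cy.
have [N2 [d2 lau2]] := cluster_variable_laurent es2 hX2 cy.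
have X1E h : exists st q b, [/\ perm_state k st, (0 < q <= k)%N &
    X1 h = (-1) ^+ (b : bool) * poly_minor K k q st.1 st.2].
  have [st [q [b [ps qk e]]]] := seed_var_frac h rep1 pm1.
  by exists st, q, b; split=> //; apply: frac_inj; rewrite -hX1.
have X1_prime h : prime_element (X1 h).
  have [st [q [b [[pu pv] /andP[q0 qk] ->]]]] := X1E h.
  by apply/prime_element_sign/poly_minor_prime; rewrite //;
    apply: is_perm_injective_below.
have X1_nonunit h : ~ divides (X1 h) 1.
  have [st [q [b [[pu pv] /andP[q0 qk] ->]]]] := X1E h.
  by apply: poly_minor_not_unit => //; apply: is_perm_injective_below.
have X1_neq0 h : X1 h != 0.
  have [st [q [b [[pu pv] /andP[q0 qk] ->]]]] := X1E h.
  rewrite mulf_neq0 ?signr_eq0 //.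
  by apply: poly_minor_neq0; apply: is_perm_injective_below.
apply: (remove_prime_denominators (@frac_inj K k) X1_neq0 X1_prime _ lau1) => h.
case: (split_ordP h) => j ->; last first.
  (* A frozen factor: the denominator comes from the value of [y] at the point where this variable
     is 0. *)
  have [ls [i ey]] := cy.
  have [v [/(_ (lshift f i)) [p [q [q0 ep _]]] _ _]] :=
    positive_at_foldl s0_alg_independent j ls.
  exists (mmap (@mpolyC (k * k) K) X0 q), (mmap (@mpolyC (k * k) K) X0 p).
  rewrite -!mmap_frac -eX0 ey; split=> //.
  have -> : X1 (rshift n j) = X0 (rshift n j).
    apply: frac_inj; rewrite -hX1 es1 seed_var_frozen eX0 //.
  exact: frozen_not_divides.
(* A mutable factor: the denominator comes from the expansion of [y] at the seed with blue crossings
   first. *)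
exists ((\prod_h X2 h) ^+ N2), d2; split=> //.
apply: prime_element_exp => //; apply: prime_element_prod => // h'.
have final1 : run st0 (map fst S1) = (reversal k, id) by rewrite f1.
have [T [y1 [T' []]]] := inner_chamber j rep1 pm1 l1 final1.
set st := run st0 _ => eS1 pk ps xE /andP[hl hu].
have [b hb] := set_minor_frac K k y1.2.+1 st.1 st.2.
have X1j : X1 (lshift f j) = (-1) ^+ b * poly_minor K k y1.2.+1 st.1 st.2.
  by apply: frac_inj; rewrite -hX1 xE.
have hst : st.2 = reversal k \/ st.1 = reversal k.
  have e : (a1 ++ b1 = map fst (rcons T (y1, lshift f j)) ++ map fst T')%SEQ.
    by rewrite -f1 eS1 map_cat.
  by have [h2|h1] := red_first_prefix st0 ra1 rb1 e; [left | right; rewrite -e1].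
have [st' [q' [b' [hst' ps' /andP[q'0 q'k] X2E]]]] : exists st' q' b',
    [/\ st'.1 = id \/ st'.2 = id, perm_state k st', (0 < q' <= k)%N &
      X2 h' = (-1) ^+ (b' : bool) * poly_minor K k q' st'.1 st'.2].
  have [[q qk [_ e]]|[U [z [U' [eS2 e]]]]] := seed_var_chamber h' rep2 pm2.
    have [b' hb'] := set_minor_frac K k q st0.1 st0.2.
    exists st0, q, b'; split=> //; [by left | exact: perm_state_initial |].
    by apply: frac_inj; rewrite -hX2 e.
  set st' := run _ _ in e; have [b' hb'] := set_minor_frac K k z.2.+1 st'.1 st'.2.
  have va := rep_valid rep2; rewrite eS2 map_cat valid_cat in va.
  case/andP: va => va _; exists st', z.2.+1, b'; split.
  - have e3 : (a2 ++ b2 = map fst (rcons U (z, h')) ++ map fst U')%SEQ.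
      by rewrite -f2 eS2 map_cat.
    by have [h1|h2] := blue_first_prefix st0 ra2 rb2 e3; [left | right; rewrite -e2].
  - exact: perm_state_run va (perm_state_initial k).
  - apply: ltnW; apply: (valid_lt (rep_valid rep2) (t := (z, h'))).
    by rewrite eS2 mem_cat mem_rcons mem_head.
  - by apply: frac_inj; rewrite -hX2 e.
rewrite X1j X2E => /divides_sign; case: ps => pu pv; case: ps' => pu' pv'.
case/poly_minor_divides => //; try by apply: is_perm_injective_below; rewrite // ltnW.
move=> eq1 eq2 eq3; apply: (@chambers_disjoint k y1.2.+1 st q' st') => //.
Qed.

Lemma frozen_variable_polynomial y : is_frozen_variable s0 y ->
  exists q : R, y = frac q.
Proof. by move=> [j ->]; have [X ->] := s0_frac; eexists. Qed.

Lemma cluster_algebra_polynomial y : cluster_algebra iota s0 y <->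
  exists p : R, y = frac p.
Proof.
split.
  elim=> [z [/cluster_variable_polynomial|/frozen_variable_polynomial] //
         | c | z1 z2 _ [p ->] _ [q ->] | z1 z2 _ [p ->] _ [q ->]].
  - by exists c%:MP.
  - by exists (p + q); rewrite rmorphD.
  - by exists (p * q); rewrite rmorphM.
case=> p ->; elim/mpoly_alg_ind: p => [c | t | p q hp hq | p q hp hq].
- exact: (GenScalar iota _ c).
- have [ls [h ->]] := coordinate_reachable t; apply: GenIncl.
  by case: (seed_var_foldl_cases s0 ls h); [right | left].
- by rewrite rmorphD; apply: GenAdd.
- by rewrite rmorphM; apply: GenMul.
Qed.

Lemma generic_minor_variable (I J : {set 'I_k}) (eIJ : #|I| = #|J|) :
  (0 < #|I|)%N -> let D := frac (generic_minor K eIJ) in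
  is_frozen_variable s0 D \/ is_cluster_variable s0 D.
Proof.
move=> I0 D; have [st [ps e]] := generic_minor_chamber K eIJ.
have [|ls [h e']] := chamber_minor_reachable (q := #|I|) ps.
  by rewrite I0 /= -[X in (_ <= X)%N]card_ord max_card.
by rewrite /D e e'; apply: seed_var_foldl_cases.
Qed.

End Assembly.

Theorem minors_cluster_structure (K : numFieldType) (k : nat) (hk : (0 < k)%N) :
  exists (n f : nat) (s : seed_data (coord_field K k) n f),
    [/\ is_seed (scalar_in_field K k) s,
        (forall y : coord_field K k,
           cluster_algebra (scalar_in_field K k) s y <->
           exists p : {mpoly K[k * k]}, y = coord_in_field K k p)
      & (forall (I J : {set 'I_k}) (eIJ : #|I| = #|J|), (0 < #|I|)%N ->
           let D := coord_in_field K k (generic_minor K eIJ) in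
           is_frozen_variable s D \/ is_cluster_variable s D)].
Proof.
have [r [vr tr]] := extend_to_terminal k (initial_state k).
have [n [f [s0 [phi [w0 [nfE fw0 rep0 [sk un] [cov inn]]]]]]] :=
  initial_diagram (coord_frac K k) hk vr.
have nf : (n + f)%N = (k * k)%N.
  rewrite nfE (size_maximal_word vr tr). 
  by rewrite -[X in (X + _)%N]muln1 -mulnDr add1n prednK.
rewrite -fw0 in tr.
exists n, f, s0; split.
- exact: (s0_is_seed nf rep0 tr sk cov).
- exact: (cluster_algebra_polynomial nf rep0 tr sk un cov inn).
- exact: (generic_minor_variable rep0 tr).
Qed.

Theorem theorem6p6p1 (R : realType) (k : nat) (hk : (0 < k)%N) :
  exists (n f : nat) (s : seed_data (coord_field (complex R) k) n f),
    [/\ is_seed (scalar_in_field (complex R) k) s,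
        (forall y : coord_field (complex R) k,
           cluster_algebra (scalar_in_field (complex R) k) s y <->
           exists p : {mpoly (complex R)[k * k]},
             y = coord_in_field (complex R) k p)
      & (forall (I J : {set 'I_k}) (eIJ : #|I| = #|J|), (0 < #|I|)%N ->
           let D := coord_in_field (complex R) k
                      (generic_minor (complex R) eIJ) in
           is_frozen_variable s D \/ is_cluster_variable s D)].
Proof. exact: minors_cluster_structure. Qed.
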